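(* Let $\mathcal{X}$ be a real analytic planar vector field with a center at the origin, let $(p,q)\in W(\mathbf{N}(\mathcal{X}))$, let $\mathcal{Z}$ be the polar vector field of $\mathcal{X}$ in $(p,q)$-weighted polar coordinates $(\varphi,\rho)$, and assume that the set $\Omega_{pq}$ of characteristic directions is empty. Then $\mathcal{Z}$ admits an inverse integrating factor $V(\varphi,\rho)$ that is analytic at $\rho=0$, i.e. analytic on the cylinder $C$ including $\rho=0$, so that $V(\varphi,\rho)=\sum_{j\ge m} v_j(\varphi)\rho^j$ with leading exponent $m\geq 0$.
   Context: Let $\mathcal{X}=P(x,y)\partial_x+Q(x,y)\partial_y$ be a real analytic vector field near the origin of $\mathbb{R}^2$, with a monodromic singularity at the origin (nearby orbits rotate around it, so a Poincaré return map is defined on a small transversal section with endpoint at the origin). The origin is a center if all nearby orbits are periodic orbits surrounding it. Newton diagram and weights: write $P=\sum a_{ij}x^iy^{j-1}$, $Q=\sum b_{ij}x^{i-1}y^j$; the support of $\mathcal{X}$ is $\{(i,j):(a_{ij},b_{ij})\neq(0,0)\}$, and the Newton diagram $\mathbf{N}(\mathcal{X})$ is the union of the compact edges of the boundary of the convex hull of $\bigcup_{(i,j)\in\mathrm{supp}}((i,j)+\mathbb{R}_{\ge0}^2)$. Each edge has slope $-p/q$ with $(p,q)\in\mathbb{N}^2$ coprime; $W(\mathbf{N}(\mathcal{X}))\subset\mathbb{N}^2$ is the set of all such weights $(p,q)$. Polar vector field: with $x=\rho^p\cos\varphi$, $y=\rho^q\sin\varphi$, and after removing the common factor $\rho^r$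 (with $r$ the $(p,q)$-quasihomogeneous degree of the leading part of $\mathcal{X}$), $\mathcal{X}$ becomes the polar vector field $\mathcal{Z}=\Theta(\varphi,\rho)\partial_\varphi+R(\varphi,\rho)\partial_\rho$ with $R(\varphi,0)=0$ and $\Theta(\varphi,0)\ge0$ (the flow is taken counterclockwise). It is defined on the cylinder $C=\{(\varphi,\rho)\in\mathbb{S}^1\times\mathbb{R}:0\le\rho\ll1\}$, $\mathbb{S}^1=\mathbb{R}/(2\pi\mathbb{Z})$. The set of characteristic directions is $\Omega_{pq}=\{\varphi^*\in\mathbb{S}^1:\Theta(\varphi^*,0)=0\}$. An inverse integrating factor of $\mathcal{Z}$ on $C$ is a real function $V(\varphi,\rho)\not\equiv0$ of class $C^1(C\setminus\{\rho=0\})$ satisfying $\mathcal{Z}(V)=V\,\mathrm{div}(\mathcal{Z})$, where $\mathrm{div}(\mathcal{Z})=\partial_\varphi\Theta+\partial_\rho R$. In the expansion $V=\sum_{j\ge m}v_j(\varphi)\rho^j$ with $v_m\not\equiv0$, $m$ is called the leading exponent. *)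

(* Defs.v *)
From Stdlib Require Export Reals ZArith.
From Coquelicot Require Export Coquelicot.
Open Scope R_scope.

(** * Real analytic functions of two variables *)

(* [l] is the sum of the absolutely convergent double series
   [sum_(i,j) c i j * x^i * y^j]; absolute convergence makes the order of
   summation irrelevant. *)
Definition is_pseries2 (c : nat -> nat -> R) (x y l : R) : Prop :=
  (exists M : R, forall N : nat,
     sum_n (fun i => sum_n (fun j => Rabs (c i j * x ^ i * y ^ j)) N) N <= M)
  /\ is_series (fun i => Series (fun j => c i j * x ^ i * y ^ j)) l.

(* [c] is the family of Taylor coefficients of [f] at [(x0,y0)], the expansion
   being required at the points of [D] close to [(x0,y0)]. *)
Definition taylor_within (D : R * R -> Prop) (f : R -> R -> R) (x0 y0 : R)
    (c : nat -> nat -> R) : Prop :=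
  exists d : R, 0 < d /\
    forall x y : R, D (x, y) -> Rabs (x - x0) < d -> Rabs (y - y0) < d ->
      is_pseries2 c (x - x0) (y - y0) (f x y).

(* On an open [D] this is ordinary analyticity; on a set with boundary, [f]
   extends analytically across each boundary point belonging to [D]. *)
Definition analytic_on (D : R * R -> Prop) (f : R -> R -> R) : Prop :=
  forall x0 y0 : R, D (x0, y0) ->
    exists c : nat -> nat -> R, taylor_within D f x0 y0 c.

(** * Analytic vector fields near the origin, centers *)

(* The field [P d/dx + Q d/dy] on an open neighbourhood [dom] of the origin; the
   Taylor coefficients at the origin are determined by [P] and [Q].  The values
   of [P] and [Q] outside [dom] are irrelevant. *)
Record analytic_field : Type := AnalyticField {
  dom : R * R -> Prop;
  compP : R -> R -> R;
  compQ : R -> R -> R;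
  coefP : nat -> nat -> R;
  coefQ : nat -> nat -> R;
  dom_open : open dom;
  dom_origin : dom (0, 0);
  compP_analytic : analytic_on dom compP;
  compQ_analytic : analytic_on dom compQ;
  compP_taylor : taylor_within dom compP 0 0 coefP;
  compQ_taylor : taylor_within dom compQ 0 0 coefQ
}.

Definition is_periodic_solution (X : analytic_field) (x y : R -> R) : Prop :=
  (forall t : R, dom X (x t, y t)
     /\ is_derive x t (compP X (x t) (y t))
     /\ is_derive y t (compQ X (x t) (y t)))
  /\ exists T : R, 0 < T /\ forall t : R, x (t + T) = x t /\ y (t + T) = y t.

Definition orbit (x y : R -> R) (z : R * R) : Prop :=
  exists t : R, z = (x t, y t).

(* The origin lies in a bounded component of the complement of [O].  For [O]
   closed, components of the complement are path components.  An orbit reduced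
   to an equilibrium surrounds nothing. *)
Definition surrounds_origin (O : R * R -> Prop) : Prop :=
  ~ O (0, 0) /\
  exists B : R, forall cx cy : R -> R,
    (forall s : R, continuous cx s) -> (forall s : R, continuous cy s) ->
    cx 0 = 0 -> cy 0 = 0 ->
    (forall s : R, 0 <= s <= 1 -> ~ O (cx s, cy s)) ->
    Rabs (cx 1) <= B /\ Rabs (cy 1) <= B.

Definition is_center (X : analytic_field) : Prop :=
  compP X 0 0 = 0 /\ compQ X 0 0 = 0 /\
  exists U : R * R -> Prop, open U /\ U (0, 0) /\
    forall x0 y0 : R, U (x0, y0) -> (x0, y0) <> (0, 0) ->
      exists x y : R -> R,
        is_periodic_solution X x y /\ x 0 = x0 /\ y 0 = y0
        /\ surrounds_origin (orbit x y).

(** * Newton diagram and weights *)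

(* [P = sum a_ij x^i y^(j-1)] and [Q = sum b_ij x^(i-1) y^j]. *)
Definition newton_a (X : analytic_field) (i j : nat) : R :=
  match j with O => 0 | S l => coefP X i l end.

Definition newton_b (X : analytic_field) (i j : nat) : R :=
  match i with O => 0 | S k => coefQ X k j end.

Definition supp (X : analytic_field) (i j : nat) : Prop :=
  (newton_a X i j, newton_b X i j) <> (0, 0).

Definition affine_comb (t : R) (u v : R * R) : R * R :=
  ((1 - t) * fst u + t * fst v, (1 - t) * snd u + t * snd v).

Definition convex_set (K : R * R -> Prop) : Prop :=
  forall (u v : R * R) (t : R), K u -> K v -> 0 <= t <= 1 ->
    K (affine_comb t u v).

Definition convex_hull (S : R * R -> Prop) (z : R * R) : Prop :=
  forall K : R * R -> Prop, convex_set K -> (forall w, S w -> K w) -> K z.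

Definition newton_region (X : analytic_field) (z : R * R) : Prop :=
  exists i j : nat, supp X i j /\ INR i <= fst z /\ INR j <= snd z.

Definition segment (A B z : R * R) : Prop :=
  exists t : R, 0 <= t <= 1 /\ z = affine_comb t A B.

(* Compact edges of the boundary of a planar convex set with nonempty interior
   are its one-dimensional bounded faces. *)
Definition is_compact_edge (K : R * R -> Prop) (A B : R * R) : Prop :=
  A <> B /\ (forall z, segment A B z -> K z) /\
  forall (u v : R * R) (t : R), K u -> K v -> 0 < t < 1 ->
    segment A B (affine_comb t u v) -> segment A B u /\ segment A B v.

Definition newton_diagram_edge (X : analytic_field) (A B : R * R) : Prop :=
  is_compact_edge (convex_hull (newton_region X)) A B.

(* [(p,q)] belongs to [W(N(X))]: some edge of the diagram has slope [-p/q]. *)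
Definition newton_weight (X : analytic_field) (p q : nat) : Prop :=
  (0 < p)%nat /\ (0 < q)%nat /\ Nat.gcd p q = 1%nat /\
  exists A B : R * R, newton_diagram_edge X A B /\
    snd B - snd A = - (INR p / INR q) * (fst B - fst A).

(** * Weighted polar vector field *)

(* A monomial [(i,j)] of the support has [(p,q)]-quasihomogeneous degree
   [p*i + q*j - (p+q)] as a vector field; [r] is the least one. *)
Definition leading_degree (X : analytic_field) (p q : nat) (r : Z) : Prop :=
  (exists i j : nat, supp X i j /\
     (r + Z.of_nat (p + q) = Z.of_nat (p * i + q * j))%Z) /\
  (forall i j : nat, supp X i j ->
     (r + Z.of_nat (p + q) <= Z.of_nat (p * i + q * j))%Z).

(* The sum of [c k l * x^k * y^l] over [p*k + q*l = d]; for [0 < p] and [0 < q]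
   all such [k], [l] are at most [d]. *)
Definition qh_part (c : nat -> nat -> R) (p q : nat) (d : Z) (x y : R) : R :=
  sum_n (fun k => sum_n (fun l =>
    if Z.eq_dec (Z.of_nat (p * k + q * l)) d then c k l * x ^ k * y ^ l else 0)
    (Z.to_nat d)) (Z.to_nat d).

Definition polar_den (p q : nat) (phi : R) : R :=
  INR p * cos phi ^ 2 + INR q * sin phi ^ 2.

(* The polar field [Theta d/dphi + R d/drho] of [s * X], [s] being the sign
   that fixes the direction of the flow.  For [0 < rho], at
   [x = rho^p cos phi], [y = rho^q sin phi], it is obtained by solving
     [s * P(x,y) = rho^r * (dx/dphi * Theta + dx/drho * R)],
     [s * Q(x,y) = rho^r * (dy/dphi * Theta + dy/drho * R)],
   whose matrix has determinant of modulus [rho^(p+q-1) * polar_den p q phi];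
   at [rho = 0] it is the continuous extension, which only involves the leading
   quasihomogeneous part of [X]. *)
Definition polar_Theta (X : analytic_field) (p q : nat) (r : Z) (s : R)
    (phi rho : R) : R :=
  if Req_EM_T rho 0 then
    s * (INR p * cos phi
           * qh_part (coefQ X) p q (r + Z.of_nat q) (cos phi) (sin phi)
         - INR q * sin phi
           * qh_part (coefP X) p q (r + Z.of_nat p) (cos phi) (sin phi))
      / polar_den p q phi
  else
    let x := rho ^ p * cos phi in
    let y := rho ^ q * sin phi in
    s * (INR p * cos phi * rho ^ p * compQ X x y
         - INR q * sin phi * rho ^ q * compP X x y)
      / (powerRZ rho r * rho ^ (p + q) * polar_den p q phi).

Definition polar_R (X : analytic_field) (p q : nat) (r : Z) (s : R)
    (phi rho : R) : R :=
  if Req_EM_T rho 0 then 0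
  else
    let x := rho ^ p * cos phi in
    let y := rho ^ q * sin phi in
    s * rho * (rho ^ q * cos phi * compP X x y + rho ^ p * sin phi * compQ X x y)
      / (powerRZ rho r * rho ^ (p + q) * polar_den p q phi).

(* Angles are real representatives of points of [R/(2 pi Z)]. *)
Definition characteristic_directions (X : analytic_field) (p q : nat) (r : Z)
    (s : R) (phi : R) : Prop :=
  polar_Theta X p q r s phi 0 = 0.

(** * Inverse integrating factors on the cylinder *)

Definition cylinder (eps : R) (z : R * R) : Prop := 0 <= snd z < eps.

Definition in_polar_domain (X : analytic_field) (p q : nat) (eps : R) : Prop :=
  forall phi rho : R, cylinder eps (phi, rho) ->
    dom X (rho ^ p * cos phi, rho ^ q * sin phi).

Definition C1_at (V : R -> R -> R) (phi rho : R) : Prop :=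
  locally_2d (fun u v => ex_derive (fun w => V w v) u
                         /\ ex_derive (fun w => V u w) v) phi rho
  /\ continuity_2d_pt (fun u v => Derive (fun w => V w v) u) phi rho
  /\ continuity_2d_pt (fun u v => Derive (fun w => V u w) v) phi rho.

Definition divergence (Th Rr : R -> R -> R) (phi rho : R) : R :=
  Derive (fun u => Th u rho) phi + Derive (fun v => Rr phi v) rho.

Definition lie_derivative (Th Rr V : R -> R -> R) (phi rho : R) : R :=
  Th phi rho * Derive (fun u => V u rho) phi
  + Rr phi rho * Derive (fun v => V phi v) rho.

(* Functions on the cylinder are [2 pi]-periodic in the angle. *)
Definition inverse_integrating_factor (Th Rr : R -> R -> R) (eps : R)
    (V : R -> R -> R) : Prop :=
  (forall phi rho : R, cylinder eps (phi, rho) ->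
     V (phi + 2 * PI) rho = V phi rho)
  /\ (exists phi rho : R, 0 < rho < eps /\ V phi rho <> 0)
  /\ (forall phi rho : R, 0 < rho < eps -> C1_at V phi rho)
  /\ (forall phi rho : R, 0 < rho < eps ->
        lie_derivative Th Rr V phi rho = V phi rho * divergence Th Rr phi rho).

(* [V = sum_(j >= m) v_j(phi) rho^j] with [v_m] not identically zero. *)
Definition leading_exponent (V : R -> R -> R) (eps : R) (m : Z) : Prop :=
  exists v : Z -> R -> R,
    (exists phi : R, v m phi <> 0) /\
    forall phi rho : R, 0 < rho < eps ->
      is_series (fun k : nat =>
        v (m + Z.of_nat k)%Z phi * powerRZ rho (m + Z.of_nat k)) (V phi rho).

(* Main.v *)
(* Without characteristic directions [Theta > 0] near [rho = 0], and
   [R = rho * G * Theta] with [G] analytic.  A Jacobi multiplier of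
   [d rho / d phi = rho * G], that is a solution [U = sum u_k(phi) rho^k] of
   [U_phi + (rho G U)_rho = 0] with [U(0, rho) = 1], is computed coefficient by
   coefficient from a triangular linear system, and [V = Theta / U] is then an
   inverse integrating factor of the polar field, with leading exponent [0].

   Periodicity of the [u_k] is where the center is used.  If [u_K] were the first
   non-periodic one, correcting it by a multiple of [phi] gives a [2 pi]-periodic
   truncated first integral [sum_(k <= K) u_k rho^(k+1) / (k+1)] whose derivative
   along the flow is of exact order [rho^(K+1)] with a constant sign.  This strict
   Lyapunov function traps an orbit near the origin in one direction of time and
   prevents it from being periodic.

   Convergence is obtained by majorants: the functions of [phi] have Taylor
   coefficients bounded uniformly in the base point, and those of [u_k] are
   dominated by [C L^k A^i binomial(i + k, k)]. *)

Require Import Defs.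
From Stdlib Require Import Lia Lra Psatz IndefiniteDescription FunctionalExtensionality.
Open Scope R_scope.

(** * Finite sums *)

(** Why [V = Theta / U] works: the polar field is [V] times [U d/dphi + rho G U d/drho], and the
    equation for [U] says exactly that this second field has zero divergence. The same equation
    makes the [rho]-primitive of [U] a first integral, which is why the first defect of periodicity
    appears as a Lyapunov function. Two obstacles shape the estimates. The angle runs over a whole
    period, so a local Cauchy-Kovalevskaya argument does not suffice: the [u_k] are first bounded
    geometrically on one period by integrating the system, periodicity carries the bound to the
    whole line, and only then are their Taylor coefficients in [phi] estimated. Moreover the factor
    [k + 1] in front of the convolution is unbounded; it has to be absorbed in both estimates, by
    exponentials whose rate is proportional to [k + 1] in the first and by the binomial weights in
    the second. No flow or return map is constructed: the center supplies one periodic solution,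
    followed in weighted polar coordinates whose regularity in time must be proved. *)

Lemma sum_S_left (f : nat -> R) (n : nat) :
  sum_f_R0 f (S n) = f 0%nat + sum_f_R0 (fun k => f (S k)) n.
Proof. rewrite decomp_sum; [reflexivity | lia]. Qed.

Lemma sum_nonneg (f : nat -> R) (n : nat) :
  (forall k, (k <= n)%nat -> 0 <= f k) -> 0 <= sum_f_R0 f n.
Proof.
  induction n as [|n IH]; intros H; simpl.
  - apply H; lia.
  - apply Rplus_le_le_0_compat; [apply IH; intros; apply H; lia | apply H; lia].
Qed.

Lemma sum_mult_l (c : R) (f : nat -> R) (n : nat) :
  sum_f_R0 (fun k => c * f k) n = c * sum_f_R0 f n.
Proof. induction n as [|n IH]; simpl; [reflexivity | rewrite IH; ring]. Qed.

Lemma sum_le_extend (f : nat -> R) (m n : nat) :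
  (forall k, 0 <= f k) -> (m <= n)%nat -> sum_f_R0 f m <= sum_f_R0 f n.
Proof.
  intros H Hm; induction Hm; [lra|]. simpl. specialize (H (S m0)). lra.
Qed.

Lemma term_le_sum (f : nat -> R) (n : nat) :
  (forall k, 0 <= f k) -> f n <= sum_f_R0 f n.
Proof.
  intros H; destruct n; simpl; [lra|].
  assert (0 <= sum_f_R0 f n) by (apply sum_nonneg; auto). lra.
Qed.

Lemma sum_swap (f : nat -> nat -> R) (m n : nat) :
  sum_f_R0 (fun i => sum_f_R0 (f i) n) m
  = sum_f_R0 (fun j => sum_f_R0 (fun i => f i j) m) n.
Proof.
  induction m as [|m IH]; simpl; [reflexivity|].
  rewrite IH, <- sum_plus. reflexivity.
Qed.

(** [cauchy_finite] writes the product of the partial sums as the Cauchy products up to degree [N]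
    plus the remaining products of the square, which are nonnegative. *)
Lemma PS_mult_sum_le (A B : nat -> R) (N : nat) :
  (forall k, 0 <= A k) -> (forall k, 0 <= B k) ->
  sum_f_R0 (PS_mult A B) N <= sum_f_R0 A N * sum_f_R0 B N.
Proof.
  intros HA HB. destruct N as [|N]; [unfold PS_mult; simpl; lra|].
  rewrite (cauchy_finite A B (S N)) by lia. unfold PS_mult.
  match goal with |- _ <= _ + ?r => assert (0 <= r) end; [|lra].
  apply sum_nonneg; intros; apply sum_nonneg; intros.
  apply Rmult_le_pos; auto.
Qed.

Lemma PS_mult_pow (f g : nat -> R) (x : R) (n : nat) :
  PS_mult f g n * x ^ n = PS_mult (fun k => f k * x ^ k) (fun k => g k * x ^ k) n.
Proof.
  unfold PS_mult. rewrite Rmult_comm, scal_sum. apply sum_eq; intros i Hi.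
  replace (x ^ n) with (x ^ i * x ^ (n - i)) by (rewrite <- pow_add; f_equal; lia).
  ring.
Qed.

Lemma PS_mult_Rabs (f g : nat -> R) (n : nat) :
  Rabs (PS_mult f g n) <= PS_mult (fun k => Rabs (f k)) (fun k => Rabs (g k)) n.
Proof.
  unfold PS_mult. eapply Rle_trans; [apply Rsum_abs|].
  apply sum_Rle; intros; rewrite Rabs_mult; lra.
Qed.

(** The weight [S n] splits as [k + (S n - k)] on each term of the convolution. For derivatives
    normalized by factorials this is the Leibniz rule; it serves products, reciprocals and the
    linear system alike. *)
Lemma PS_mult_leibniz (f g : nat -> R) (n : nat) :
  sum_f_R0 (fun k => INR (S k) * f (S k) * g (n - k)%nat
                     + f k * (INR (S (n - k)) * g (S (n - k)))) n
  = INR (S n) * PS_mult f g (S n).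
Proof.
  rewrite sum_plus. unfold PS_mult. rewrite <- sum_mult_l.
  rewrite (sum_eq _ (fun k => INR k * f k * g (S n - k)%nat
                       + INR (S n - k) * f k * g (S n - k)%nat) (S n)).
  2:{ intros i Hi. rewrite minus_INR by lia. ring. }
  rewrite sum_plus. f_equal.
  - rewrite sum_S_left. rewrite Rmult_0_l, Rmult_0_l, Rplus_0_l.
    apply sum_eq; intros i Hi. reflexivity.
  - rewrite tech5. replace (S n - S n)%nat with 0%nat by lia.
    rewrite Rmult_0_l, Rmult_0_l, Rplus_0_r.
    apply sum_eq; intros i Hi. replace (S n - i)%nat with (S (n - i)) by lia. ring.
Qed.

(** A geometric sum of ratio at most one half. Growth constants are repeatedly doubled later in
    order to meet the hypothesis [2 * B <= L]. *)
Lemma sum_geom_le (B L : R) (n : nat) :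
  0 <= B -> 2 * B <= L -> sum_f_R0 (fun k => B ^ k * L ^ (n - k)) n <= 2 * L ^ n.
Proof.
  intros HB HL. assert (HL0 : 0 <= L) by lra.
  (* The extra [B ^ n] closes the induction: the new last term and the new extra term add up to
     [2 * B * B ^ n <= L * B ^ n]. *)
  assert (H : forall n, sum_f_R0 (fun k => B ^ k * L ^ (n - k)) n + B ^ n <= 2 * L ^ n).
  { clear n. induction n as [|n IH].
    - simpl; lra.
    - rewrite tech5. replace (S n - S n)%nat with 0%nat by lia.
      rewrite (sum_eq _ (fun k => L * (B ^ k * L ^ (n - k)))).
      2:{ intros i Hi. replace (S n - i)%nat with (S (n - i)) by lia. simpl; ring. }
      rewrite sum_mult_l. simpl.
      assert (0 <= B ^ n) by (apply pow_le; lra).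
      assert (L * (sum_f_R0 (fun k : nat => B ^ k * L ^ (n - k)) n + B ^ n)
               <= L * (2 * L ^ n)) by (apply Rmult_le_compat_l; lra).
      nra. }
  specialize (H n). assert (0 <= B ^ n) by (apply pow_le; lra). lra.
Qed.

Lemma sum_half_le (x : R) (n : nat) :
  0 <= x <= / 2 -> sum_f_R0 (fun k => x ^ k) n <= 2.
Proof.
  intros Hx. assert (H := sum_geom_le x 1 n).
  rewrite (sum_eq _ (fun k => x ^ k * 1 ^ (n - k))).
  - rewrite pow1 in H. lra.
  - intros; rewrite pow1; ring.
Qed.

(** * Derivatives *)

Lemma is_derive_sum_f_R0 (f : nat -> R -> R) (l : nat -> R) (x : R) (n : nat) :
  (forall k, (k <= n)%nat -> is_derive (f k) x (l k)) ->
  is_derive (fun y => sum_f_R0 (fun k => f k y) n) x (sum_f_R0 l n).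
Proof.
  induction n as [|n IH]; intros H; simpl.
  - apply H; lia.
  - apply (is_derive_plus (fun y => sum_f_R0 (fun k => f k y) n) (f (S n))).
    + apply IH; intros; apply H; lia.
    + apply H; lia.
Qed.

Lemma is_derive_Rmult (f g : R -> R) (x df dg : R) :
  is_derive f x df -> is_derive g x dg ->
  is_derive (fun y => f y * g y) x (df * g x + f x * dg).
Proof.
  intros Hf Hg. apply is_derive_Reals.
  apply (derivable_pt_lim_mult f g); apply is_derive_Reals; assumption.
Qed.

Lemma is_derive_Rplus (f g : R -> R) (x df dg : R) :
  is_derive f x df -> is_derive g x dg ->
  is_derive (fun y => f y + g y) x (df + dg).
Proof. apply (is_derive_plus f g). Qed.

Lemma is_derive_Rscal (f : R -> R) (x c df : R) :
  is_derive f x df -> is_derive (fun y => c * f y) x (c * df).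
Proof. intros H. apply (is_derive_scal f x c df H). Qed.

Lemma is_derive_eq (f : R -> R) (x l l' : R) :
  is_derive f x l -> l = l' -> is_derive f x l'.
Proof. intros H <-; exact H. Qed.

Lemma is_derive_Rcomp (f g : R -> R) (x df dg : R) :
  is_derive f (g x) df -> is_derive g x dg -> is_derive (fun y => f (g y)) x (dg * df).
Proof. apply (is_derive_comp f g). Qed.

Lemma is_derive_Rext (f g : R -> R) (x l : R) :
  (forall t, f t = g t) -> is_derive f x l -> is_derive g x l.
Proof. apply is_derive_ext. Qed.

(** * Course-of-values recursion *)

(** Table after [n] steps: the entries below [n] are final, all others hold the default [d]. *)
Fixpoint cov_hist {T : Type} (d : T) (G : nat -> (nat -> T) -> T) (n : nat)
  : nat -> T :=
  match n with
  | O => fun _ => d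
  | S k => fun m => if Nat.eq_dec m k then G k (cov_hist d G k) else cov_hist d G k m
  end.

(** The solution is the diagonal of the tables. That [G n] reads only entries below [n] is stated
    extensionally, so that [T] can be a type of functions, as in both later uses. *)
Lemma cov_exists {T : Type} (d : T) (G : nat -> (nat -> T) -> T) :
  (forall n u v, (forall m, (m < n)%nat -> u m = v m) -> G n u = G n v) ->
  exists z : nat -> T, forall n, z n = G n z.
Proof.
  intros HG. set (z := fun k => cov_hist d G (S k) k).
  assert (Hz : forall n m, (m < n)%nat -> cov_hist d G n m = z m).
  { induction n as [|n IH]; intros m Hm; [lia|].
    destruct (Nat.eq_dec m n) as [->|Hne]; [reflexivity|].
    simpl. destruct (Nat.eq_dec m n); [contradiction|]. apply IH; lia. }
  exists z. intros n. unfold z at 1. simpl.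
  destruct (Nat.eq_dec n n); [|contradiction].
  apply HG. intros m Hm. apply Hz, Hm.
Qed.

(* [inv_hist b n] tabulates the coefficients up to [n] of the reciprocal of the
   power series [b]; beyond [n] its values are meaningless. *)
Fixpoint inv_hist (b : nat -> R) (n : nat) : nat -> R :=
  match n with
  | O => fun _ => / b 0%nat
  | S k => fun m =>
      if Nat.eq_dec m (S k)
      then - / b 0%nat
           * sum_f_R0 (fun j => b (S j) * inv_hist b k (k - j)%nat) k
      else inv_hist b k m
  end.

Definition inv_seq (b : nat -> R) (n : nat) : R := inv_hist b n n.

Lemma inv_hist_seq (b : nat -> R) (n m : nat) :
  (m <= n)%nat -> inv_hist b n m = inv_seq b m.
Proof.
  induction n as [|n IH]; intros Hm.
  - replace m with 0%nat by lia. reflexivity.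
  - destruct (Nat.eq_dec m (S n)) as [->|Hne]; [reflexivity|].
    simpl. destruct (Nat.eq_dec m (S n)); [contradiction|]. apply IH; lia.
Qed.

Lemma inv_seq_S (b : nat -> R) (n : nat) :
  inv_seq b (S n)
  = - / b 0%nat * sum_f_R0 (fun j => b (S j) * inv_seq b (n - j)%nat) n.
Proof.
  unfold inv_seq at 1. cbn [inv_hist].
  destruct (Nat.eq_dec (S n) (S n)); [|contradiction].
  f_equal. apply sum_eq; intros i Hi. rewrite inv_hist_seq by lia. reflexivity.
Qed.

Lemma PS_mult_inv_0 (b : nat -> R) :
  b 0%nat <> 0 -> PS_mult b (inv_seq b) 0 = 1.
Proof. intros H; unfold PS_mult, inv_seq; simpl; field; exact H. Qed.

Lemma PS_mult_inv_S (b : nat -> R) (n : nat) :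
  b 0%nat <> 0 -> PS_mult b (inv_seq b) (S n) = 0.
Proof.
  intros H; unfold PS_mult. rewrite sum_S_left.
  replace (S n - 0)%nat with (S n) by lia. rewrite inv_seq_S.
  cbn [Nat.sub]. field; exact H.
Qed.

(** * Functions with uniformly bounded jets *)

(* [g i] is the [i]-th derivative of [f] divided by [i!]. *)
Definition jet (f : R -> R) (g : nat -> R -> R) : Prop :=
  (forall x, g 0%nat x = f x) /\
  forall i x, is_derive (g i) x (INR (S i) * g (S i) x).

(* The weighted l1 norm makes the bound [M] submultiplicative. *)
Definition An (a M : R) (f : R -> R) : Prop :=
  exists g, jet f g /\
    forall x n, sum_f_R0 (fun i => Rabs (g i x) * a ^ i) n <= M.

Lemma An_bound (a M : R) (f : R -> R) (x : R) : An a M f -> Rabs (f x) <= M.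
Proof.
  intros [g [[H0 _] Hb]]. specialize (Hb x 0%nat). simpl in Hb.
  rewrite H0 in Hb. lra.
Qed.

Lemma An_pos (a M : R) (f : R -> R) : An a M f -> 0 <= M.
Proof. intros H. apply (An_bound _ _ _ 0) in H. pose proof (Rabs_pos (f 0)). lra. Qed.

Lemma An_ext (a M : R) (f h : R -> R) : (forall x, f x = h x) -> An a M f -> An a M h.
Proof.
  intros E [g [[H0 H1] Hb]]. exists g. split; [split|]; auto.
  intros; rewrite H0; apply E.
Qed.

Lemma An_weaken (a a' M M' : R) (f : R -> R) :
  0 <= a' <= a -> M <= M' -> An a M f -> An a' M' f.
Proof.
  intros Ha HM [g [Hj Hb]]. exists g; split; [exact Hj|]. intros x n.
  eapply Rle_trans; [|apply HM]. eapply Rle_trans; [|apply (Hb x n)].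
  apply sum_Rle; intros i Hi. apply Rmult_le_compat_l; [apply Rabs_pos|].
  apply pow_incr; exact Ha.
Qed.

Lemma An_const (a c : R) : An a (Rabs c) (fun _ => c).
Proof.
  exists (fun i _ => match i with O => c | S _ => 0 end). split; [split|].
  - reflexivity.
  - intros i x. rewrite Rmult_0_r. destruct i; apply @is_derive_const.
  - intros x n. induction n as [|n IH]; simpl in *; [lra|].
    rewrite Rabs_R0, Rmult_0_l, Rplus_0_r. exact IH.
Qed.

Lemma An_plus (a M N : R) (f h : R -> R) :
  0 <= a -> An a M f -> An a N h -> An a (M + N) (fun x => f x + h x).
Proof.
  intros Ha [u [[U0 U1] Ub]] [v [[V0 V1] Vb]].
  exists (fun i x => u i x + v i x). split; [split|].
  - intros x; rewrite U0, V0; reflexivity.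
  - intros i x. eapply is_derive_eq; [apply is_derive_Rplus; [apply U1|apply V1]|]. ring.
  - intros x n. eapply Rle_trans; [|apply Rplus_le_compat; [apply (Ub x n)|apply (Vb x n)]].
    rewrite <- sum_plus. apply sum_Rle; intros i Hi.
    rewrite <- Rmult_plus_distr_r. apply Rmult_le_compat_r; [apply pow_le, Ha|].
    apply Rabs_triang.
Qed.

Lemma An_mult (a M N : R) (f h : R -> R) :
  0 <= a -> An a M f -> An a N h -> An a (M * N) (fun x => f x * h x).
Proof.
  intros Ha Hf Hh. pose proof (An_pos _ _ _ Hf) as HM. pose proof (An_pos _ _ _ Hh) as HN.
  destruct Hf as [u [[U0 U1] Ub]]. destruct Hh as [v [[V0 V1] Vb]].
  exists (fun i x => PS_mult (fun k => u k x) (fun k => v k x) i). split; [split|].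
  - intros x; unfold PS_mult; simpl. rewrite U0, V0; reflexivity.
  - intros i x. eapply is_derive_eq.
    + unfold PS_mult.
      apply (is_derive_sum_f_R0 (fun k y => u k y * v (i - k)%nat y)).
      intros k Hk. apply is_derive_Rmult; [apply U1|apply V1].
    + rewrite <- PS_mult_leibniz. apply sum_eq; intros; ring.
  - intros x n.
    assert (P : forall w : nat -> R -> R, forall k, 0 <= Rabs (w k x) * a ^ k).
    { intros w k. apply Rmult_le_pos; [apply Rabs_pos|apply pow_le, Ha]. }
    eapply Rle_trans; [|apply Rmult_le_compat; [| |apply (Ub x n)|apply (Vb x n)]].
    2,3: apply sum_nonneg; intros; apply P.
    eapply Rle_trans; [|apply PS_mult_sum_le; apply P].
    apply sum_Rle; intros i Hi. rewrite <- (PS_mult_pow (fun k => Rabs (u k x))).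
    apply Rmult_le_compat_r; [apply pow_le, Ha|]. apply PS_mult_Rabs.
Qed.

Lemma An_scal (a M c : R) (f : R -> R) :
  0 <= a -> An a M f -> An a (Rabs c * M) (fun x => c * f x).
Proof. intros Ha H. apply (An_mult a _ _ (fun _ => c)); auto. apply An_const. Qed.

Lemma An_sum (a : R) (M : nat -> R) (f : nat -> R -> R) (n : nat) :
  0 <= a -> (forall k, (k <= n)%nat -> An a (M k) (f k)) ->
  An a (sum_f_R0 M n) (fun x => sum_f_R0 (fun k => f k x) n).
Proof.
  intros Ha. induction n as [|n IH]; intros H; simpl.
  - apply (An_ext _ _ (f 0%nat)); [reflexivity|apply H; lia].
  - apply (An_plus a _ _ (fun x => sum_f_R0 (fun k => f k x) n)); auto.
Qed.

Lemma An_pow (a M : R) (f : R -> R) (n : nat) :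
  0 <= a -> An a M f -> An a (M ^ n) (fun x => f x ^ n).
Proof.
  intros Ha H. induction n as [|n IH]; simpl.
  - rewrite <- Rabs_R1 at 1. apply An_const.
  - apply An_mult; auto.
Qed.

Lemma An_derivable (a M : R) (f : R -> R) (x : R) : An a M f -> ex_derive f x.
Proof.
  intros [g [[H0 H1] _]]. apply (ex_derive_ext (g 0%nat)); [exact H0|].
  eexists; apply H1.
Qed.

Lemma sum_inv_fact_le (n : nat) : sum_f_R0 (fun i => / INR (fact i)) n <= 3.
Proof.
  (* The subtracted term closes the induction: from order two on, an inverse factorial is at most
     half of the preceding one. *)
  enough (H : sum_f_R0 (fun i => / INR (fact i)) n <= 3 - / INR (fact n)).
  { assert (0 < / INR (fact n)) by (apply Rinv_0_lt_compat, INR_fact_lt_0). lra. }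
  induction n as [|n IH]; [simpl; lra|].
  rewrite tech5. destruct n as [|n]; [simpl in *; lra|].
  assert (/ INR (fact (S (S n))) <= / 2 * / INR (fact (S n))).
  { rewrite fact_simpl, mult_INR, Rinv_mult.
    apply Rmult_le_compat_r; [left; apply Rinv_0_lt_compat, INR_fact_lt_0|].
    apply Rinv_le_contravar; [lra|]. rewrite !S_INR. pose proof (pos_INR n). lra. }
  lra.
Qed.

Lemma is_derive_comp_shift (f : R -> R) (l c x : R) :
  is_derive f (x + c) l -> is_derive (fun y => f (y + c)) x l.
Proof.
  intros H. eapply is_derive_eq.
  - apply (is_derive_comp f (fun y => y + c) x l 1 H).
    eapply is_derive_eq; [apply is_derive_Rplus; [apply is_derive_id|apply is_derive_const]|].
    unfold one, zero; simpl; ring.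
  - unfold scal; simpl; unfold mult; simpl; ring.
Qed.

(** Differentiating a sine shifts it by [PI / 2], so one computation covers [sin] and [cos]. The
    constant [3] bounds the sum of the inverse factorials. *)
Lemma An_sin_shift (c : R) : An 1 3 (fun x => sin (x + c)).
Proof.
  exists (fun i x => sin (x + c + INR i * (PI / 2)) / INR (fact i)). split; [split|].
  - intros x; simpl. rewrite Rmult_0_l, Rplus_0_r. field.
  - intros i x.
    apply (is_derive_Rext (fun y => / INR (fact i) * sin (y + (c + INR i * (PI / 2))))).
    { intros t. rewrite <- Rplus_assoc. unfold Rdiv. apply Rmult_comm. }
    eapply is_derive_eq.
    + apply is_derive_Rscal. apply is_derive_comp_shift. apply is_derive_Reals.
      apply derivable_pt_lim_sin.
    + rewrite S_INR, fact_simpl, mult_INR, S_INR.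
      replace (x + c + (INR i + 1) * (PI / 2))
        with (PI / 2 + (x + (c + INR i * (PI / 2)))) by ring.
      rewrite <- cos_sin. field. split; [apply INR_fact_neq_0|].
      pose proof (pos_INR i); lra.
  - intros x n. eapply Rle_trans; [|apply (sum_inv_fact_le n)].
    apply sum_Rle; intros i Hi. rewrite pow1, Rmult_1_r.
    unfold Rdiv. rewrite Rabs_mult.
    assert (0 < / INR (fact i)) by (apply Rinv_0_lt_compat, INR_fact_lt_0).
    rewrite (Rabs_pos_eq (/ INR (fact i))) by lra.
    rewrite <- (Rmult_1_l (/ INR (fact i))) at 2.
    apply Rmult_le_compat_r; [lra|]. apply Rabs_le, SIN_bound.
Qed.

Lemma An_sin : An 1 3 sin.
Proof.
  apply (An_ext _ _ (fun x => sin (x + 0))); [|apply An_sin_shift].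
  intros; rewrite Rplus_0_r; reflexivity.
Qed.

Lemma An_cos : An 1 3 cos.
Proof.
  apply (An_ext _ _ (fun x => sin (x + PI / 2))); [|apply An_sin_shift].
  intros; rewrite cos_sin, Rplus_comm; reflexivity.
Qed.

(** If [S] denotes a partial norm of the reciprocal jet, its recurrence bounds the next one by
    [/ c + / c * tail * S], where [tail] gathers the orders at least one of [f]. A smaller radius
    gives [tail <= c / 2], and then [2 / c] is a stable bound. *)
Lemma An_inv (a M c : R) (f : R -> R) :
  0 < a -> 0 < c -> An a M f -> (forall x, c <= f x) ->
  exists a' M', 0 < a' <= a /\ An a' M' (fun x => / f x).
Proof.
  intros Ha Hc Hf Hfc. pose proof (An_pos _ _ _ Hf) as HM.
  destruct Hf as [g [[G0 G1] Gb]].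
  (* Since [th <= 1], each [th ^ S k] is at most [th]; at radius [th * a] the orders at least one
     thus contribute at most [th * M <= c / 2]. *)
  set (th := c / (2 * (M + c))).
  assert (Hth : 0 < th <= 1).
  { unfold th; split; [apply Rdiv_lt_0_compat; lra|].
    apply Rmult_le_reg_r with (2 * (M + c)); [lra|]. field_simplify; lra. }
  exists (th * a), (2 / c). split; [nra|].
  assert (Hnz : forall x, g 0%nat x <> 0).
  { intros x; rewrite G0; specialize (Hfc x); lra. }
  exists (fun i x => inv_seq (fun k => g k x) i).
  assert (D0 : forall x, is_derive (fun y => / g 0%nat y) x
                 (INR 1 * inv_seq (fun k => g k x) 1)).
  { intros x. eapply is_derive_eq.
    - apply is_derive_inv; [apply (G1 0%nat)|apply Hnz].
    - rewrite inv_seq_S. simpl. unfold inv_seq; simpl. field. apply Hnz. }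
  split; [split|].
  - intros x; unfold inv_seq; simpl; rewrite G0; reflexivity.
  - induction i as [i IH] using (well_founded_induction Wf_nat.lt_wf). intros x.
    destruct i as [|i]; [apply D0|].
    apply (is_derive_Rext (fun y => - (/ g 0%nat y
       * sum_f_R0 (fun j => g (S j) y * inv_seq (fun k => g k y) (i - j)%nat) i))).
    { intros t. rewrite inv_seq_S. ring. }
    set (e := inv_seq (fun k => g k x)).
    assert (Ds : is_derive
      (fun y => sum_f_R0 (fun j => g (S j) y * inv_seq (fun k => g k y) (i - j)%nat) i) x
      (sum_f_R0 (fun j => INR (S (S j)) * g (S (S j)) x * e (i - j)%nat
               + g (S j) x * (INR (S (i - j)) * e (S (i - j)))) i)).
    { apply (is_derive_sum_f_R0
               (fun j y => g (S j) y * inv_seq (fun k => g k y) (i - j)%nat)).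
      intros j Hj. apply is_derive_Rmult; [apply G1|].
      apply (IH (i - j)%nat). lia. }
    eapply is_derive_eq.
    { apply (is_derive_opp (fun y => / g 0%nat y * _)).
      apply is_derive_Rmult; [apply D0|exact Ds]. }
    (* The coefficient of order [S (S i)] of [g] times its reciprocal is zero. The Leibniz identity
       therefore expresses the derivative [Sd] of the recurrence sum through [e (S i)] and
       [e (S (S i))]. *)
    assert (E := PS_mult_leibniz (fun k => g k x) e (S i)).
    assert (Ei : PS_mult (fun k => g k x) e (S (S i)) = 0) by apply PS_mult_inv_S, Hnz.
    rewrite Ei, Rmult_0_r in E.
    rewrite sum_S_left in E.
    replace (S i - 0)%nat with (S i) in E by lia.
    rewrite (sum_eq _ (fun j => INR (S (S j)) * g (S (S j)) x * e (i - j)%nat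
               + g (S j) x * (INR (S (i - j)) * e (S (i - j))))) in E.
    2:{ intros j Hj. replace (S i - S j)%nat with (i - j)%nat by lia. reflexivity. }
    set (Sd := sum_f_R0 (fun j => INR (S (S j)) * g (S (S j)) x * e (i - j)%nat
               + g (S j) x * (INR (S (i - j)) * e (S (i - j)))) i) in *.
    assert (E1 : e 1%nat = - / g 0%nat x * (g 1%nat x * / g 0%nat x)).
    { unfold e; rewrite inv_seq_S; reflexivity. }
    assert (E2 : e (S i) = - / g 0%nat x
       * sum_f_R0 (fun j => g (S j) x * e (i - j)%nat) i).
    { unfold e; rewrite inv_seq_S; reflexivity. }
    fold e. rewrite E1. clearbody Sd.
    set (sg := sum_f_R0 (fun j => g (S j) x * e (i - j)%nat) i) in *.
    unfold opp; simpl (AbelianGroup.opp _ _); simpl Rplus.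
    assert (Hz := Hnz x).
    assert (Hs : Sd = - (INR 1 * g 1%nat x * e (S i))
                      - g 0%nat x * (INR (S (S i)) * e (S (S i)))) by lra.
    rewrite Hs, E2. simpl (INR 1). change (sum_f_R0 _ i) with sg.
    simpl. field. exact Hz.
  - intros x.
    assert (Habs : forall k, 0 <= Rabs (inv_seq (fun k => g k x) k) * (th * a) ^ k).
    { intros k. apply Rmult_le_pos; [apply Rabs_pos|apply pow_le; nra]. }
    assert (Hi0 : Rabs (/ g 0%nat x) <= / c).
    { rewrite G0, Rabs_pos_eq.
      - apply Rinv_le_contravar; [lra|apply Hfc].
      - left; apply Rinv_0_lt_compat; specialize (Hfc x); lra. }
    assert (Htail : forall n, sum_f_R0 (fun k => Rabs (g (S k) x) * (th * a) ^ S k) n <= c / 2).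
    { intros n. apply Rle_trans with (th * M).
      - apply Rle_trans with (th * sum_f_R0 (fun k => Rabs (g k x) * a ^ k) (S n)).
        + rewrite sum_S_left. rewrite Rmult_plus_distr_l, <- sum_mult_l.
          assert (0 <= th * (Rabs (g 0%nat x) * a ^ 0)).
          { simpl. pose proof (Rabs_pos (g 0%nat x)). nra. }
          apply Rle_trans with (sum_f_R0 (fun k => th * (Rabs (g (S k) x) * a ^ S k)) n); [|lra].
          apply sum_Rle; intros k Hk. rewrite Rpow_mult_distr.
          assert (th ^ S k <= th).
          { assert (th ^ k <= 1 ^ k) by (apply pow_incr; lra).
            rewrite pow1 in *. simpl. nra. }
          assert (0 <= Rabs (g (S k) x) * a ^ S k).
          { apply Rmult_le_pos; [apply Rabs_pos|apply pow_le; lra]. }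
          nra.
        + apply Rmult_le_compat_l; [lra|apply Gb].
      - unfold th. apply Rmult_le_reg_r with (2 * (M + c)); [lra|].
        field_simplify; [nra|lra]. }
    induction n as [|n IH].
    + simpl. rewrite Rmult_1_r. unfold inv_seq; simpl.
      eapply Rle_trans; [apply Hi0|]. assert (0 < / c) by (apply Rinv_0_lt_compat; lra).
      unfold Rdiv; lra.
    + rewrite sum_S_left.
      assert (Hc' : 0 < / c) by (apply Rinv_0_lt_compat; lra).
      apply Rle_trans with (/ c + / c * (c / 2 * (2 / c))); [|right; field; lra].
      apply Rplus_le_compat; [simpl; rewrite Rmult_1_r; exact Hi0|].
      eapply Rle_trans; [|apply Rmult_le_compat_l; [lra|]; apply Rmult_le_compat;
         [| |apply (Htail n)|apply IH]].
      2:{ apply sum_nonneg; intros; apply Rmult_le_pos; [apply Rabs_pos|apply pow_le; nra]. }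
      2:{ apply sum_nonneg; intros; apply Habs. }
      eapply Rle_trans; [|apply Rmult_le_compat_l; [lra|]; apply PS_mult_sum_le].
      2:{ intros; apply Rmult_le_pos; [apply Rabs_pos|apply pow_le; nra]. }
      2: exact Habs.
      rewrite <- sum_mult_l. apply sum_Rle; intros k Hk.
      rewrite inv_seq_S, Rabs_mult, Rabs_Ropp, Rmult_assoc.
      apply Rmult_le_compat; [apply Rabs_pos| |exact Hi0|].
      { apply Rmult_le_pos; [apply Rabs_pos|apply pow_le; nra]. }
      rewrite Rmult_comm.
      eapply Rle_trans; [apply Rmult_le_compat_l; [apply pow_le; nra|]; apply Rsum_abs|].
      rewrite <- sum_mult_l. right. unfold PS_mult. apply sum_eq; intros j Hj.
      rewrite Rabs_mult.
      replace ((th * a) ^ S k) with ((th * a) ^ S j * (th * a) ^ (k - j)).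
      2:{ rewrite <- pow_add; f_equal; lia. }
      ring.
Qed.

(** * Power series with geometrically bounded coefficients *)

Lemma CV_radius_geom (c : nat -> R) (M L x : R) :
  0 < L -> (forall j, Rabs (c j) <= M * L ^ j) -> Rabs x * L < 1 ->
  Rbar_lt (Rabs x) (CV_radius c).
Proof.
  intros HL Hc Hx. apply Rbar_lt_le_trans with (/ L).
  - simpl. apply Rmult_lt_reg_r with L; [lra|]. rewrite Rinv_l; lra.
  - apply (CV_radius_bounded c). exists M. intros n.
    rewrite Rabs_mult, (Rabs_pos_eq ((/ L) ^ n)).
    2:{ apply pow_le. left; apply Rinv_0_lt_compat, HL. }
    rewrite pow_inv. assert (0 < L ^ n) by (apply pow_lt, HL).
    apply Rmult_le_reg_r with (L ^ n); [lra|].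
    rewrite Rmult_assoc, Rinv_l, Rmult_1_r by lra. apply Hc.
Qed.

Lemma Series_geom_half (q : R) : 0 <= q <= / 2 ->
  ex_series (fun n => q ^ n) /\ Series (fun n => q ^ n) <= 2.
Proof.
  intros Hq. assert (Rabs q < 1) by (rewrite Rabs_pos_eq; lra).
  split; [apply ex_series_geom; assumption|].
  rewrite Series_geom by assumption.
  replace 2 with (/ (/ 2)) by field. apply Rinv_le_contravar; lra.
Qed.

Lemma PSeries_geom_bound (c : nat -> R) (M L x : R) :
  0 < L -> (forall j, Rabs (c j) <= M * L ^ j) -> Rabs x * L <= / 2 ->
  Rabs (PSeries c x) <= 2 * M.
Proof.
  intros HL Hc Hx.
  assert (HM : 0 <= M).
  { specialize (Hc 0%nat). simpl in Hc. pose proof (Rabs_pos (c 0%nat)). lra. }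
  assert (Hq : 0 <= Rabs x * L <= / 2).
  { split; [|exact Hx]. apply Rmult_le_pos; [apply Rabs_pos|lra]. }
  destruct (Series_geom_half _ Hq) as [E1 E2].
  assert (Hb : forall n, Rabs (c n * x ^ n) <= M * (Rabs x * L) ^ n).
  { intros n. rewrite Rabs_mult, <- RPow_abs, Rpow_mult_distr.
    apply Rle_trans with (M * L ^ n * Rabs x ^ n); [|right; ring].
    apply Rmult_le_compat_r; [apply pow_le, Rabs_pos|apply Hc]. }
  assert (E3 : ex_series (fun n => M * (Rabs x * L) ^ n))
    by apply (ex_series_scal M _ E1).
  unfold PSeries.
  eapply Rle_trans; [apply Series_Rabs|].
  - apply (@ex_series_le R_AbsRing R_CompleteNormedModule _
             (fun n => M * (Rabs x * L) ^ n)); [|exact E3].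
    intros n. change (norm (Rabs (c n * x ^ n))) with (Rabs (Rabs (c n * x ^ n))).
    rewrite Rabs_Rabsolu. apply Hb.
  - eapply Rle_trans; [apply (Series_le _ (fun n => M * (Rabs x * L) ^ n))|].
    + intros n; split; [apply Rabs_pos|apply Hb].
    + exact E3.
    + rewrite Series_scal_l, (Rmult_comm 2). apply Rmult_le_compat_l; assumption.
Qed.

(** Two applications of the mean value theorem give [M] instead of the sharp [M / 2], which is
    enough to identify derivatives. *)
Lemma Rle_second_order (f df ddf : R -> R) (M x y : R) :
  (forall t, is_derive f t (df t)) -> (forall t, is_derive df t (ddf t)) ->
  (forall t, Rabs (ddf t) <= M) ->
  Rabs (f y - f x - (y - x) * df x) <= M * (y - x) ^ 2.
Proof.
  intros D1 D2 Hb.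
  assert (C : forall (h dh : R -> R), (forall t, is_derive h t (dh t)) ->
            forall t, continuity_pt h t).
  { intros h dh H t. apply derivable_continuous_pt.
    exists (dh t). apply is_derive_Reals, H. }
  destruct (MVT_gen f x y df) as [z [Hz E]].
  { intros; apply D1. } { intros; apply (C f df D1). }
  destruct (MVT_gen df x z ddf) as [z' [_ E']].
  { intros; apply D2. } { intros; apply (C df ddf D2). }
  rewrite E.
  replace (df z * (y - x) - (y - x) * df x) with (ddf z' * ((z - x) * (y - x)))
    by (rewrite <- Rmult_assoc, <- E'; ring).
  rewrite Rabs_mult. apply Rmult_le_compat; [apply Rabs_pos|apply Rabs_pos|apply Hb|].
  assert (Hzx : Rabs (z - x) <= Rabs (y - x)).
  { unfold Rmin, Rmax in Hz. unfold Rabs. destruct (Rle_dec x y);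
      destruct (Rcase_abs (z - x)), (Rcase_abs (y - x)); lra. }
  rewrite Rabs_mult, <- (pow2_abs (y - x)).
  pose proof (Rabs_pos (z - x)). nra.
Qed.

Lemma is_derive_quadratic (f : R -> R) (x l K : R) :
  (forall y, Rabs (f y - f x - (y - x) * l) <= K * (y - x) ^ 2) ->
  is_derive f x l.
Proof.
  intros H. apply is_derive_Reals. intros eps Heps.
  assert (HK : 0 <= K).
  { specialize (H (x + 1)). replace (x + 1 - x) with 1 in H by ring.
    pose proof (Rabs_pos (f (x + 1) - f x - 1 * l)). lra. }
  assert (Hd : 0 < eps / (K + 1)) by (apply Rdiv_lt_0_compat; lra).
  exists (mkposreal _ Hd). intros h Hh Hlt. simpl in Hlt.
  specialize (H (x + h)). replace (x + h - x) with h in H by ring.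
  replace ((f (x + h) - f x) / h - l) with ((f (x + h) - f x - h * l) / h)
    by (field; exact Hh).
  unfold Rdiv. rewrite Rabs_mult, Rabs_inv.
  assert (Hp : 0 < Rabs h) by (apply Rabs_pos_lt, Hh).
  rewrite <- (pow2_abs h) in H.
  apply Rle_lt_trans with (K * Rabs h).
  - apply Rmult_le_reg_r with (Rabs h); [lra|].
    rewrite Rmult_assoc, Rinv_l by lra. lra.
  - apply Rle_lt_trans with ((K + 1) * Rabs h); [nra|].
    apply Rmult_lt_reg_r with (/ (K + 1)); [apply Rinv_0_lt_compat; lra|].
    replace ((K + 1) * Rabs h * / (K + 1)) with (Rabs h) by (field; lra).
    exact Hlt.
Qed.

(** Bounds on the second derivatives make the first-order remainder of each coefficient quadratic in
    [y - x], with a constant geometric in [j]. Summed over [j], the remainder stays quadratic, so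
    the derivative is read off without exchanging limits. *)
Lemma is_derive_PSeries_param (c d e : nat -> R -> R) (M L x r : R) :
  0 < L -> Rabs r * L <= / 2 ->
  (forall j t, is_derive (c j) t (d j t)) ->
  (forall j t, is_derive (d j) t (e j t)) ->
  (forall j t, Rabs (c j t) <= M * L ^ j) ->
  (forall j t, Rabs (d j t) <= M * L ^ j) ->
  (forall j t, Rabs (e j t) <= M * L ^ j) ->
  is_derive (fun y => PSeries (fun j => c j y) r) x (PSeries (fun j => d j x) r).
Proof.
  intros HL Hr D1 D2 Bc Bd Be.
  assert (Hex : forall (h : nat -> R -> R) t, (forall j t, Rabs (h j t) <= M * L ^ j) ->
            ex_pseries (fun j => h j t) r).
  { intros h t Hh. apply CV_radius_inside. apply (CV_radius_geom _ M L); auto. lra. }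
  apply (is_derive_quadratic _ _ _ (2 * M)). intros y.
  replace (PSeries (fun j => c j y) r - PSeries (fun j => c j x) r
             - (y - x) * PSeries (fun j => d j x) r)
    with (PSeries (fun j => c j y - c j x - (y - x) * d j x) r).
  - rewrite Rmult_assoc, (Rmult_comm M), <- Rmult_assoc.
    apply Rle_trans with (2 * (M * (y - x) ^ 2)); [|right; ring].
    apply (PSeries_geom_bound _ _ L); auto. intros j.
    apply Rle_trans with (M * L ^ j * (y - x) ^ 2); [|right; ring].
    apply (Rle_second_order _ _ (e j)); auto.
  - rewrite <- (PSeries_scal (y - x)).
    rewrite <- PSeries_minus; [|apply (Hex c); auto|apply (Hex c); auto].
    rewrite <- PSeries_minus.
    + apply PSeries_ext; intros; unfold PS_minus, PS_plus, PS_scal, PS_opp; simpl.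
      unfold plus, opp, scal; simpl; unfold mult; simpl. ring.
    + apply (ex_pseries_minus (fun j => c j y) (fun j => c j x)); apply (Hex c); auto.
    + apply (ex_pseries_scal (y - x) (fun j => d j x)); [apply Rmult_comm|].
      apply (Hex d); auto.
Qed.

(** * Sequences of coefficients *)

Definition AnS (a M B : R) (w : nat -> R -> R) : Prop :=
  forall j, An a (M * B ^ j) (w j).

(** These are the coefficients in [t] of functions of [(x, t)] analytic near [t = 0], uniformly on
    the whole line of [x]: [a] controls the radius in [x] and [/ B] the radius in [t]. *)
Definition analytic_coeffs (w : nat -> R -> R) : Prop :=
  exists a M B, 0 < a /\ 0 < B /\ AnS a M B w.

Lemma AnS_pos (a M B : R) (w : nat -> R -> R) : AnS a M B w -> 0 <= M.
Proof. intros H. specialize (H 0%nat). apply An_pos in H. simpl in H; lra. Qed.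

Lemma AnS_weaken (a a' M M' B B' : R) (w : nat -> R -> R) :
  0 <= a' <= a -> M <= M' -> 0 <= B <= B' -> AnS a M B w -> AnS a' M' B' w.
Proof.
  intros Ha HM HB H j. pose proof (AnS_pos _ _ _ _ H).
  apply (An_weaken a a' (M * B ^ j)); auto.
  apply Rmult_le_compat; auto; [apply pow_le; lra|apply pow_incr; lra].
Qed.

(** Each [An] hides its own jet, so the family of jets comes from choice; the estimate keeps a
    single term of the weighted l1 sum. *)
Lemma AnS_jets (a M B : R) (w : nat -> R -> R) : 0 < a -> AnS a M B w ->
  exists G : nat -> nat -> R -> R, (forall j, jet (w j) (G j)) /\
    forall j i x, Rabs (G j i x) <= M * B ^ j * (/ a) ^ i.
Proof.
  intros Ha H.
  destruct (functional_choice (fun j G => jet (w j) G /\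
      forall x n, sum_f_R0 (fun i => Rabs (G i x) * a ^ i) n <= M * B ^ j) H) as [G HG].
  exists G. split; [intros j; apply HG|]. intros j i x.
  destruct (HG j) as [_ Hb]. specialize (Hb x i).
  assert (Hp : 0 < a ^ i) by (apply pow_lt, Ha).
  assert (Ht := term_le_sum (fun i => Rabs (G j i x) * a ^ i) i
           (fun k => Rmult_le_pos _ _ (Rabs_pos _) (pow_le _ _ (Rlt_le _ _ Ha)))).
  simpl in Ht. rewrite pow_inv. apply Rmult_le_reg_r with (a ^ i); [exact Hp|].
  rewrite Rmult_assoc, Rinv_l by lra. lra.
Qed.

Lemma analytic_coeffs_ext (w w' : nat -> R -> R) :
  (forall j x, w j x = w' j x) -> analytic_coeffs w -> analytic_coeffs w'.
Proof.
  intros E (a & M & B & Ha & HB & H). exists a, M, B. split; [|split]; auto.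
  intros j. apply (An_ext _ _ (w j)); auto.
Qed.

Lemma analytic_coeffs_common (w w' : nat -> R -> R) :
  analytic_coeffs w -> analytic_coeffs w' ->
  exists a M B, 0 < a /\ 0 < B /\ AnS a M B w /\ AnS a M B w'.
Proof.
  intros (a & M & B & Ha & HB & H) (a' & M' & B' & Ha' & HB' & H').
  exists (Rmin a a'), (Rmax M M'), (Rmax B B').
  pose proof (Rmin_l a a'); pose proof (Rmin_r a a').
  pose proof (Rmax_l M M'); pose proof (Rmax_r M M').
  pose proof (Rmax_l B B'); pose proof (Rmax_r B B').
  assert (0 < Rmin a a') by (apply Rmin_glb_lt; auto).
  repeat split; try lra.
  - apply (AnS_weaken a _ M _ B); auto; lra.
  - apply (AnS_weaken a' _ M' _ B'); auto; lra.
Qed.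

Lemma analytic_coeffs_mult (w w' : nat -> R -> R) :
  analytic_coeffs w -> analytic_coeffs w' ->
  analytic_coeffs (fun n x => PS_mult (fun k => w k x) (fun k => w' k x) n).
Proof.
  intros Hw Hw'.
  destruct (analytic_coeffs_common w w' Hw Hw') as (a & M & B & Ha & HB & H & H').
  pose proof (AnS_pos _ _ _ _ H).
  (* One factor is measured with [2 * B] instead of [B], so that the convolution of the two
     geometric bounds loses only a factor [2]. *)
  exists a, (2 * M * M), (2 * B). repeat split; try lra. intros n.
  apply (An_weaken a a (sum_f_R0 (fun k => (M * B ^ k) * (M * (2 * B) ^ (n - k))) n)).
  - lra.
  - rewrite (sum_eq _ (fun k => (M * M) * (B ^ k * (2 * B) ^ (n - k)))) by (intros; ring).
    rewrite sum_mult_l.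
    replace (2 * M * M * (2 * B) ^ n) with ((M * M) * (2 * (2 * B) ^ n)) by ring.
    apply Rmult_le_compat_l; [nra|]. apply sum_geom_le; lra.
  - unfold PS_mult. apply (An_sum a _ (fun k x => w k x * w' (n - k)%nat x)); [lra|].
    intros k Hk. apply An_mult; [lra|apply H|].
    apply (AnS_weaken a a M M B (2 * B)); auto; lra.
Qed.

Lemma analytic_coeffs_inv (b : nat -> R -> R) (c : R) :
  0 < c -> (forall x, c <= b 0%nat x) -> analytic_coeffs b ->
  analytic_coeffs (fun n x => inv_seq (fun k => b k x) n).
Proof.
  intros Hc Hb (a & M & B & Ha & HB & H). pose proof (AnS_pos _ _ _ _ H) as HM.
  destruct (An_inv a (M * B ^ 0) c (b 0%nat) Ha Hc (H 0%nat) Hb) as (a' & K & Ha' & HK).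
  pose proof (An_pos _ _ _ HK) as HK0.
  assert (HKM : 0 <= K * M) by (apply Rmult_le_pos; auto).
  (* The part [2 * B] provides the ratio required by [sum_geom_le]; the part [2 * B * (K * M)]
     absorbs the constant produced by one step of the recurrence. *)
  set (B' := 2 * B * (1 + K * M)).
  assert (HB' : 2 * B <= B') by (unfold B'; nra).
  exists a', K, B'. split; [lra|split; [lra|]]. intros n.
  induction n as [n IH] using (well_founded_induction Wf_nat.lt_wf).
  destruct n as [|n].
  - simpl. rewrite Rmult_1_r. apply (An_ext _ _ (fun x => / b 0%nat x)); auto.
  - apply (An_ext _ _ (fun x => (-1) * (/ b 0%nat x
        * sum_f_R0 (fun j => b (S j) x * inv_seq (fun k => b k x) (n - j)%nat) n))).
    { intros x. rewrite inv_seq_S. ring. }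
    eapply An_weaken with (a := a')
      (M := Rabs (-1) * (K * sum_f_R0 (fun j => (M * B ^ S j) * (K * B' ^ (n - j))) n)).
    + lra.
    + rewrite (sum_eq _ (fun k => (M * B * K) * (B ^ k * B' ^ (n - k))))
        by (intros; simpl; ring).
      rewrite sum_mult_l, (Rabs_left (-1)) by lra.
      apply Rle_trans with (K * (M * B * K * (2 * B' ^ n))).
      * replace (- (-1)) with 1 by lra. rewrite Rmult_1_l.
        apply Rmult_le_compat_l; auto. apply Rmult_le_compat_l; [nra|].
        apply sum_geom_le; lra.
      * simpl. assert (0 <= B' ^ n) by (apply pow_le; lra).
        apply Rle_trans with (K * ((2 * B * (K * M)) * B' ^ n)); [right; ring|].
        apply Rmult_le_compat_l; auto. apply Rmult_le_compat_r; auto. unfold B'; nra.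
    + apply An_scal; [lra|]. apply An_mult; [lra|exact HK|].
      apply (An_sum a' _ (fun j x => b (S j) x * inv_seq (fun k => b k x) (n - j)%nat)); [lra|].
      intros j Hj. apply An_mult; [lra| |apply IH; lia].
      apply (An_weaken a a' (M * B ^ S j)); [lra|lra|apply H].
Qed.

(** * Joint analyticity of the sum *)

(* Symmetric indexing of the binomial coefficients keeps Pascal's rule
   subtraction-free. *)
Definition bc (i k : nat) : R := INR (fact (i + k)) / (INR (fact i) * INR (fact k)).

Lemma bc_0_l (k : nat) : bc 0 k = 1.
Proof. unfold bc; simpl; field. apply INR_fact_neq_0. Qed.

Lemma bc_0_r (k : nat) : bc k 0 = 1.
Proof. unfold bc. rewrite Nat.add_0_r. simpl; field. apply INR_fact_neq_0. Qed.

Lemma bc_pos (i k : nat) : 0 < bc i k.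
Proof.
  unfold bc. apply Rdiv_lt_0_compat; [|apply Rmult_lt_0_compat]; apply INR_fact_lt_0.
Qed.

Lemma bc_S_l (i k : nat) : INR (S i) * bc (S i) k = bc i k * INR (S (i + k)).
Proof.
  unfold bc. rewrite Nat.add_succ_l, !fact_simpl, !mult_INR. field.
  repeat split; try apply INR_fact_neq_0. apply not_0_INR; lia.
Qed.

Lemma bc_S_r (i k : nat) : INR (S k) * bc i (S k) = bc i k * INR (S (i + k)).
Proof.
  unfold bc. rewrite Nat.add_succ_r, !fact_simpl, !mult_INR. field.
  repeat split; try apply INR_fact_neq_0. apply not_0_INR; lia.
Qed.

Lemma bc_pascal (i k : nat) : bc (S i) (S k) = bc i (S k) + bc (S i) k.
Proof.
  unfold bc. rewrite Nat.add_succ_r, Nat.add_succ_l, !fact_simpl, !mult_INR.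
  rewrite Nat.add_succ_r, !fact_simpl, !mult_INR.
  rewrite !S_INR, plus_INR. field. pose proof (pos_INR i); pose proof (pos_INR k).
  repeat split; try apply INR_fact_neq_0; lra.
Qed.

Lemma bc_le (i k : nat) : bc i k <= 2 ^ (i + k).
Proof.
  assert (H1 : forall n, 1 <= 2 ^ n) by (intros; apply pow_R1_Rle; lra).
  revert k; induction i as [|i IH]; intros k; [rewrite bc_0_l; apply H1|].
  induction k as [|k IHk]; [rewrite bc_0_r; apply H1|].
  rewrite bc_pascal. specialize (IH (S k)).
  replace (S i + S k)%nat with (S (i + S k)) by lia.
  replace (S i + k)%nat with (i + S k)%nat in IHk by lia.
  simpl. lra.
Qed.

(** [T i l] is the mixed partial derivative of order [(i, l)] of the sum, divided by both
    factorials. Its bound does not depend on the base point, which later gives Taylor expansions on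
    neighbourhoods of fixed size. *)
Lemma analytic_coeffs_jets (w : nat -> R -> R) : analytic_coeffs w ->
  exists (r K A : R) (T : nat -> nat -> R -> R -> R),
    0 < r /\ 0 < A /\
    (forall x t, T 0%nat 0%nat x t = PSeries (fun j => w j x) t) /\
    (forall x t, T 1%nat 0%nat x t = PSeries (fun j => Derive (w j) x) t) /\
    (forall i l x t, Rabs t < r ->
       is_derive (fun y => T i l y t) x (INR (S i) * T (S i) l x t) /\
       is_derive (fun y => T i l x y) t (INR (S l) * T i (S l) x t) /\
       Rabs (T i l x t) <= K * A ^ i * A ^ l) /\
    (forall x t, Rabs t < r -> Rbar_lt (Rabs t) (CV_radius (fun j => w j x))).
Proof.
  intros (a & M & B & Ha & HB & H). pose proof (AnS_pos _ _ _ _ H) as HM.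
  destruct (AnS_jets a M B w Ha H) as (G & HG & Gb).
  assert (Hia : 0 < / a) by (apply Rinv_0_lt_compat, Ha).
  (* Differentiating [l] times in [t] and dividing by [l!] turns the coefficient of index [j + l]
     into that of index [j], with the binomial factor [bc j l]. *)
  set (cf := fun i l j x => bc j l * G (j + l)%nat i x).
  assert (cfb : forall i l j x,
            Rabs (cf i l j x) <= (M * (/ a) ^ i * (2 * B) ^ l) * (2 * B) ^ j).
  { intros i l j x. unfold cf. rewrite Rabs_mult, Rabs_pos_eq by (left; apply bc_pos).
    apply Rle_trans with (2 ^ (j + l) * (M * B ^ (j + l) * (/ a) ^ i)).
    - apply Rmult_le_compat; [left; apply bc_pos|apply Rabs_pos|apply bc_le|apply Gb].
    - right. rewrite !Rpow_mult_distr, !pow_add. ring. }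
  set (T := fun i l x t => PSeries (fun j => cf i l j x) t).
  set (A := Rmax (/ a) (2 * B)).
  assert (A1 : / a <= A) by apply Rmax_l. assert (A2 : 2 * B <= A) by apply Rmax_r.
  (* The factor [bc j l <= 2 ^ (j + l)] doubles the growth rate to [2 * B]; for [Rabs t < / (4 * B)]
     the series still has ratio at most one half, hence a sum at most twice its constant. *)
  exists (/ (4 * B)), (2 * M), A, T.
  assert (Hr : 0 < / (4 * B)) by (apply Rinv_0_lt_compat; lra).
  assert (Hhalf : forall t, Rabs t < / (4 * B) -> Rabs t * (2 * B) <= / 2).
  { intros t Ht. apply Rle_trans with (/ (4 * B) * (2 * B)).
    - apply Rmult_le_compat_r; lra.
    - right; field; lra. }
  split; [exact Hr|]. split; [lra|]. split; [|split; [|split]].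
  - intros x t. unfold T. apply PSeries_ext; intros j. unfold cf.
    rewrite bc_0_r, Nat.add_0_r. destruct (HG j) as [H0 _]. rewrite H0; ring.
  - intros x t. unfold T. apply PSeries_ext; intros j. unfold cf.
    rewrite bc_0_r, Nat.add_0_r. destruct (HG j) as [H0 H1].
    symmetry. rewrite Rmult_1_l. apply is_derive_unique.
    apply (is_derive_Rext (G j 0%nat)); [exact H0|].
    eapply is_derive_eq; [apply H1|]. simpl; ring.
  - intros i l x t Ht. specialize (Hhalf t Ht). split; [|split].
    + unfold T.
      replace (INR (S i) * PSeries (fun j => cf (S i) l j x) t)
        with (PSeries (fun j => INR (S i) * cf (S i) l j x) t).
      2:{ rewrite <- PSeries_scal. apply PSeries_ext; reflexivity. }
      pose (Mi := Rmax (M * (/ a) ^ i * (2 * B) ^ l)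
             (Rmax (INR (S i) * (M * (/ a) ^ (S i) * (2 * B) ^ l))
                (INR (S i) * INR (S (S i)) * (M * (/ a) ^ (S (S i)) * (2 * B) ^ l)))).
      assert (P2 : forall j, 0 <= (2 * B) ^ j) by (intros; apply pow_le; lra).
      apply (is_derive_PSeries_param (cf i l) (fun j x => INR (S i) * cf (S i) l j x)
          (fun j x => INR (S i) * INR (S (S i)) * cf (S (S i)) l j x)
          Mi (2 * B)); auto; try lra.
      * intros j y. unfold cf. eapply is_derive_eq.
        { apply is_derive_Rscal. apply (HG (j + l)%nat). } ring.
      * intros j y. unfold cf. eapply is_derive_eq.
        { apply is_derive_Rscal. apply is_derive_Rscal. apply (HG (j + l)%nat). } ring.
      * intros j y. eapply Rle_trans; [apply cfb|]. apply Rmult_le_compat_r; [apply P2|].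
        apply Rmax_l.
      * intros j y. rewrite Rabs_mult, Rabs_pos_eq by apply pos_INR.
        eapply Rle_trans; [apply Rmult_le_compat_l; [apply pos_INR|apply cfb]|].
        rewrite <- Rmult_assoc. apply Rmult_le_compat_r; [apply P2|].
        eapply Rle_trans; [apply Rmax_l|apply Rmax_r].
      * intros j y. rewrite Rabs_mult, Rabs_pos_eq.
        2:{ apply Rmult_le_pos; apply pos_INR. }
        eapply Rle_trans; [apply Rmult_le_compat_l;
          [apply Rmult_le_pos; apply pos_INR|apply cfb]|].
        rewrite <- Rmult_assoc. apply Rmult_le_compat_r; [apply P2|].
        eapply Rle_trans; [apply Rmax_r|apply Rmax_r].
    + unfold T.
      replace (INR (S l) * PSeries (fun j => cf i (S l) j x) t)
        with (PSeries (PS_derive (fun j => cf i l j x)) t).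
      { apply is_derive_PSeries.
        apply (CV_radius_geom _ _ (2 * B)) with (2 := fun j => cfb i l j x);
          lra. }
      rewrite <- PSeries_scal. apply PSeries_ext; intros j.
      unfold PS_derive, PS_scal, cf, scal; simpl; unfold mult; simpl.
      change (match j with 0%nat => 1 | S _ => INR j + 1 end) with (INR (S j)).
      change (match l with 0%nat => 1 | S _ => INR l + 1 end) with (INR (S l)).
      rewrite <- !Rmult_assoc, bc_S_l, bc_S_r, Nat.add_succ_r. reflexivity.
    + unfold T. eapply Rle_trans.
      * apply (PSeries_geom_bound _ _ (2 * B)) with (2 := fun j => cfb i l j x); lra.
      * rewrite <- !Rmult_assoc.
        apply Rmult_le_compat; [|apply pow_le; lra| |apply pow_incr; lra].
        { apply Rmult_le_pos; [lra|apply pow_le; lra]. }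
        apply Rmult_le_compat_l; [lra|]. apply pow_incr; lra.
  - intros x t Ht. apply (CV_radius_geom _ M B).
    + lra.
    + intros j. destruct (HG j) as [H0 _]. specialize (Gb j 0%nat x).
      rewrite H0 in Gb. simpl in Gb. lra.
    + specialize (Hhalf t Ht). pose proof (Rabs_pos t). nra.
Qed.

Lemma taylor_jet_series (G : nat -> R -> R) (lo hi K A x0 x : R) :
  lo < x0 < hi -> lo < x < hi -> 0 < A -> Rabs (x - x0) * A <= / 2 ->
  (forall n t, lo < t < hi -> is_derive (G n) t (INR (S n) * G (S n) t)) ->
  (forall n t, lo < t < hi -> Rabs (G n t) <= K * A ^ n) ->
  is_series (fun n => G n x0 * (x - x0) ^ n) (G 0%nat x).
Proof.
  intros H0 Hx HA Hh HD Hb.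
  (* Taylor polynomial as a function of its base point [t], the target [x] being fixed. Its
     derivative telescopes to one term and [E n x = G 0 x], so the mean value theorem gives the
     remainder in Cauchy form. *)
  set (E := fun n t => sum_f_R0 (fun i => G i t * (x - t) ^ i) n).
  assert (ED : forall n t, lo < t < hi ->
            is_derive (E n) t (INR (S n) * G (S n) t * (x - t) ^ n)).
  { intros n t Ht. induction n as [|n IH].
    - unfold E; simpl. apply (is_derive_Rext (G 0%nat)).
      { intros; ring. }
      eapply is_derive_eq; [apply HD, Ht|]. simpl; ring.
    - unfold E; simpl. fold (E n).
      eapply is_derive_eq.
      { apply (is_derive_Rplus (E n) (fun t => G (S n) t * ((x - t) ^ S n))).
        - apply IH.
        - apply is_derive_Rmult; [apply HD, Ht|].
          apply (is_derive_pow (fun t => x - t) (S n) t (-1)).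
          eapply is_derive_eq.
          + apply (is_derive_minus (fun _ => x) (fun y => y));
              [apply @is_derive_const|apply @is_derive_id].
          + unfold minus, plus, opp, zero, one; simpl; ring. }
      simpl. ring. }
  assert (Hrem : forall n, Rabs (G 0%nat x - E n x0)
            <= K * A * Rabs (x - x0) * (INR (S n) * (/ 2) ^ n)).
  { intros n.
    destruct (MVT_gen (E n) x0 x (fun t => INR (S n) * G (S n) t * (x - t) ^ n))
      as [z [Hz Ez]].
    { intros t Ht. apply ED. unfold Rmin, Rmax in Ht. destruct (Rle_dec x0 x); lra. }
    { intros t Ht. apply derivable_continuous_pt. eexists. apply is_derive_Reals, ED.
      unfold Rmin, Rmax in Ht. destruct (Rle_dec x0 x); lra. }
    assert (Hz' : lo < z < hi /\ Rabs (x - z) <= Rabs (x - x0)).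
    { unfold Rmin, Rmax in Hz. unfold Rabs. destruct (Rle_dec x0 x);
        destruct (Rcase_abs (x - z)), (Rcase_abs (x - x0)); lra. }
    destruct Hz' as [Hz1 Hz2].
    replace (G 0%nat x) with (E n x).
    2:{ unfold E. clear. induction n as [|n IH]; simpl; [ring|].
        rewrite IH. replace (x - x) with 0 by ring. ring. }
    rewrite Ez, !Rabs_mult, (Rabs_pos_eq (INR (S n))) by apply pos_INR.
    rewrite <- RPow_abs.
    apply Rle_trans with (INR (S n) * (K * A ^ S n) * Rabs (x - x0) ^ n * Rabs (x - x0)).
    - apply Rmult_le_compat_r; [apply Rabs_pos|].
      apply Rmult_le_compat.
      + apply Rmult_le_pos; [apply pos_INR|apply Rabs_pos].
      + apply pow_le, Rabs_pos.
      + apply Rmult_le_compat_l; [apply pos_INR|apply Hb, Hz1].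
      + apply pow_incr; split; [apply Rabs_pos|exact Hz2].
    - assert (HK : 0 <= K).
      { specialize (Hb 0%nat x Hx). simpl in Hb. pose proof (Rabs_pos (G 0%nat x)). lra. }
      apply Rle_trans with (K * A * Rabs (x - x0) * (INR (S n) * (Rabs (x - x0) * A) ^ n)).
      + right. rewrite Rpow_mult_distr. simpl. ring.
      + apply Rmult_le_compat_l.
        { apply Rmult_le_pos; [nra|apply Rabs_pos]. }
        apply Rmult_le_compat_l; [apply pos_INR|]. apply pow_incr.
        split; [apply Rmult_le_pos; [apply Rabs_pos|lra]|lra]. }
  apply is_series_Reals.
  (* [INR (S n) * (/ 2) ^ n] is the general term of the differentiated geometric series at [/ 2],
     hence tends to zero. *)
  assert (Hlim : is_lim_seq (fun n => K * A * Rabs (x - x0) * (INR (S n) * (/ 2) ^ n)) 0).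
  { replace (Finite 0) with (Rbar_mult (K * A * Rabs (x - x0)) 0) by (simpl; f_equal; ring).
    apply is_lim_seq_scal_l.
    apply (ex_series_lim_0 (fun n => INR (S n) * (/ 2) ^ n)).
    apply (ex_series_ext (fun n => PS_derive (fun _ => 1) n * (/ 2) ^ n)).
    { intros n. unfold PS_derive. rewrite Rmult_1_r. reflexivity. }
    apply ex_pseries_R. apply CV_radius_inside. rewrite CV_radius_derive.
    apply (CV_radius_geom _ 1 1); [lra| |].
    - intros; cbv beta. rewrite Rabs_R1, pow1. lra.
    - rewrite Rabs_pos_eq; lra. }
  intros eps Heps.
  apply is_lim_seq_spec in Hlim. destruct (Hlim (mkposreal eps Heps)) as [N HN].
  exists N. intros n Hn. specialize (HN n Hn). simpl in HN.
  unfold R_dist. rewrite <- Rabs_Ropp, Ropp_minus_distr.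
  eapply Rle_lt_trans; [apply (Hrem n)|].
  eapply Rle_lt_trans; [apply Rle_abs|]. rewrite Rminus_0_r in HN. exact HN.
Qed.

Lemma is_series_Rext (u v : nat -> R) (l : R) :
  (forall n, u n = v n) -> is_series u l -> is_series v l.
Proof. apply is_series_ext. Qed.

Lemma MVT_Rabs_le (f df : R -> R) (lo hi K x y : R) :
  lo < x < hi -> lo < y < hi ->
  (forall t, lo < t < hi -> is_derive f t (df t) /\ Rabs (df t) <= K) ->
  Rabs (f y - f x) <= K * Rabs (y - x).
Proof.
  intros Hx Hy H.
  destruct (MVT_gen f x y df) as [z [Hz E]].
  { intros t Ht. apply H. unfold Rmin, Rmax in Ht. destruct (Rle_dec x y); lra. }
  { intros t Ht. apply derivable_continuous_pt. eexists. apply is_derive_Reals.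
    apply (H t). unfold Rmin, Rmax in Ht. destruct (Rle_dec x y); lra. }
  rewrite E, Rabs_mult. apply Rmult_le_compat_r; [apply Rabs_pos|].
  apply H. unfold Rmin, Rmax in Hz. destruct (Rle_dec x y); lra.
Qed.

Definition coeff_sum (w : nat -> R -> R) (x t : R) : R := PSeries (fun j => w j x) t.

(** Everything follows from the uniform jets [T]. They are controlled for both signs of [t], so a
    point with [t0 = 0], on the boundary of the cylinder, is treated as an interior one. *)
Lemma analytic_coeffs_regular (w : nat -> R -> R) : analytic_coeffs w ->
  exists r K, 0 < r /\ 0 <= K /\
    (forall x t, Rabs t < r -> Rbar_lt (Rabs t) (CV_radius (fun j => w j x))) /\
    (forall x t, Rabs t < r ->
       is_derive (fun y => coeff_sum w y t) x (coeff_sum (fun j => Derive (w j)) x t)) /\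
    (forall x t, Rabs t < r -> Rabs (coeff_sum w x t - w 0%nat x) <= K * Rabs t) /\
    analytic_on (cylinder r) (coeff_sum w) /\
    (forall x t, Rabs t < r -> C1_at (coeff_sum w) x t).
Proof.
  intros Hw.
  destruct (analytic_coeffs_jets w Hw) as (r & K & A & T & Hr & HA & T00 & T10 & HT & HCV).
  assert (T00' : forall x t, T 0%nat 0%nat x t = coeff_sum w x t) by exact T00.
  assert (HTr : forall i l x t, Rabs t < r ->
     is_derive (fun y => T i l y t) x (INR (S i) * T (S i) l x t)) by apply HT.
  assert (HTt : forall i l x t, Rabs t < r ->
     is_derive (fun y => T i l x y) t (INR (S l) * T i (S l) x t)) by apply HT.
  assert (HTb : forall i l x t, Rabs t < r -> Rabs (T i l x t) <= K * A ^ i * A ^ l)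
    by apply HT.
  assert (HK : 0 <= K).
  { specialize (HTb 0%nat 0%nat 0 0). rewrite Rabs_R0 in HTb. specialize (HTb Hr).
    pose proof (Rabs_pos (T 0%nat 0%nat 0 0)). simpl in HTb. lra. }
  assert (Hin : forall t, Rabs t < r <-> - r < t < r).
  { intros t. split; [intros H; apply Rabs_def2 in H; lra|].
    intros; apply Rabs_def1; lra. }
  exists r, (K * A). split; [exact Hr|]. split; [nra|].
  split; [exact HCV|]. split; [|split; [|split]].
  - intros x t Ht. apply (is_derive_Rext (fun y => T 0%nat 0%nat y t)).
    { intros; apply T00. }
    eapply is_derive_eq; [apply HTr, Ht|]. rewrite T10. unfold coeff_sum. simpl; ring.
  - intros x t Ht. rewrite <- T00'.
    replace (w 0%nat x) with (T 0%nat 0%nat x 0) by (rewrite T00, PSeries_0; reflexivity).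
    replace (Rabs t) with (Rabs (t - 0)) by (f_equal; ring).
    apply (MVT_Rabs_le (fun y => T 0%nat 0%nat x y)
             (fun y => INR 1 * T 0%nat 1%nat x y) (- r) r); [lra|apply Hin, Ht|].
    intros y Hy. apply Hin in Hy. split; [apply HTt, Hy|].
    rewrite Rmult_1_l. eapply Rle_trans; [apply HTb, Hy|]. simpl; lra.
  - intros x0 t0 Hc. unfold cylinder in Hc; simpl in Hc.
    exists (fun i l => T i l x0 t0). exists (/ (2 * A)).
    assert (Hd : 0 < / (2 * A)) by (apply Rinv_0_lt_compat; lra).
    split; [exact Hd|]. intros x t Hct Hx Ht. unfold cylinder in Hct; simpl in Hct.
    assert (Hhalf : forall u, Rabs u < / (2 * A) -> Rabs u * A <= / 2).
    { intros u Hu. apply Rle_trans with (/ (2 * A) * A); [nra|]. right; field; lra. }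
    apply Hhalf in Hx. apply Hhalf in Ht.
    assert (Ht0 : Rabs t0 < r) by (apply Hin; lra).
    assert (Htr : Rabs t < r) by (apply Hin; lra).
    split.
    + exists (K * 2 * 2). intros N.
      rewrite sum_n_Reals.
      apply Rle_trans with (sum_f_R0 (fun i => K * 2 * (Rabs (x - x0) * A) ^ i) N).
      * apply sum_Rle. intros i _. rewrite sum_n_Reals.
        apply Rle_trans with (sum_f_R0 (fun l => (K * (Rabs (x - x0) * A) ^ i)
                                 * (Rabs (t - t0) * A) ^ l) N).
        -- apply sum_Rle; intros l _. rewrite !Rabs_mult, <- !RPow_abs, !Rpow_mult_distr.
           apply Rle_trans with (K * A ^ i * A ^ l * Rabs (x - x0) ^ i * Rabs (t - t0) ^ l);
             [|right; ring].
           apply Rmult_le_compat_r; [apply pow_le, Rabs_pos|].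
           apply Rmult_le_compat_r; [apply pow_le, Rabs_pos|]. apply HTb, Ht0.
        -- rewrite sum_mult_l.
           apply Rle_trans with (K * (Rabs (x - x0) * A) ^ i * 2); [|right; ring].
           apply Rmult_le_compat_l.
           ++ apply Rmult_le_pos; [lra|]. apply pow_le.
              apply Rmult_le_pos; [apply Rabs_pos|lra].
           ++ apply sum_half_le. split; [|exact Ht].
              apply Rmult_le_pos; [apply Rabs_pos|lra].
      * rewrite sum_mult_l. apply Rmult_le_compat_l; [lra|].
        apply sum_half_le. split; [|exact Hx]. apply Rmult_le_pos; [apply Rabs_pos|lra].
    + rewrite <- T00'.
      (* The double series is summed by two expansions in one variable: each [T i 0 x0] in [t]
         around [t0], then the function itself in [x] around [x0]. *)
      apply (is_series_Rext (fun i => T i 0%nat x0 t * (x - x0) ^ i)).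
      * intros i. symmetry. apply is_series_unique.
        apply (is_series_Rext (fun l => (x - x0) ^ i * (T i l x0 t0 * (t - t0) ^ l))).
        { intros; ring. }
        rewrite Rmult_comm.
        apply (is_series_scal ((x - x0) ^ i) (fun l => T i l x0 t0 * (t - t0) ^ l)).
        apply (taylor_jet_series (fun l y => T i l x0 y) (- r) r (K * A ^ i) A);
          [lra|lra|lra|exact Ht| |].
        -- intros n y Hy. apply HTt, Hin, Hy.
        -- intros n y Hy. apply HTb, Hin, Hy.
      * apply (taylor_jet_series (fun i y => T i 0%nat y t)
                 (- Rabs x0 - Rabs x - 1) (Rabs x0 + Rabs x + 1) K A); [| |lra|exact Hx| |].
        -- pose proof (Rle_abs x0); pose proof (Rle_abs (- x0)); rewrite Rabs_Ropp in *.
           pose proof (Rabs_pos x). lra.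
        -- pose proof (Rle_abs x); pose proof (Rle_abs (- x)); rewrite Rabs_Ropp in *.
           pose proof (Rabs_pos x0). lra.
        -- intros n y _. apply HTr, Htr.
        -- intros n y _. specialize (HTb n 0%nat y t Htr). simpl in HTb. lra.
  - intros x t Ht.
    assert (Hloc : forall P : R -> R -> Prop,
              (forall u v, Rabs v < r -> P u v) -> locally_2d P x t).
    { intros P HP. assert (Hd : 0 < r - Rabs t) by lra.
      exists (mkposreal _ Hd). simpl. intros u v _ Hv. apply HP.
      replace v with ((v - t) + t) by ring.
      eapply Rle_lt_trans; [apply Rabs_triang|]. lra. }
    assert (Hcont : forall i l, continuity_2d_pt (T i l) x t).
    { intros i l eps.
      set (K1 := INR (S i) * (K * A ^ S i * A ^ l)).
      set (K2 := INR (S l) * (K * A ^ i * A ^ S l)).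
      assert (P : forall n, 0 <= A ^ n) by (intros; apply pow_le; lra).
      assert (HK1 : 0 <= K1).
      { unfold K1. apply Rmult_le_pos; [apply pos_INR|].
        apply Rmult_le_pos; [apply Rmult_le_pos; auto|auto]. }
      assert (HK2 : 0 <= K2).
      { unfold K2. apply Rmult_le_pos; [apply pos_INR|].
        apply Rmult_le_pos; [apply Rmult_le_pos; auto|auto]. }
      set (d := Rmin (r - Rabs t) (eps / (K1 + K2 + 1))).
      assert (He : 0 < eps / (K1 + K2 + 1)) by (apply Rdiv_lt_0_compat; [apply eps|lra]).
      assert (Hd : 0 < d) by (unfold d; apply Rmin_glb_lt; lra).
      exists (mkposreal d Hd). simpl. intros u v Hu Hv.
      assert (Hd1 : d <= r - Rabs t) by apply Rmin_l.
      assert (Hd2 : d <= eps / (K1 + K2 + 1)) by apply Rmin_r.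
      assert (Hvr : Rabs v < r).
      { replace v with ((v - t) + t) by ring.
        eapply Rle_lt_trans; [apply Rabs_triang|]. lra. }
      replace (T i l u v - T i l x t)
        with ((T i l u v - T i l x v) + (T i l x v - T i l x t)) by ring.
      eapply Rle_lt_trans; [apply Rabs_triang|].
      assert (M1 : Rabs (T i l u v - T i l x v) <= K1 * Rabs (u - x)).
      { apply (MVT_Rabs_le (fun y => T i l y v) (fun y => INR (S i) * T (S i) l y v)
                 (- Rabs x - Rabs u - 1) (Rabs x + Rabs u + 1)).
        - pose proof (Rle_abs x); pose proof (Rle_abs (- x)); rewrite Rabs_Ropp in *.
          pose proof (Rabs_pos u). lra.
        - pose proof (Rle_abs u); pose proof (Rle_abs (- u)); rewrite Rabs_Ropp in *.
          pose proof (Rabs_pos x). lra.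
        - intros y _. split; [apply HTr, Hvr|].
          rewrite Rabs_mult, Rabs_pos_eq by apply pos_INR.
          apply Rmult_le_compat_l; [apply pos_INR|apply HTb, Hvr]. }
      assert (M2 : Rabs (T i l x v - T i l x t) <= K2 * Rabs (v - t)).
      { apply (MVT_Rabs_le (fun y => T i l x y) (fun y => INR (S l) * T i (S l) x y) (- r) r).
        - apply Hin, Ht.
        - apply Hin, Hvr.
        - intros y Hy. apply Hin in Hy. split; [apply HTt, Hy|].
          rewrite Rabs_mult, Rabs_pos_eq by apply pos_INR.
          apply Rmult_le_compat_l; [apply pos_INR|apply HTb, Hy]. }
      apply Rle_lt_trans with ((K1 + K2) * d); [nra|].
      apply Rle_lt_trans with ((K1 + K2) * (eps / (K1 + K2 + 1))).
      + apply Rmult_le_compat_l; lra.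
      + apply Rmult_lt_reg_r with (K1 + K2 + 1); [lra|].
        unfold Rdiv. rewrite Rmult_assoc, Rmult_assoc, Rinv_l by lra.
        pose proof (cond_pos eps). nra. }
    assert (Dx : forall u v, Rabs v < r ->
              is_derive (fun w0 => coeff_sum w w0 v) u (INR 1 * T 1%nat 0%nat u v)).
    { intros u v Hv. apply (is_derive_Rext (fun y => T 0%nat 0%nat y v)).
      { intros; apply T00. } apply HTr, Hv. }
    assert (Dt : forall u v, Rabs v < r ->
              is_derive (fun w0 => coeff_sum w u w0) v (INR 1 * T 0%nat 1%nat u v)).
    { intros u v Hv. apply (is_derive_Rext (fun y => T 0%nat 0%nat u y)).
      { intros; apply T00. } apply HTt, Hv. }
    split; [|split].
    + apply Hloc. intros u v Hv. split; eexists; [apply Dx, Hv|apply Dt, Hv].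
    + apply (continuity_2d_pt_ext_loc (T 1%nat 0%nat)); [|apply Hcont].
      apply Hloc. intros u v Hv. symmetry.
      etransitivity; [apply is_derive_unique, (Dx u v Hv)|]. simpl; ring.
    + apply (continuity_2d_pt_ext_loc (T 0%nat 1%nat)); [|apply Hcont].
      apply Hloc. intros u v Hv. symmetry.
      etransitivity; [apply is_derive_unique, (Dt u v Hv)|]. simpl; ring.
Qed.

(** * Monotonicity, and functions of period [2 * PI] *)

Lemma ex_derive_Rcontinuous (f : R -> R) (x : R) : ex_derive f x -> continuous f x.
Proof. apply (@ex_derive_continuous R_AbsRing R_NormedModule). Qed.

Lemma derive_nonneg_le (f df : R -> R) (x y : R) :
  x <= y -> (forall t, is_derive f t (df t)) -> (forall t, x <= t <= y -> 0 <= df t) ->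
  f x <= f y.
Proof.
  intros Hxy HD Hp.
  destruct (MVT_gen f x y df) as [z [Hz E]].
  { intros; apply HD. }
  { intros t _. apply derivable_continuous_pt. eexists; apply is_derive_Reals, HD. }
  rewrite Rmin_left, Rmax_right in Hz by exact Hxy.
  specialize (Hp z Hz). assert (0 <= df z * (y - x)) by (apply Rmult_le_pos; lra). lra.
Qed.

Lemma derive_zero_const (f : R -> R) (x y : R) :
  (forall t, is_derive f t 0) -> f x = f y.
Proof.
  intros HD. destruct (MVT_gen f x y (fun _ => 0)) as [z [_ E]].
  { intros; apply HD. }
  { intros t _. apply derivable_continuous_pt. eexists; apply is_derive_Reals, HD. }
  lra.
Qed.

Definition periodic (f : R -> R) : Prop := forall x, f (x + 2 * PI) = f x.

Lemma periodic_IZR (f : R -> R) (n : Z) (x : R) :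
  periodic f -> f (x + 2 * PI * IZR n) = f x.
Proof.
  intros Hf. assert (Hn : forall m x, f (x + 2 * PI * INR m) = f x).
  { induction m as [|m IH]; intros y; [simpl; f_equal; ring|].
    rewrite S_INR. replace (y + 2 * PI * (INR m + 1)) with ((y + 2 * PI * INR m) + 2 * PI) by ring.
    rewrite Hf. apply IH. }
  destruct (Z_le_gt_dec 0 n) as [H|H].
  - rewrite <- (Z2Nat.id n) by exact H. rewrite <- INR_IZR_INZ. apply Hn.
  - replace (f x) with (f ((x + 2 * PI * IZR n) + 2 * PI * INR (Z.to_nat (- n)))).
    + rewrite Hn. reflexivity.
    + f_equal. rewrite INR_IZR_INZ, Z2Nat.id by lia. rewrite opp_IZR. ring.
Qed.

Lemma mod_2PI (x : R) : exists (n : Z) (y : R), x = y + 2 * PI * IZR n /\ 0 <= y <= 2 * PI.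
Proof.
  pose proof PI_RGT_0 as HP.
  exists (Int_part (x / (2 * PI))), (x - 2 * PI * IZR (Int_part (x / (2 * PI)))).
  split; [ring|].
  destruct (base_Int_part (x / (2 * PI))) as [H1 H2].
  set (m := IZR (Int_part (x / (2 * PI)))) in *.
  assert (E : x = 2 * PI * (x / (2 * PI))) by (field; lra).
  split; nra.
Qed.

Lemma periodic_repr (f : R -> R) (x : R) :
  periodic f -> exists y, 0 <= y <= 2 * PI /\ f x = f y.
Proof.
  intros Hf. destruct (mod_2PI x) as (n & y & E & Hy). exists y. split; [exact Hy|].
  rewrite E. apply periodic_IZR, Hf.
Qed.

Lemma periodic_lower_bound (f : R -> R) :
  periodic f -> (forall x, ex_derive f x) -> (forall x, 0 < f x) ->
  exists c, 0 < c /\ forall x, c <= f x.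
Proof.
  intros Hp Hd Hpos. pose proof PI_RGT_0 as HP.
  destruct (continuity_ab_min f 0 (2 * PI)) as [m [Hm _]].
  - lra.
  - intros c _. apply continuity_pt_filterlim. apply (ex_derive_Rcontinuous f), Hd.
  - exists (f m). split; [apply Hpos|]. intros x.
    destruct (periodic_repr f x Hp) as (y & Hy & E). rewrite E. apply Hm, Hy.
Qed.

(** The increment over one period has zero derivative. Hence a primitive of a periodic function
    either is periodic or becomes so after subtracting a linear function of nonzero slope. *)
Lemma periodic_increment (f df : R -> R) :
  (forall x, is_derive f x (df x)) -> periodic df ->
  forall x, f (x + 2 * PI) - f x = f (2 * PI) - f 0.
Proof.
  intros HD Hp x.
  replace (f (2 * PI)) with (f (0 + 2 * PI)) by (f_equal; ring).
  apply (derive_zero_const (fun t => f (t + 2 * PI) - f t)).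
  intros t. eapply is_derive_eq.
  - apply (is_derive_minus (fun t => f (t + 2 * PI)) f); [|apply HD].
    apply is_derive_comp_shift, HD.
  - rewrite Hp. unfold minus, plus, opp; simpl. ring.
Qed.

(** * The linear system for the coefficients of the Jacobi multiplier *)

(* Writing [u_k = exp (- (k+1) a) z_k] with [a' = g_0] removes the diagonal term of
   [u_k' = - (k+1) (g u)_k]: the [z_k] are successive primitives. *)
Definition zsum (g : nat -> R -> R) (a : R -> R) (z : nat -> R -> R) (m : nat) (x : R) : R :=
  sum_f_R0 (fun j => g (S j) x * exp (INR (S j) * a x) * z (m - j)%nat x) m.

Definition zder (g : nat -> R -> R) (a : R -> R) (z : nat -> R -> R) (k : nat) (x : R) : R :=
  match k with
  | O => 0
  | S m => - INR (S k) * zsum g a z m x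
  end.

Lemma is_derive_RInt_cont (f : R -> R) (x : R) :
  (forall t, continuous f t) -> is_derive (fun y => RInt f 0 y) x (f x).
Proof.
  intros H. apply (is_derive_RInt f (fun y => RInt f 0 y) 0 x); [|apply H].
  apply filter_forall. intros y. apply (@RInt_correct R_CompleteNormedModule).
  apply ex_RInt_continuous. intros; apply H.
Qed.

(** The derivative of [z k] involves only earlier terms, so each term is a primitive taken from [0].
    The initial values encode the normalization [U(0, rho) = 1]. *)
Lemma zsystem_exists (g : nat -> R -> R) : (forall j x, ex_derive (g j) x) ->
  exists (a : R -> R) (z : nat -> R -> R),
    a 0 = 0 /\ (forall x, is_derive a x (g 0%nat x)) /\
    (forall x, z 0%nat x = 1) /\ (forall k, z (S k) 0 = 0) /\
    (forall k x, is_derive (z k) x (zder g a z k x)).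
Proof.
  intros Hg. set (a := fun x => RInt (g 0%nat) 0 x).
  assert (Da : forall x, is_derive a x (g 0%nat x)).
  { intros x. apply is_derive_RInt_cont. intros t. apply ex_derive_Rcontinuous, Hg. }
  destruct (cov_exists (fun _ : R => 0)
     (fun k z => match k with
                 | O => fun _ => 1
                 | S m => fun x => RInt (fun t => - INR (S k) * zsum g a z m t) 0 x
                 end)) as [z Hz].
  { intros n u v Huv. destruct n as [|m]; [reflexivity|].
    apply functional_extensionality; intros x. f_equal.
    apply functional_extensionality; intros t. f_equal. unfold zsum.
    apply sum_eq; intros i Hi. rewrite Huv by lia. reflexivity. }
  exists a, z. split; [apply (RInt_point 0 (g 0%nat))|]. split; [exact Da|].
  split; [intros x; rewrite Hz; reflexivity|]. split.
  { intros k. rewrite Hz. apply (@RInt_point R_CompleteNormedModule 0). }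
  induction k as [k IH] using (well_founded_induction Wf_nat.lt_wf). intros x.
  destruct k as [|m].
  - rewrite (Hz 0%nat). simpl. apply @is_derive_const.
  - rewrite (Hz (S m)). simpl zder.
    apply (is_derive_RInt_cont (fun t => - INR (S (S m)) * zsum g a z m t)).
    intros t. apply ex_derive_Rcontinuous.
    assert (E : forall j, (j <= m)%nat -> ex_derive
              (fun x => g (S j) x * exp (INR (S j) * a x) * z (m - j)%nat x) t).
    { intros j Hj. apply @ex_derive_mult; [apply @ex_derive_mult; [apply Hg|]|].
      - eexists. apply (is_derive_comp exp (fun x => INR (S j) * a x));
          [apply is_derive_Reals, derivable_pt_lim_exp|].
        apply is_derive_Rscal, Da.
      - eexists. apply IH. lia. }
    assert (Es : exists l : nat -> R, forall j, (j <= m)%nat -> is_derive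
              (fun x => g (S j) x * exp (INR (S j) * a x) * z (m - j)%nat x) t (l j)).
    { exists (fun j => Derive (fun x => g (S j) x * exp (INR (S j) * a x) * z (m - j)%nat x) t).
      intros j Hj. apply Derive_correct, E, Hj. }
    destruct Es as [l Hl]. eexists. apply is_derive_Rscal.
    apply (is_derive_sum_f_R0
      (fun j x => g (S j) x * exp (INR (S j) * a x) * z (m - j)%nat x)). exact Hl.
Qed.

Definition ucoef (a : R -> R) (z : nat -> R -> R) (k : nat) (x : R) : R :=
  exp (- INR (S k) * a x) * z k x.

(** The exponents [- INR (S (m - j))] carried by [ucoef] and [INR (S j)] inserted in [zsum] differ
    by the constant [INR (S (S m))], so a single exponential factors out of all off-diagonal
    terms. *)
Lemma PS_mult_ucoef_S (g : nat -> R -> R) (a : R -> R) (z : nat -> R -> R) (m : nat) (x : R) :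
  PS_mult (fun j => g j x) (fun j => ucoef a z j x) (S m)
  = g 0%nat x * ucoef a z (S m) x + exp (- INR (S (S m)) * a x) * zsum g a z m x.
Proof.
  unfold PS_mult. rewrite sum_S_left. f_equal.
  unfold zsum. rewrite <- sum_mult_l. apply sum_eq; intros j Hj.
  unfold ucoef. replace (S m - S j)%nat with (m - j)%nat by lia.
  replace (exp (- INR (S (m - j)) * a x))
    with (exp (- INR (S (S m)) * a x) * exp (INR (S j) * a x)); [ring|].
  rewrite <- exp_plus. f_equal. rewrite !S_INR, minus_INR by exact Hj. ring.
Qed.

Lemma is_derive_exp_scal (a : R -> R) (c x l : R) :
  is_derive a x l -> is_derive (fun y => exp (c * a y)) x (c * l * exp (c * a x)).
Proof.
  intros H. eapply is_derive_eq.
  - apply (is_derive_comp exp (fun x => c * a x)).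
    + apply is_derive_Reals, derivable_pt_lim_exp.
    + apply is_derive_Rscal, H.
  - unfold scal; simpl; unfold mult; simpl. ring.
Qed.

Lemma is_derive_ucoef (g : nat -> R -> R) (a : R -> R) (z : nat -> R -> R) :
  (forall x, is_derive a x (g 0%nat x)) ->
  (forall k x, is_derive (z k) x (zder g a z k x)) ->
  forall k x, is_derive (ucoef a z k) x
    (- INR (S k) * PS_mult (fun j => g j x) (fun j => ucoef a z j x) k).
Proof.
  intros Da Dz k x. unfold ucoef at 1. eapply is_derive_eq.
  - apply is_derive_Rmult; [apply is_derive_exp_scal, Da|apply Dz].
  - destruct k as [|m].
    + unfold PS_mult, ucoef, zder; simpl. ring.
    + rewrite PS_mult_ucoef_S. unfold zder, ucoef. ring.
Qed.

Lemma exp_INR_mult (n : nat) (x : R) : exp (INR n * x) = exp x ^ n.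
Proof.
  induction n as [|n IH]; [simpl; rewrite Rmult_0_l; apply exp_0|].
  rewrite S_INR, Rmult_plus_distr_r, Rmult_1_l, exp_plus, IH. simpl; ring.
Qed.

Lemma exp_le_compat (x y : R) : x <= y -> exp x <= exp y.
Proof.
  intros [H|H]; [left; apply exp_increasing, H|right; rewrite H; reflexivity].
Qed.

(** The [z k] are compared on one period with explicit majorants. An estimate on a bounded interval
    is all that can be expected before periodicity is known. *)
Lemma ucoef_geom_bound (g : nat -> R -> R) (a : R -> R) (z : nat -> R -> R) (M B : R) :
  0 <= M -> 0 < B -> (forall j x, Rabs (g j x) <= M * B ^ j) ->
  a 0 = 0 -> (forall x, is_derive a x (g 0%nat x)) ->
  (forall x, z 0%nat x = 1) -> (forall k, z (S k) 0 = 0) ->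
  (forall k x, is_derive (z k) x (zder g a z k x)) ->
  exists C L, 0 < C /\ 0 < L /\
    forall k x, 0 <= x <= 2 * PI -> Rabs (ucoef a z k x) <= C * L ^ k.
Proof.
  intros HM HB Hg a0 Da z0 zS0 Dz. pose proof PI_RGT_0 as HP.
  set (E := M * (2 * PI)).
  assert (HE : 0 <= E) by (unfold E; nra).
  assert (Ha : forall x, 0 <= x <= 2 * PI -> Rabs (a x) <= E).
  { intros x Hx. replace (a x) with (a x - a 0) by lra.
    apply Rle_trans with (M * Rabs (x - 0)).
    - apply (MVT_Rabs_le a (g 0%nat) (-1) (2 * PI + 1)); [lra|lra|].
      intros t _. split; [apply Da|]. specialize (Hg 0%nat t). simpl in Hg. lra.
    - unfold E. apply Rmult_le_compat_l; [lra|]. rewrite Rabs_pos_eq; lra. }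
  assert (Hexp : forall k c x, 0 <= x <= 2 * PI -> Rabs c = INR k ->
            exp (c * a x) <= exp E ^ k).
  { intros k c x Hx Hc. replace (exp E ^ k) with (exp (INR k * E)).
    2:{ clear. induction k as [|k IH]; [simpl; rewrite Rmult_0_l; apply exp_0|].
        rewrite S_INR, Rmult_plus_distr_r, Rmult_1_l, exp_plus, IH. simpl; ring. }
    assert (H : c * a x <= INR k * E).
    { eapply Rle_trans; [apply Rle_abs|]. rewrite Rabs_mult, Hc.
      apply Rmult_le_compat_l; [apply pos_INR|apply Ha, Hx]. }
    apply exp_le_compat, H. }
  set (b := B * exp E). set (L := 2 * b).
  assert (Hb : 0 < b) by (unfold b; apply Rmult_lt_0_compat; [lra|apply exp_pos]).
  (* Majorant satisfying [w' = M * INR (S k) * w]: the unbounded factor of the system becomes a rate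
     in the exponential, which on one period still grows only geometrically in [k]. With [L = 2 * b]
     the convolution bound [2 * L ^ m], times [b], is exactly [L ^ S m]. *)
  set (w := fun k x => L ^ k * exp (M * INR (S k) * x)).
  assert (Dw : forall k x, is_derive (w k) x (M * INR (S k) * w k x)).
  { intros k x. unfold w. eapply is_derive_eq.
    - apply is_derive_Rscal. apply (is_derive_exp_scal (fun y => y)). apply is_derive_id.
    - unfold one; simpl. ring. }
  assert (Hwp : forall k x, 0 <= w k x).
  { intros; unfold w. apply Rmult_le_pos; [apply pow_le; unfold L; lra|left; apply exp_pos]. }
  assert (Hz : forall k x, 0 <= x <= 2 * PI -> Rabs (z k x) <= w k x).
  { induction k as [k IH] using (well_founded_induction Wf_nat.lt_wf). intros x Hx.
    destruct k as [|m].
    - rewrite z0, Rabs_R1. unfold w. simpl (L ^ 0). rewrite Rmult_1_l, <- exp_0.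
      assert (H : 0 <= M * INR 1 * x) by (simpl; nra).
      apply exp_le_compat, H.
    - assert (Hd : forall t, 0 <= t <= 2 * PI ->
                Rabs (zder g a z (S m) t) <= M * INR (S (S m)) * w (S m) t).
      { intros t Ht. unfold zder, zsum. rewrite Rabs_mult, Rabs_Ropp, Rabs_pos_eq by apply pos_INR.
        rewrite (Rmult_comm M), Rmult_assoc. apply Rmult_le_compat_l; [apply pos_INR|].
        eapply Rle_trans; [apply Rsum_abs|].
        apply Rle_trans with (sum_f_R0 (fun j => (M * b * exp (M * INR (S (S m)) * t))
                                  * (b ^ j * L ^ (m - j))) m).
        - apply sum_Rle; intros j Hj. rewrite !Rabs_mult.
          rewrite (Rabs_pos_eq (exp _)) by (left; apply exp_pos).
          apply Rle_trans with ((M * B ^ S j) * exp E ^ S j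
              * (L ^ (m - j) * exp (M * INR (S (S m)) * t))).
          + apply Rmult_le_compat; [|apply Rabs_pos| |].
            * apply Rmult_le_pos; [apply Rabs_pos|left; apply exp_pos].
            * apply Rmult_le_compat; [apply Rabs_pos|left; apply exp_pos|apply Hg|].
              apply Hexp; [exact Ht|]. apply Rabs_pos_eq, pos_INR.
            * eapply Rle_trans; [apply IH; [lia|exact Ht]|]. unfold w.
              apply Rmult_le_compat_l; [apply pow_le; unfold L; lra|].
              assert (H : M * INR (S (m - j)) * t <= M * INR (S (S m)) * t).
              { apply Rmult_le_compat_r; [lra|]. apply Rmult_le_compat_l; [lra|].
                apply le_INR; lia. }
              apply exp_le_compat, H.
          + right. unfold b. rewrite Rpow_mult_distr. simpl. ring.
        - rewrite sum_mult_l. unfold w.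
          apply Rle_trans with (M * b * exp (M * INR (S (S m)) * t) * (2 * L ^ m)).
          + apply Rmult_le_compat_l.
            * apply Rmult_le_pos; [nra|left; apply exp_pos].
            * apply sum_geom_le; unfold L; lra.
          + right. unfold L. simpl. ring. }
      apply Rabs_le. rewrite <- (Rplus_0_l (z (S m) x)).
      (* Both [w + z] and [w - z] are nondecreasing on [[0, x]] and nonnegative at [0], where
         [z (S m)] vanishes. *)
      assert (H1 := derive_nonneg_le (fun t => w (S m) t + z (S m) t)
                 (fun t => M * INR (S (S m)) * w (S m) t + zder g a z (S m) t) 0 x (proj1 Hx)).
      assert (H2 := derive_nonneg_le (fun t => w (S m) t + (-1) * z (S m) t)
                 (fun t => M * INR (S (S m)) * w (S m) t + (-1) * zder g a z (S m) t)
                 0 x (proj1 Hx)).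
      cbv beta in H1, H2. rewrite zS0 in H1, H2.
      assert (H0 := Hwp (S m) 0).
      assert (Hd' : forall t, 0 <= t <= x ->
                - (M * INR (S (S m)) * w (S m) t) <= zder g a z (S m) t
                <= M * INR (S (S m)) * w (S m) t).
      { intros t Ht. apply Rabs_le_between. apply Hd. lra. }
      assert (H1' : w (S m) 0 + 0 <= w (S m) x + z (S m) x).
      { apply H1.
        - intros t. apply is_derive_Rplus; [apply Dw|apply Dz].
        - intros t Ht. specialize (Hd' t Ht). lra. }
      assert (H2' : w (S m) 0 + -1 * 0 <= w (S m) x + -1 * z (S m) x).
      { apply H2.
        - intros t. apply is_derive_Rplus; [apply Dw|apply is_derive_Rscal, Dz].
        - intros t Ht. specialize (Hd' t Ht). lra. }
      lra. }
  (* One factor [exp E] per unit of [S k] comes from undoing the substitution for [u_k], the other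
     from the exponential in [w]. *)
  set (F := exp E * exp E). assert (HF : 0 < F) by (apply Rmult_lt_0_compat; apply exp_pos).
  exists F, (F * L). split; [exact HF|]. split; [unfold L; nra|].
  intros k x Hx. unfold ucoef. rewrite Rabs_mult.
  rewrite (Rabs_pos_eq (exp _)) by (left; apply exp_pos).
  apply Rle_trans with (exp E ^ S k * (L ^ k * exp E ^ S k)).
  - apply Rmult_le_compat; [left; apply exp_pos|apply Rabs_pos| |].
    + apply Hexp; [exact Hx|]. rewrite Rabs_Ropp. apply Rabs_pos_eq, pos_INR.
    + eapply Rle_trans; [apply Hz, Hx|]. unfold w. apply Rmult_le_compat_l.
      * apply pow_le; unfold L; lra.
      * rewrite <- exp_INR_mult.
        assert (H : M * INR (S k) * x <= INR (S k) * E).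
        { unfold E. replace (M * INR (S k) * x) with (INR (S k) * (M * x)) by ring.
          apply Rmult_le_compat_l; [apply pos_INR|]. apply Rmult_le_compat_l; lra. }
        apply exp_le_compat, H.
  - right. unfold F. rewrite !Rpow_mult_distr. simpl. ring.
Qed.

(* The factor [k + 1] of the system is absorbed by
   [(i + 1) bc (i + 1) k = (i + k + 1) bc i k]. *)
Lemma linear_system_analytic (g u : nat -> R -> R) (C L0 : R) :
  analytic_coeffs g -> 0 < C -> 0 < L0 ->
  (forall k x, Rabs (u k x) <= C * L0 ^ k) ->
  (forall k x, is_derive (u k) x
     (- INR (S k) * PS_mult (fun j => g j x) (fun j => u j x) k)) ->
  analytic_coeffs u.
Proof.
  intros (a & M & B & Ha & HB & H) HC HL0 Hu Du.
  pose proof (AnS_pos _ _ _ _ H) as HM.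
  destruct (AnS_jets a M B g Ha H) as (G & HG & Gb).
  assert (Hia : 0 < / a) by (apply Rinv_0_lt_compat, Ha).
  (* [U i k] is the [i]-th normalized derivative of [u k], obtained by reading the differential
     equation on Taylor coefficients: order [S m] is a double convolution of the jets of [g] with
     orders at most [m] of [u]. *)
  destruct (cov_exists (fun (_ : nat) (_ : R) => 0)
     (fun i U => match i with
        | O => u
        | S m => fun k x => - INR (S k) / INR (S m)
            * sum_f_R0 (fun j => PS_mult (fun l => G j l x) (fun l => U l (k - j)%nat x) m) k
        end)) as [U HU].
  { intros n v w Hvw. destruct n as [|m]; [reflexivity|].
    apply functional_extensionality; intros k. apply functional_extensionality; intros x.
    f_equal. apply sum_eq; intros j Hj. unfold PS_mult. apply sum_eq; intros l Hl.
    rewrite Hvw by lia. reflexivity. }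
  assert (U0 : U 0%nat = u) by (rewrite HU; reflexivity).
  assert (US : forall m k x, INR (S m) * U (S m) k x = - INR (S k)
            * sum_f_R0 (fun j => PS_mult (fun l => G j l x) (fun l => U l (k - j)%nat x) m) k).
  { intros m k x. rewrite (HU (S m)). field. apply not_0_INR; lia. }
  assert (DU : forall i k x, is_derive (U i k) x (INR (S i) * U (S i) k x)).
  { induction i as [i IH] using (well_founded_induction Wf_nat.lt_wf). intros k x.
    destruct i as [|m].
    - rewrite U0, US. eapply is_derive_eq; [apply Du|]. f_equal.
      unfold PS_mult. apply sum_eq; intros j Hj. simpl.
      destruct (HG j) as [G0 _]. rewrite G0, U0. reflexivity.
    - apply (is_derive_Rext (fun x => - INR (S k) / INR (S m)
            * sum_f_R0 (fun j => PS_mult (fun l => G j l x) (fun l => U l (k - j)%nat x) m) k)).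
      { intros t. rewrite (HU (S m)). reflexivity. }
      eapply is_derive_eq.
      { apply is_derive_Rscal.
        apply (is_derive_sum_f_R0
          (fun j x => PS_mult (fun l => G j l x) (fun l => U l (k - j)%nat x) m)).
        intros j Hj. unfold PS_mult.
        apply (is_derive_sum_f_R0 (fun l x => G j l x * U (m - l)%nat (k - j)%nat x)).
        intros l Hl. apply is_derive_Rmult; [apply (HG j)|apply IH; lia]. }
      rewrite US.
      rewrite (sum_eq _ (fun j => INR (S m)
           * PS_mult (fun l => G j l x) (fun l => U l (k - j)%nat x) (S m))).
      + rewrite sum_mult_l. field. apply not_0_INR; lia.
      + intros j Hj. rewrite <- PS_mult_leibniz. reflexivity. }
  (* [2 * B] and [2 * / a] give ratio one half to the sums over powers of [rho] and over
     derivatives. Each sum costs a factor [2], so one recurrence step produces [4 * M], absorbed by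
     the additional power of [A]. *)
  set (L := Rmax L0 (2 * B)). set (A := Rmax (2 * / a) (4 * M)).
  assert (L1 : L0 <= L) by apply Rmax_l. assert (L2 : 2 * B <= L) by apply Rmax_r.
  assert (A1 : 2 * / a <= A) by apply Rmax_l. assert (A2 : 4 * M <= A) by apply Rmax_r.
  assert (bcm_r : forall i k k', (k' <= k)%nat -> bc i k' <= bc i k).
  { intros i k k' Hk. induction Hk as [|k Hk IH]; [lra|].
    eapply Rle_trans; [apply IH|]. apply Rmult_le_reg_l with (INR (S k)).
    - apply lt_0_INR; lia.
    - rewrite bc_S_r, Rmult_comm. apply Rmult_le_compat_l; [left; apply bc_pos|].
      apply le_INR; lia. }
  assert (bcm_l : forall i i' k, (i' <= i)%nat -> bc i' k <= bc i k).
  { intros i i' k Hk. induction Hk as [|i Hk IH]; [lra|].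
    eapply Rle_trans; [apply IH|]. apply Rmult_le_reg_l with (INR (S i)).
    - apply lt_0_INR; lia.
    - rewrite bc_S_l, Rmult_comm. apply Rmult_le_compat_l; [left; apply bc_pos|].
      apply le_INR; lia. }
  assert (Ub : forall i k x, Rabs (U i k x) <= C * L ^ k * A ^ i * bc i k).
  { induction i as [i IH] using (well_founded_induction Wf_nat.lt_wf). intros k x.
    destruct i as [|m].
    - rewrite U0, bc_0_l. simpl. rewrite !Rmult_1_r. eapply Rle_trans; [apply Hu|].
      apply Rmult_le_compat_l; [lra|]. apply pow_incr; lra.
    - assert (Hm : 0 < INR (S m)) by (apply lt_0_INR; lia).
      apply Rmult_le_reg_l with (INR (S m)); [exact Hm|].
      rewrite <- (Rabs_pos_eq (INR (S m))) at 1 by lra.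
      rewrite <- Rabs_mult, US, Rabs_mult, Rabs_Ropp, Rabs_pos_eq by apply pos_INR.
      assert (HLk : forall n, 0 <= L ^ n) by (intros; apply pow_le; lra).
      assert (HAk : forall n, 0 <= A ^ n) by (intros; apply pow_le; lra).
      assert (HBk : forall n, 0 <= B ^ n) by (intros; apply pow_le; lra).
      assert (Hak : forall n, 0 <= (/ a) ^ n) by (intros; apply pow_le; lra).
      assert (Hbc := bc_pos m k).
      assert (HS : Rabs (sum_f_R0 (fun j => PS_mult (fun l => G j l x)
                     (fun l => U l (k - j)%nat x) m) k)
                <= M * C * bc m k * (2 * L ^ k) * (2 * A ^ m)).
      { eapply Rle_trans; [apply Rsum_abs|].
        apply Rle_trans with (sum_f_R0 (fun j =>
            (M * C * bc m k * (2 * A ^ m)) * (B ^ j * L ^ (k - j))) k).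
        - apply sum_Rle; intros j Hj. unfold PS_mult.
          eapply Rle_trans; [apply Rsum_abs|].
          apply Rle_trans with (sum_f_R0 (fun l =>
            (M * C * bc m k * (B ^ j * L ^ (k - j))) * ((/ a) ^ l * A ^ (m - l))) m).
          + apply sum_Rle; intros l Hl. rewrite Rabs_mult.
            apply Rle_trans with ((M * B ^ j * (/ a) ^ l)
               * (C * L ^ (k - j) * A ^ (m - l) * bc m k)); [|right; ring].
            apply Rmult_le_compat; [apply Rabs_pos|apply Rabs_pos|apply Gb|].
            eapply Rle_trans; [apply IH; lia|].
            apply Rmult_le_compat_l.
            { apply Rmult_le_pos; [apply Rmult_le_pos; [lra|]|]; auto. }
            eapply Rle_trans; [apply (bcm_l m); lia|apply bcm_r; lia].
          + rewrite sum_mult_l.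
            apply Rle_trans with (M * C * bc m k * (B ^ j * L ^ (k - j)) * (2 * A ^ m));
              [|right; ring].
            apply Rmult_le_compat_l; [|apply sum_geom_le; lra].
            apply Rmult_le_pos; [|apply Rmult_le_pos; auto].
            apply Rmult_le_pos; [nra|lra].
        - rewrite sum_mult_l.
          apply Rle_trans with (M * C * bc m k * (2 * A ^ m) * (2 * L ^ k)); [|right; ring].
          apply Rmult_le_compat_l; [|apply sum_geom_le; lra].
          apply Rmult_le_pos; [|specialize (HAk m); lra].
          apply Rmult_le_pos; [nra|lra]. }
      eapply Rle_trans; [apply Rmult_le_compat_l; [apply pos_INR|apply HS]|].
      replace (INR (S m) * (C * L ^ k * A ^ S m * bc (S m) k))
        with (C * L ^ k * A ^ m * (A * (INR (S m) * bc (S m) k))) by (simpl; ring).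
      rewrite bc_S_l.
      replace (INR (S k) * (M * C * bc m k * (2 * L ^ k) * (2 * A ^ m)))
        with (C * L ^ k * A ^ m * (4 * M * (bc m k * INR (S k)))) by ring.
      apply Rmult_le_compat_l.
      { apply Rmult_le_pos; [apply Rmult_le_pos; [lra|]|]; auto. }
      apply Rmult_le_compat; [lra| |exact A2|].
      { apply Rmult_le_pos; [lra|apply pos_INR]. }
      apply Rmult_le_compat_l; [lra|]. apply le_INR; lia. }
  assert (HA : 0 < A) by lra.
  (* [bc i k <= 2 ^ i * 2 ^ k]: the factor [2 ^ i] together with [A ^ i] and the radius [/ (4 * A)]
     leaves ratio one half, and [2 ^ k] turns [L] into [2 * L]. *)
  exists (/ (4 * A)), (2 * C), (2 * L).
  split; [apply Rinv_0_lt_compat; lra|]. split; [lra|]. intros k.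
  exists (fun i => U i k). split; [split|].
  - intros x. rewrite U0. reflexivity.
  - intros i x. apply DU.
  - intros x n. rewrite Rpow_mult_distr.
    apply Rle_trans with (sum_f_R0 (fun i => (C * (2 ^ k * L ^ k)) * (/ 2) ^ i) n).
    + apply sum_Rle; intros i Hi.
      apply Rle_trans with ((C * L ^ k * A ^ i * (2 ^ i * 2 ^ k)) * (/ (4 * A)) ^ i).
      * apply Rmult_le_compat_r.
        { apply pow_le. left; apply Rinv_0_lt_compat; lra. }
        eapply Rle_trans; [apply Ub|]. rewrite <- pow_add.
        apply Rmult_le_compat_l; [|apply bc_le].
        apply Rmult_le_pos; [apply Rmult_le_pos; [lra|]|]; apply pow_le; lra.
      * right. replace (/ 2) with (A * 2 * / (4 * A)) by (field; lra).
        rewrite !Rpow_mult_distr. ring.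
    + rewrite sum_mult_l.
      replace (2 * C * (2 ^ k * L ^ k)) with ((C * (2 ^ k * L ^ k)) * 2) by ring.
      apply Rmult_le_compat_l.
      * apply Rmult_le_pos; [lra|]. apply Rmult_le_pos; apply pow_le; lra.
      * apply sum_half_le. lra.
Qed.

(** * Regrouping a double series by quasihomogeneous degree *)

(** Squares serve as the common reference: strips of rows and weighted triangles are both compared
    with them. *)
Definition sq2 (f : nat -> nat -> R) (n : nat) : R :=
  sum_f_R0 (fun k => sum_f_R0 (fun l => f k l) n) n.

Lemma sum_indicator_le (f : nat -> R) (m n : nat) :
  (m <= n)%nat ->
  sum_f_R0 (fun k => if Nat.leb k m then f k else 0) n = sum_f_R0 f m.
Proof.
  induction n as [|n IH]; intros Hm.
  - replace m with 0%nat by lia. reflexivity.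
  - destruct (Nat.eq_dec m (S n)) as [->|Hne].
    + apply sum_eq; intros i Hi. destruct (Nat.leb_spec i (S n)); [reflexivity|lia].
    + rewrite tech5, IH by lia. destruct (Nat.leb_spec (S n) m); [lia|ring].
Qed.

Lemma sum_zero (f : nat -> R) (n : nat) :
  (forall k, (k <= n)%nat -> f k = 0) -> sum_f_R0 f n = 0.
Proof.
  intros H. rewrite (sum_eq _ (fun _ => 0)) by exact H.
  rewrite sum_cte. ring.
Qed.

Lemma sum_f_R0_minus (f g : nat -> R) (n : nat) :
  sum_f_R0 f n - sum_f_R0 g n = sum_f_R0 (fun k => f k - g k) n.
Proof. symmetry. apply minus_sum. Qed.

Lemma sq2_restrict (f : nat -> nat -> R) (m n : nat) :
  (m <= n)%nat ->
  sq2 (fun k l => if (Nat.leb k m && Nat.leb l m)%bool then f k l else 0) n = sq2 f m.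
Proof.
  intros Hm. unfold sq2. rewrite <- (sum_indicator_le _ m n Hm).
  apply sum_eq; intros k _. destruct (Nat.leb_spec k m) as [Hk|Hk]; simpl.
  - apply (sum_indicator_le (f k)), Hm.
  - apply sum_zero; reflexivity.
Qed.

(** On the smaller square the terms cancel; whatever the region keeps elsewhere is dominated by
    absolute values lying between the two squares. *)
Lemma sq2_region_diff (t : nat -> nat -> R) (chi : nat -> nat -> bool) (m n : nat) :
  (m <= n)%nat -> (forall k l, (k <= m)%nat -> (l <= m)%nat -> chi k l = true) ->
  Rabs (sq2 (fun k l => if chi k l then t k l else 0) n - sq2 t m)
  <= sq2 (fun k l => Rabs (t k l)) n - sq2 (fun k l => Rabs (t k l)) m.
Proof.
  intros Hm Hchi. rewrite <- (sq2_restrict t m n Hm).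
  rewrite <- (sq2_restrict (fun k l => Rabs (t k l)) m n Hm).
  unfold sq2. rewrite !sum_f_R0_minus. eapply Rle_trans; [apply Rsum_abs|].
  apply sum_Rle; intros k _. rewrite !sum_f_R0_minus. eapply Rle_trans; [apply Rsum_abs|].
  apply sum_Rle; intros l _.
  destruct (Nat.leb_spec k m), (Nat.leb_spec l m); simpl;
    [rewrite Hchi by assumption| | |]; try destruct (chi k l);
    rewrite ?Rminus_diag, ?Rminus_0_r, ?Rabs_R0; try lra; apply Rabs_pos.
Qed.

Lemma sq2_pos_le (t : nat -> nat -> R) (m n : nat) : (m <= n)%nat ->
  sq2 (fun k l => Rabs (t k l)) m <= sq2 (fun k l => Rabs (t k l)) n.
Proof.
  intros Hm. unfold sq2.
  apply Rle_trans with (sum_f_R0 (fun k => sum_f_R0 (fun l => Rabs (t k l)) m) n).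
  - apply sum_le_extend; [|exact Hm]. intros; apply sum_nonneg; intros; apply Rabs_pos.
  - apply sum_Rle; intros k _. apply sum_le_extend; [|exact Hm]. intros; apply Rabs_pos.
Qed.

Lemma sq2_cauchy (t : nat -> nat -> R) (M : R) :
  (forall N, sq2 (fun k l => Rabs (t k l)) N <= M) ->
  forall eps, 0 < eps -> exists N0, forall m n, (N0 <= m <= n)%nat ->
    sq2 (fun k l => Rabs (t k l)) n - sq2 (fun k l => Rabs (t k l)) m < eps.
Proof.
  intros HM eps Heps. set (S := sq2 (fun k l => Rabs (t k l))).
  destruct (ex_finite_lim_seq_incr S M) as [l Hl].
  { intros n. apply sq2_pos_le. lia. } { exact HM. }
  assert (Hle : forall n, S n <= l).
  { apply (is_lim_seq_incr_compare S l Hl). intros n. apply sq2_pos_le. lia. }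
  apply is_lim_seq_spec in Hl. destruct (Hl (mkposreal eps Heps)) as [N0 HN]. simpl in HN.
  exists N0. intros m n Hmn. assert (Hm : Rabs (S m - l) < eps) by (apply HN; lia).
  specialize (Hle n). apply Rabs_def2 in Hm. lra.
Qed.

Lemma is_lim_seq_sum_f_R0 (f : nat -> nat -> R) (l : nat -> R) (N : nat) :
  (forall k, (k <= N)%nat -> is_lim_seq (fun n => f k n) (l k)) ->
  is_lim_seq (fun n => sum_f_R0 (fun k => f k n) N) (sum_f_R0 l N).
Proof.
  induction N as [|N IH]; intros H; simpl; [apply H; lia|].
  apply (is_lim_seq_plus' (fun n => sum_f_R0 (fun k => f k n) N) (f (S N))).
  - apply IH; intros; apply H; lia.
  - apply H; lia.
Qed.

Lemma sq2_row_series (t : nat -> nat -> R) (M : R) (k : nat) :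
  (forall N, sq2 (fun k j => Rabs (t k j)) N <= M) -> ex_series (t k).
Proof.
  intros HM. apply ex_series_Rabs.
  destruct (ex_finite_lim_seq_incr (sum_n (fun j => Rabs (t k j))) M) as [s Hs'].
  - intros n. rewrite !sum_n_Reals, tech5. pose proof (Rabs_pos (t k (S n))). lra.
  - intros n. rewrite sum_n_Reals. eapply Rle_trans; [|apply (HM (Nat.max k n))].
    unfold sq2.
    apply Rle_trans with (sum_f_R0 (fun j => Rabs (t k j)) (Nat.max k n)).
    + apply sum_le_extend; [intros; apply Rabs_pos|lia].
    + apply Rle_trans with
        (sum_f_R0 (fun i => sum_f_R0 (fun j => Rabs (t i j)) (Nat.max k n)) k).
      * apply (term_le_sum (fun k' => sum_f_R0 (fun j => Rabs (t k' j)) (Nat.max k n)) k).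
        intros; apply sum_nonneg; intros; apply Rabs_pos.
      * apply sum_le_extend; [|lia].
        intros; apply sum_nonneg; intros; apply Rabs_pos.
  - exists s. exact Hs'.
Qed.

(** The partial iterated sum [G N] is the limit in [n] of the strip [k <= N], [j <= n]. This strip
    contains the square of size [N] and lies in that of size [n], so it differs from [sq2 t N] by a
    Cauchy tail. *)
Lemma sq2_lim (t : nat -> nat -> R) (M l : R) :
  (forall N, sq2 (fun k j => Rabs (t k j)) N <= M) ->
  is_series (fun k => Series (t k)) l ->
  is_lim_seq (sq2 t) l.
Proof.
  intros HM Hs.
  set (G := fun N => sum_f_R0 (fun k => Series (t k)) N).
  assert (HG : is_lim_seq G l).
  { apply (is_lim_seq_ext (sum_n (fun k => Series (t k)))); [|exact Hs].
    intros n; apply sum_n_Reals. }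
  replace (Finite l) with (Finite (l - 0)) by (f_equal; ring).
  apply (is_lim_seq_ext (fun N => G N - (G N - sq2 t N))); [intros; ring|].
  apply is_lim_seq_minus'; [exact HG|].
  apply is_lim_seq_spec. intros eps.
  destruct (sq2_cauchy t M HM (eps / 2)) as [N0 HN0]; [pose proof (cond_pos eps); lra|].
  exists N0. intros N HN. rewrite Rminus_0_r.
  apply Rle_lt_trans with (eps / 2); [|pose proof (cond_pos eps); lra].
  assert (Hlim : is_lim_seq (fun n => Rabs (sum_f_R0 (fun k => sum_f_R0 (t k) n) N - sq2 t N))
                   (Rabs (G N - sq2 t N))).
  { apply (is_lim_seq_abs _ (Finite (G N - sq2 t N))).
    apply is_lim_seq_minus'; [|apply is_lim_seq_const].
    apply (is_lim_seq_sum_f_R0 (fun k n => sum_f_R0 (t k) n)). intros k _.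
    apply (is_lim_seq_ext (sum_n (t k))); [intros; apply sum_n_Reals|].
    apply Series_correct. apply (sq2_row_series t M k HM). }
  apply (is_lim_seq_le_loc _ (fun _ => eps / 2) _ (eps / 2)) with (2 := Hlim);
    [|apply is_lim_seq_const].
  exists N. intros n Hn.
  replace (sum_f_R0 (fun k => sum_f_R0 (t k) n) N)
    with (sq2 (fun k j => if Nat.leb k N then t k j else 0) n).
  - eapply Rle_trans; [apply sq2_region_diff; [exact Hn|]|].
    + intros k j Hk _. apply Nat.leb_le, Hk.
    + left. apply HN0. lia.
  - unfold sq2. rewrite <- (sum_indicator_le _ N n Hn). apply sum_eq; intros k _.
    destruct (Nat.leb k N); [reflexivity|]. apply sum_zero; reflexivity.
Qed.

Lemma qh_part_sum (c : nat -> nat -> R) (p q : nat) (d n : nat) (x y : R) :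
  (0 < p)%nat -> (0 < q)%nat -> (d <= n)%nat ->
  qh_part c p q (Z.of_nat d) x y
  = sq2 (fun k l => if Nat.eqb (p * k + q * l) d then c k l * x ^ k * y ^ l else 0) n.
Proof.
  intros Hp Hq Hdn. unfold qh_part. rewrite Nat2Z.id, sum_n_Reals.
  transitivity (sq2 (fun k l => if Nat.eqb (p * k + q * l) d
                                then c k l * x ^ k * y ^ l else 0) d).
  - unfold sq2. apply sum_eq; intros k _. rewrite sum_n_Reals.
    apply sum_eq; intros l _.
    destruct (Z.eq_dec (Z.of_nat (p * k + q * l)) (Z.of_nat d)),
      (Nat.eqb_spec (p * k + q * l) d); try reflexivity; lia.
  - rewrite <- (sq2_restrict _ d n Hdn). unfold sq2.
    apply sum_eq; intros k _. apply sum_eq; intros l _.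
    destruct (Nat.eqb_spec (p * k + q * l) d) as [E|E].
    + destruct (Nat.leb_spec k d); [|nia]. destruct (Nat.leb_spec l d); [reflexivity|nia].
    + destruct (Nat.leb k d && Nat.leb l d)%bool; reflexivity.
Qed.

Lemma sum_eqb_indicator (v : R) (e n : nat) :
  sum_f_R0 (fun d => if Nat.eqb e d then v else 0) n = if Nat.leb e n then v else 0.
Proof.
  induction n as [|n IH].
  - simpl. destruct (Nat.eqb_spec e 0), (Nat.leb_spec e 0); try reflexivity; lia.
  - rewrite tech5, IH.
    destruct (Nat.leb_spec e n), (Nat.eqb_spec e (S n)), (Nat.leb_spec e (S n)); try lia; ring.
Qed.

(** The partial sum by degrees is the sum over the triangle [p * k + q * j <= n], which lies inside
    the square of size [n] because both weights are positive, and fills ever larger squares. *)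
Lemma is_pseries2_qh (c : nat -> nat -> R) (p q : nat) (x y l : R) :
  (0 < p)%nat -> (0 < q)%nat -> is_pseries2 c x y l ->
  is_series (fun d => qh_part c p q (Z.of_nat d) x y) l.
Proof.
  intros Hp Hq [[M HM] Hs]. set (t := fun k j => c k j * x ^ k * y ^ j).
  assert (HM' : forall N, sq2 (fun k j => Rabs (t k j)) N <= M).
  { intros N. specialize (HM N). rewrite sum_n_Reals in HM.
    eapply Rle_trans; [|apply HM]. right. unfold sq2. apply sum_eq; intros k _.
    rewrite sum_n_Reals. reflexivity. }
  assert (HG : forall n, sum_n (fun d => qh_part c p q (Z.of_nat d) x y) n
     = sq2 (fun k j => if Nat.leb (p * k + q * j) n then t k j else 0) n).
  { intros n. rewrite sum_n_Reals.
    rewrite (sum_eq _ (fun d => sq2 (fun k j => if Nat.eqb (p * k + q * j) d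
                                          then t k j else 0) n)).
    2:{ intros d Hd. apply qh_part_sum; assumption. }
    unfold sq2. rewrite sum_swap. apply sum_eq; intros k _.
    rewrite sum_swap. apply sum_eq; intros j _. apply sum_eqb_indicator. }
  assert (Hl := sq2_lim t M l HM' Hs).
  apply is_series_Reals. intros eps Heps.
  destruct (sq2_cauchy t M HM' (eps / 2)) as [N0 HN0]; [lra|].
  apply is_lim_seq_spec in Hl.
  assert (He2 : 0 < eps / 2) by lra.
  destruct (Hl (mkposreal _ He2)) as [N1 HN1]. simpl in HN1.
  (* For [n >= (p + q) * m] the triangle contains the square of size [m]. *)
  set (m := Nat.max N0 N1). exists ((p + q) * m)%nat. intros n Hn.
  unfold R_dist. rewrite <- sum_n_Reals, HG.
  replace (_ - l) with ((sq2 (fun k j => if Nat.leb (p * k + q * j) n then t k j else 0) n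
                         - sq2 t m) + (sq2 t m - l)) by ring.
  eapply Rle_lt_trans; [apply Rabs_triang|].
  assert (Hmn : (m <= n)%nat).
  { assert (1 * m <= (p + q) * m)%nat by (apply Nat.mul_le_mono_r; lia). lia. }
  assert (H1 : Rabs (sq2 t m - l) < eps / 2) by (apply HN1; unfold m; lia).
  assert (H2 := sq2_region_diff t (fun k j => Nat.leb (p * k + q * j) n) m n Hmn).
  cbv beta in H2.
  assert (H3 := HN0 m n (conj (Nat.le_max_l N0 N1) Hmn)).
  enough (Rabs (sq2 (fun k j => if Nat.leb (p * k + q * j) n then t k j else 0) n
                - sq2 t m) < eps / 2) by lra.
  eapply Rle_lt_trans; [apply H2|exact H3].
  intros k j Hk Hj. apply Nat.leb_le.
  assert (p * k <= p * m)%nat by (apply Nat.mul_le_mono_l; exact Hk).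
  assert (q * j <= q * m)%nat by (apply Nat.mul_le_mono_l; exact Hj). lia.
Qed.

Lemma qh_part_neg (c : nat -> nat -> R) (p q : nat) (z : Z) (x y : R) :
  (z < 0)%Z -> qh_part c p q z x y = 0.
Proof.
  intros Hz. unfold qh_part. rewrite sum_n_Reals. apply sum_zero; intros k _.
  rewrite sum_n_Reals. apply sum_zero; intros l _.
  destruct (Z.eq_dec (Z.of_nat (p * k + q * l)) z); [lia|reflexivity].
Qed.

Lemma qh_part_zero (c : nat -> nat -> R) (p q : nat) (z : Z) (x y : R) :
  (forall k l, Z.of_nat (p * k + q * l) = z -> c k l = 0) -> qh_part c p q z x y = 0.
Proof.
  intros H. unfold qh_part. rewrite sum_n_Reals. apply sum_zero; intros k _.
  rewrite sum_n_Reals. apply sum_zero; intros l _.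
  destruct (Z.eq_dec (Z.of_nat (p * k + q * l)) z) as [E|]; [|reflexivity].
  rewrite (H _ _ E). ring.
Qed.

Lemma qh_part_homogeneous (c : nat -> nat -> R) (p q d : nat) (t x y : R) :
  qh_part c p q (Z.of_nat d) (t ^ p * x) (t ^ q * y) = t ^ d * qh_part c p q (Z.of_nat d) x y.
Proof.
  unfold qh_part. rewrite !sum_n_Reals, <- sum_mult_l. apply sum_eq; intros k _.
  rewrite !sum_n_Reals, <- sum_mult_l. apply sum_eq; intros l _.
  destruct (Z.eq_dec (Z.of_nat (p * k + q * l)) (Z.of_nat d)) as [E|]; [|ring].
  replace d with (p * k + q * l)%nat by lia.
  rewrite !Rpow_mult_distr, pow_add, !pow_mult. ring.
Qed.

(** The lowest degree of a component, [r + p] or [r + q], may be negative: the series is re-indexed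
    by dropping zero terms when [z0] is nonnegative and by inserting them otherwise. *)
Lemma is_series_shift_Z (w : Z -> R) (z0 : Z) (l : R) :
  (forall z, (z < 0)%Z -> w z = 0) -> (forall z, (z < z0)%Z -> w z = 0) ->
  is_series (fun d => w (Z.of_nat d)) l -> is_series (fun d => w (z0 + Z.of_nat d)%Z) l.
Proof.
  intros Hneg Hz0 Hs.
  assert (Hup : forall n, (forall z, (z < Z.of_nat n)%Z -> w z = 0) ->
             is_series (fun d => w (Z.of_nat n + Z.of_nat d)%Z) l).
  { induction n as [|n IH]; intros Hn; [exact Hs|].
    apply (is_series_Rext (fun d => w (Z.of_nat n + Z.of_nat (S d))%Z)).
    { intros d. apply (f_equal w). lia. }
    apply (is_series_incr_1 (fun d => w (Z.of_nat n + Z.of_nat d)%Z) l).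
    rewrite (Hn (Z.of_nat n + Z.of_nat 0)%Z) by lia.
    unfold plus; simpl. rewrite Rplus_0_r. apply IH. intros z Hz; apply Hn; lia. }
  assert (Hdown : forall n, is_series (fun d => w (- Z.of_nat n + Z.of_nat d)%Z) l).
  { induction n as [|n IH]; [exact Hs|].
    apply (is_series_decr_1 (fun d => w (- Z.of_nat (S n) + Z.of_nat d)%Z) l).
    rewrite (Hneg (- Z.of_nat (S n) + Z.of_nat 0)%Z) by lia.
    change (is_series (fun d => w (- Z.of_nat (S n) + Z.of_nat (S d))%Z) (l + - 0)).
    rewrite Ropp_0, Rplus_0_r.
    apply (is_series_Rext (fun d => w (- Z.of_nat n + Z.of_nat d)%Z)); [|exact IH].
    intros d. apply (f_equal w). lia. }
  destruct (Z_le_gt_dec 0 z0) as [H|H].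
  - rewrite <- (Z2Nat.id z0) by exact H. apply Hup. intros z Hz; apply Hz0; lia.
  - replace z0 with (- Z.of_nat (Z.to_nat (- z0)))%Z by lia. apply Hdown.
Qed.

(** Homogeneity turns the regrouped series into a power series in [t]; no monomial has weighted
    degree below [e], so [t ^ e] can be divided out. *)
Lemma is_pseries2_weighted (c : nat -> nat -> R) (p q : nat) (e : Z) (t x y l : R) :
  (0 < p)%nat -> (0 < q)%nat -> t <> 0 ->
  (forall k j, c k j <> 0 -> (e <= Z.of_nat (p * k + q * j))%Z) ->
  is_pseries2 c (t ^ p * x) (t ^ q * y) l ->
  is_series (fun d => qh_part c p q (e + Z.of_nat d) x y * t ^ d) (l / powerRZ t e).
Proof.
  intros Hp Hq Ht He H. apply (is_pseries2_qh c p q) in H; [|assumption|assumption].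
  set (w := fun z => powerRZ t z * qh_part c p q z x y).
  assert (H' : is_series (fun d => w (Z.of_nat d)) l).
  { apply (is_series_Rext (fun d => qh_part c p q (Z.of_nat d) (t ^ p * x) (t ^ q * y)));
      [|exact H].
    intros d. unfold w. rewrite qh_part_homogeneous, pow_powerRZ. reflexivity. }
  apply (is_series_shift_Z w e) in H'.
  - apply (is_series_Rext (fun d => / powerRZ t e * w (e + Z.of_nat d)%Z)).
    + intros d. unfold w. rewrite powerRZ_add by exact Ht. rewrite <- pow_powerRZ.
      field. apply powerRZ_NOR, Ht.
    + unfold Rdiv. rewrite Rmult_comm. apply (is_series_scal (/ powerRZ t e) _ l H').
  - intros z Hz. unfold w. rewrite qh_part_neg by exact Hz. ring.
  - intros z Hz. unfold w. rewrite qh_part_zero; [ring|].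
    intros k j E. destruct (Req_dec (c k j) 0) as [|Hn]; [assumption|].
    apply He in Hn. lia.
Qed.

(** * Quasihomogeneous parts on the unit circle as analytic coefficients *)

Lemma is_pseries2_coeff_bound (c : nat -> nat -> R) (d l : R) :
  0 < d -> is_pseries2 c d d l ->
  exists M, 0 <= M /\ forall k j, Rabs (c k j) <= M * (/ d) ^ (k + j).
Proof.
  intros Hd [[M HM] _].
  assert (HM0 : forall k j, Rabs (c k j * d ^ k * d ^ j) <= M).
  { intros k j. specialize (HM (Nat.max k j)). rewrite sum_n_Reals in HM.
    eapply Rle_trans; [|apply HM].
    apply Rle_trans with (sum_n (fun j => Rabs (c k j * d ^ k * d ^ j)) (Nat.max k j)).
    - rewrite sum_n_Reals.
      apply Rle_trans with (sum_f_R0 (fun j => Rabs (c k j * d ^ k * d ^ j)) j).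
      + apply (term_le_sum (fun j => Rabs (c k j * d ^ k * d ^ j))). intros; apply Rabs_pos.
      + apply sum_le_extend; [intros; apply Rabs_pos|lia].
    - set (f := fun i => sum_n (fun j0 => Rabs (c i j0 * d ^ i * d ^ j0)) (Nat.max k j)).
      assert (Hf : forall i, 0 <= f i).
      { intros i. unfold f. rewrite sum_n_Reals. apply sum_nonneg; intros; apply Rabs_pos. }
      apply Rle_trans with (sum_f_R0 f k).
      + apply (term_le_sum f k Hf).
      + apply sum_le_extend; [exact Hf|lia]. }
  exists M. split.
  { eapply Rle_trans; [apply Rabs_pos|apply (HM0 0%nat 0%nat)]. }
  intros k j. specialize (HM0 k j). rewrite Rmult_assoc, <- pow_add, Rabs_mult in HM0.
  assert (Hp : 0 < d ^ (k + j)) by (apply pow_lt, Hd).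
  rewrite (Rabs_pos_eq (d ^ (k + j))) in HM0 by lra. rewrite pow_inv.
  apply Rmult_le_reg_r with (d ^ (k + j)); [exact Hp|].
  rewrite Rmult_assoc, Rinv_l by lra. lra.
Qed.

(** The constant is [12 = 3 * 2 * 2]: a factor [3] for each sine or cosine, of which there are at
    most [d] since the weights are at least one, and [(d + 1) ^ 2 <= 2 ^ d * 2 ^ d] for the number
    of terms. *)
Lemma An_qh_part (c : nat -> nat -> R) (p q : nat) (z : Z) (M D : R) :
  (0 < p)%nat -> (0 < q)%nat -> 1 <= D ->
  (forall k j, Rabs (c k j) <= M * D ^ (k + j)) ->
  An 1 (M * (12 * D) ^ Z.to_nat z) (fun phi => qh_part c p q z (cos phi) (sin phi)).
Proof.
  intros Hp Hq HD Hc.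
  assert (HM : 0 <= M).
  { specialize (Hc 0%nat 0%nat). simpl in Hc. pose proof (Rabs_pos (c 0%nat 0%nat)). lra. }
  set (d := Z.to_nat z).
  apply (An_ext _ _ (fun phi => sum_f_R0 (fun k => sum_f_R0 (fun j =>
      if Z.eq_dec (Z.of_nat (p * k + q * j)) z then c k j * cos phi ^ k * sin phi ^ j else 0)
      d) d)).
  { intros phi. unfold qh_part. rewrite sum_n_Reals. apply sum_eq; intros k _.
    rewrite sum_n_Reals. reflexivity. }
  set (N := M * (3 * D) ^ d).
  assert (HN : 0 <= N) by (apply Rmult_le_pos; [lra|apply pow_le; lra]).
  apply (An_weaken 1 1 (sum_f_R0 (fun _ => sum_f_R0 (fun _ => N) d) d)).
  - lra.
  - rewrite !sum_cte.
    assert (H2 : forall n, INR (S n) <= 2 ^ n).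
    { induction n as [|n IH]; [simpl; lra|]. rewrite S_INR. simpl pow.
      assert (1 <= 2 ^ n) by (apply pow_R1_Rle; lra). lra. }
    specialize (H2 d). pose proof (pos_INR (S d)).
    replace (12 * D) with (2 * 2 * (3 * D)) by ring. rewrite !(Rpow_mult_distr _ (3 * D)).
    rewrite Rpow_mult_distr. fold d.
    replace (M * (2 ^ d * 2 ^ d * (3 * D) ^ d)) with (N * (2 ^ d * 2 ^ d))
      by (unfold N; ring).
    rewrite Rmult_assoc. apply Rmult_le_compat_l; [exact HN|].
    apply Rmult_le_compat; assumption.
  - apply (An_sum 1 _ (fun k phi => sum_f_R0 (fun j =>
      if Z.eq_dec (Z.of_nat (p * k + q * j)) z
      then c k j * cos phi ^ k * sin phi ^ j else 0) d)); [lra|].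
    intros k Hk.
    apply (An_sum 1 _ (fun j phi => 
      if Z.eq_dec (Z.of_nat (p * k + q * j)) z
      then c k j * cos phi ^ k * sin phi ^ j else 0)); [lra|].
    intros j Hj. destruct (Z.eq_dec (Z.of_nat (p * k + q * j)) z) as [E|E].
    + apply (An_weaken 1 1 (Rabs (c k j) * 3 ^ k * 3 ^ j)); [lra| |].
      * rewrite Rmult_assoc, <- pow_add.
        apply Rle_trans with (M * D ^ (k + j) * 3 ^ (k + j)).
        { apply Rmult_le_compat_r; [apply pow_le; lra|apply Hc]. }
        unfold N. rewrite Rmult_assoc, <- Rpow_mult_distr, (Rmult_comm D).
        apply Rmult_le_compat_l; [lra|]. apply Rle_pow; [lra|]. unfold d. nia.
      * apply An_mult; [lra| |apply An_pow; [lra|apply An_sin]].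
        apply An_scal; [lra|]. apply An_pow; [lra|apply An_cos].
    + apply (An_weaken 1 1 (Rabs 0)); [lra|rewrite Rabs_R0; exact HN|apply An_const].
Qed.

Lemma analytic_coeffs_plus (w w' : nat -> R -> R) :
  analytic_coeffs w -> analytic_coeffs w' -> analytic_coeffs (fun j x => w j x + w' j x).
Proof.
  intros Hw Hw'. destruct (analytic_coeffs_common w w' Hw Hw') as (a & M & B & Ha & HB & H & H').
  exists a, (M + M), B. repeat split; auto. intros j.
  rewrite Rmult_plus_distr_r. apply An_plus; [lra|apply H|apply H'].
Qed.

Lemma analytic_coeffs_scale (f : R -> R) (w : nat -> R -> R) (a0 M0 : R) :
  0 < a0 -> An a0 M0 f -> analytic_coeffs w -> analytic_coeffs (fun j x => f x * w j x).
Proof.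
  intros Ha0 Hf (a & M & B & Ha & HB & H).
  assert (Hm : 0 < Rmin a0 a) by (apply Rmin_glb_lt; auto).
  pose proof (Rmin_l a0 a). pose proof (Rmin_r a0 a).
  exists (Rmin a0 a), (M0 * M), B. repeat split; auto. intros j.
  rewrite Rmult_assoc. apply An_mult; [lra| |].
  - apply (An_weaken a0 _ M0); auto; lra.
  - apply (An_weaken a _ (M * B ^ j)); auto; lra.
Qed.

Lemma analytic_coeffs_qh (c : nat -> nat -> R) (p q : nat) (e : Z) (M D : R) :
  (0 < p)%nat -> (0 < q)%nat -> 1 <= D ->
  (forall k j, Rabs (c k j) <= M * D ^ (k + j)) ->
  analytic_coeffs (fun d phi => qh_part c p q (e + Z.of_nat d) (cos phi) (sin phi)).
Proof.
  intros Hp Hq HD Hc. exists 1, (M * (12 * D) ^ Z.to_nat (Z.abs e)), (12 * D).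
  assert (HM : 0 <= M).
  { specialize (Hc 0%nat 0%nat). simpl in Hc. pose proof (Rabs_pos (c 0%nat 0%nat)). lra. }
  split; [lra|]. split; [lra|]. intros j.
  apply (An_weaken 1 1 (M * (12 * D) ^ Z.to_nat (e + Z.of_nat j))); [lra| |].
  - rewrite Rmult_assoc, <- pow_add. apply Rmult_le_compat_l; [exact HM|].
    apply Rle_pow; [lra|lia].
  - apply An_qh_part; assumption.
Qed.

(** * The expansion of the polar field at the boundary circle *)

Definition theta_coef (X : analytic_field) (p q : nat) (r : Z) (s : R)
    (d : nat) (phi : R) : R :=
  s * (INR p * cos phi
         * qh_part (coefQ X) p q (r + Z.of_nat q + Z.of_nat d) (cos phi) (sin phi)
       - INR q * sin phi
         * qh_part (coefP X) p q (r + Z.of_nat p + Z.of_nat d) (cos phi) (sin phi))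
    / polar_den p q phi.

(** The factor [rho] common to all terms of [polar_R] is taken out, so index [d] belongs to
    [rho ^ (d + 1)] in [polar_R]. *)
Definition rho_coef (X : analytic_field) (p q : nat) (r : Z) (s : R)
    (d : nat) (phi : R) : R :=
  s * (cos phi * qh_part (coefP X) p q (r + Z.of_nat p + Z.of_nat d) (cos phi) (sin phi)
       + sin phi * qh_part (coefQ X) p q (r + Z.of_nat q + Z.of_nat d) (cos phi) (sin phi))
    / polar_den p q phi.

Lemma polar_den_ge_1 (p q : nat) (phi : R) :
  (0 < p)%nat -> (0 < q)%nat -> 1 <= polar_den p q phi.
Proof.
  intros Hp Hq. unfold polar_den. pose proof (sin2_cos2 phi) as E. unfold Rsqr in E.
  apply le_INR in Hp, Hq. simpl in Hp, Hq.
  pose proof (pow2_ge_0 (cos phi)). pose proof (pow2_ge_0 (sin phi)). nra.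
Qed.

Lemma An_polar_den_inv (p q : nat) : (0 < p)%nat -> (0 < q)%nat ->
  exists a M, 0 < a /\ An a M (fun phi => / polar_den p q phi).
Proof.
  intros Hp Hq.
  destruct (An_inv 1 (Rabs (INR p) * 3 ^ 2 + Rabs (INR q) * 3 ^ 2) 1 (polar_den p q))
    as (a & M & Ha & H); [lra|lra| | |].
  - apply (An_plus 1 _ _ (fun x => INR p * cos x ^ 2) (fun x => INR q * sin x ^ 2)); [lra| |].
    + apply An_scal; [lra|]. apply An_pow; [lra|apply An_cos].
    + apply An_scal; [lra|]. apply An_pow; [lra|apply An_sin].
  - intros; apply polar_den_ge_1; assumption.
  - exists a, M. split; [lra|exact H].
Qed.

Lemma field_coeff_bounds (X : analytic_field) : exists d M D, 0 < d /\ 1 <= D /\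
  (forall k j, Rabs (coefP X k j) <= M * D ^ (k + j)) /\
  (forall k j, Rabs (coefQ X k j) <= M * D ^ (k + j)) /\
  (forall x y, Rabs x < d -> Rabs y < d -> dom X (x, y) /\
     is_pseries2 (coefP X) x y (compP X x y) /\ is_pseries2 (coefQ X) x y (compQ X x y)).
Proof.
  destruct (compP_taylor X) as (d1 & Hd1 & HP). destruct (compQ_taylor X) as (d2 & Hd2 & HQ).
  destruct (dom_open X (0, 0) (dom_origin X)) as [d3 Hd3].
  (* The bound [d <= 1] guarantees [1 <= D] for the growth constant [D = / (d / 2)] read off at the
     point [(d / 2, d / 2)]. *)
  set (d := Rmin (Rmin d1 d2) (Rmin d3 1)).
  assert (Hd : 0 < d).
  { unfold d. apply Rmin_glb_lt; apply Rmin_glb_lt; try assumption; [apply cond_pos|lra]. }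
  assert (L1 : d <= d1) by (eapply Rle_trans; [apply Rmin_l|apply Rmin_l]).
  assert (L2 : d <= d2) by (eapply Rle_trans; [apply Rmin_l|apply Rmin_r]).
  assert (L3 : d <= d3) by (eapply Rle_trans; [apply Rmin_r|apply Rmin_l]).
  assert (L4 : d <= 1) by (eapply Rle_trans; [apply Rmin_r|apply Rmin_r]).
  assert (Hall : forall x y, Rabs x < d -> Rabs y < d -> dom X (x, y) /\
     is_pseries2 (coefP X) x y (compP X x y) /\ is_pseries2 (coefQ X) x y (compQ X x y)).
  { intros x y Hx Hy. assert (HD : dom X (x, y)).
    { apply Hd3. split; simpl; unfold ball; simpl; unfold AbsRing_ball, abs, minus, plus, opp;
        simpl; rewrite Ropp_0, Rplus_0_r; lra. }
    split; [exact HD|].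
    specialize (HP x y HD). specialize (HQ x y HD). rewrite !Rminus_0_r in HP, HQ.
    split; [apply HP|apply HQ]; lra. }
  assert (Hh : Rabs (d / 2) < d) by (rewrite Rabs_pos_eq; lra).
  destruct (Hall _ _ Hh Hh) as (_ & EP & EQ).
  assert (Hd2' : 0 < d / 2) by lra.
  destruct (is_pseries2_coeff_bound _ _ _ Hd2' EP) as (M1 & HM1 & B1).
  destruct (is_pseries2_coeff_bound _ _ _ Hd2' EQ) as (M2 & HM2 & B2).
  assert (HD : 1 <= / (d / 2)).
  { rewrite <- Rinv_1 at 1. apply Rinv_le_contravar; lra. }
  exists d, (M1 + M2), (/ (d / 2)). split; [exact Hd|]. split; [exact HD|].
  assert (Hp : forall n, 0 <= (/ (d / 2)) ^ n) by (intros; apply pow_le; lra).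
  split; [|split; [|exact Hall]]; intros k j.
  - eapply Rle_trans; [apply B1|]. apply Rmult_le_compat_r; [apply Hp|lra].
  - eapply Rle_trans; [apply B2|]. apply Rmult_le_compat_r; [apply Hp|lra].
Qed.

Lemma polar_coeffs_analytic (X : analytic_field) (p q : nat) (r : Z) (s : R) :
  (0 < p)%nat -> (0 < q)%nat ->
  analytic_coeffs (theta_coef X p q r s) /\ analytic_coeffs (rho_coef X p q r s).
Proof.
  intros Hp Hq. destruct (field_coeff_bounds X) as (d & M & D & Hd & HD & BP & BQ & _).
  destruct (An_polar_den_inv p q Hp Hq) as (a & N & Ha & Hden).
  assert (AP := analytic_coeffs_qh (coefP X) p q (r + Z.of_nat p) M D Hp Hq HD BP).
  assert (AQ := analytic_coeffs_qh (coefQ X) p q (r + Z.of_nat q) M D Hp Hq HD BQ).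
  assert (Ac : forall c, An 1 (Rabs c * 3) (fun x => c * cos x)).
  { intros; apply An_scal; [lra|apply An_cos]. }
  assert (As : forall c, An 1 (Rabs c * 3) (fun x => c * sin x)).
  { intros; apply An_scal; [lra|apply An_sin]. }
  assert (H1 : 0 < 1) by lra.
  split.
  - apply (analytic_coeffs_ext (fun j phi => / polar_den p q phi *
       ((s * INR p) * cos phi
         * qh_part (coefQ X) p q (r + Z.of_nat q + Z.of_nat j) (cos phi) (sin phi)
       + (- s * INR q) * sin phi
         * qh_part (coefP X) p q (r + Z.of_nat p + Z.of_nat j) (cos phi) (sin phi)))).
    { intros j x. unfold theta_coef, Rdiv. ring. }
    apply (analytic_coeffs_scale _ _ a N Ha Hden). apply analytic_coeffs_plus.
    + apply (analytic_coeffs_scale _ _ 1 _ H1 (Ac _) AQ).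
    + apply (analytic_coeffs_scale _ _ 1 _ H1 (As _) AP).
  - apply (analytic_coeffs_ext (fun j phi => / polar_den p q phi *
       (s * cos phi
         * qh_part (coefP X) p q (r + Z.of_nat p + Z.of_nat j) (cos phi) (sin phi)
       + s * sin phi
         * qh_part (coefQ X) p q (r + Z.of_nat q + Z.of_nat j) (cos phi) (sin phi)))).
    { intros j x. unfold rho_coef, Rdiv. ring. }
    apply (analytic_coeffs_scale _ _ a N Ha Hden). apply analytic_coeffs_plus.
    + apply (analytic_coeffs_scale _ _ 1 _ H1 (Ac _) AP).
    + apply (analytic_coeffs_scale _ _ 1 _ H1 (As _) AQ).
Qed.

Lemma polar_coeffs_periodic (X : analytic_field) (p q : nat) (r : Z) (s : R) (d : nat) :
  periodic (theta_coef X p q r s d) /\ periodic (rho_coef X p q r s d).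
Proof.
  assert (Hc : forall x, cos (x + 2 * PI) = cos x).
  { intros x. replace (x + 2 * PI) with (x + 2 * INR 1 * PI) by (simpl; ring).
    apply cos_period. }
  assert (Hs : forall x, sin (x + 2 * PI) = sin x).
  { intros x. replace (x + 2 * PI) with (x + 2 * INR 1 * PI) by (simpl; ring).
    apply sin_period. }
  split; intros x; unfold theta_coef, rho_coef, polar_den; rewrite Hc, Hs; reflexivity.
Qed.

Lemma leading_degree_P (X : analytic_field) (p q : nat) (r : Z) (k j : nat) :
  leading_degree X p q r -> coefP X k j <> 0 -> (r + Z.of_nat p <= Z.of_nat (p * k + q * j))%Z.
Proof.
  intros [_ H] Hn. assert (Hs : supp X k (S j)).
  { unfold supp. simpl. intros E. injection E as E1 _. apply Hn, E1. }
  specialize (H k (S j) Hs). nia.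
Qed.

Lemma leading_degree_Q (X : analytic_field) (p q : nat) (r : Z) (k j : nat) :
  leading_degree X p q r -> coefQ X k j <> 0 -> (r + Z.of_nat q <= Z.of_nat (p * k + q * j))%Z.
Proof.
  intros [_ H] Hn. assert (Hs : supp X (S k) j).
  { unfold supp. simpl. intros E. injection E as _ E1. apply Hn, E1. }
  specialize (H (S k) j Hs). nia.
Qed.

Lemma Rabs_pow_mult_small (d t c : R) (n : nat) :
  (0 < n)%nat -> Rabs t < d -> d <= 1 -> Rabs c <= 1 -> Rabs (t ^ n * c) < d.
Proof.
  intros Hn Ht Hd Hc. destruct n as [|n]; [lia|]. rewrite Rabs_mult, <- RPow_abs. simpl.
  pose proof (Rabs_pos t). pose proof (Rabs_pos c).
  assert (0 <= Rabs t ^ n <= 1).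
  { split; [apply pow_le; lra|]. rewrite <- (pow1 n). apply pow_incr; lra. }
  assert (0 <= Rabs t ^ n * Rabs c <= 1) by nra. nra.
Qed.

(** The least degree [r] bounds the weighted degrees in [P] below by [r + p] and those in [Q] by
    [r + q], so the division by [t ^ r] leaves power series. At [t = 0] their constant terms are the
    continuous extension chosen in [polar_Theta] and [polar_R]. *)
Lemma polar_field_expansion (X : analytic_field) (p q : nat) (r : Z) (s : R) :
  (0 < p)%nat -> (0 < q)%nat -> leading_degree X p q r ->
  exists d, 0 < d /\ forall phi t, Rabs t < d ->
    dom X (t ^ p * cos phi, t ^ q * sin phi) /\
    polar_Theta X p q r s phi t = coeff_sum (theta_coef X p q r s) phi t /\
    polar_R X p q r s phi t = t * coeff_sum (rho_coef X p q r s) phi t.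
Proof.
  intros Hp Hq Hr. destruct (field_coeff_bounds X) as (d0 & _ & _ & Hd0 & _ & _ & _ & Hd).
  assert (Hm : 0 < Rmin d0 1) by (apply Rmin_glb_lt; lra).
  pose proof (Rmin_l d0 1). pose proof (Rmin_r d0 1).
  exists (Rmin d0 1). split; [exact Hm|]. intros phi t Ht.
  destruct (Hd (t ^ p * cos phi) (t ^ q * sin phi)) as (HD & HP & HQ).
  { eapply Rlt_le_trans; [apply Rabs_pow_mult_small with (d := Rmin d0 1)|]; auto.
    apply Rabs_le, COS_bound. }
  { eapply Rlt_le_trans; [apply Rabs_pow_mult_small with (d := Rmin d0 1)|]; auto.
    apply Rabs_le, SIN_bound. }
  split; [exact HD|].
  assert (Hden := polar_den_ge_1 p q phi Hp Hq).
  unfold polar_Theta, polar_R. destruct (Req_EM_T t 0) as [->|Hn].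
  - unfold coeff_sum. rewrite !PSeries_0. split; [|ring].
    unfold theta_coef. rewrite !Z.add_0_r. reflexivity.
  - apply (is_pseries2_weighted _ _ _ (r + Z.of_nat p)) in HP; auto.
    2:{ intros; apply (leading_degree_P X p q r); assumption. }
    apply (is_pseries2_weighted _ _ _ (r + Z.of_nat q)) in HQ; auto.
    2:{ intros; apply (leading_degree_Q X p q r); assumption. }
    set (SP := compP X (t ^ p * cos phi) (t ^ q * sin phi)) in *.
    set (SQ := compQ X (t ^ p * cos phi) (t ^ q * sin phi)) in *.
    assert (Hpr : powerRZ t r <> 0) by (apply powerRZ_NOR, Hn).
    assert (Htp : t ^ p <> 0) by (apply pow_nonzero, Hn).
    assert (Htq : t ^ q <> 0) by (apply pow_nonzero, Hn).
    rewrite powerRZ_add, <- pow_powerRZ in HP by exact Hn.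
    rewrite powerRZ_add, <- pow_powerRZ in HQ by exact Hn.
    cbv zeta. fold SP SQ.
    assert (Hlin : forall u v : R,
       is_series (fun j => (u * qh_part (coefP X) p q (r + Z.of_nat p + Z.of_nat j) (cos phi) (sin phi)
          + v * qh_part (coefQ X) p q (r + Z.of_nat q + Z.of_nat j) (cos phi) (sin phi)) * t ^ j)
         (u * (SP / (powerRZ t r * t ^ p)) + v * (SQ / (powerRZ t r * t ^ q)))).
    { intros u v.
      apply (is_series_Rext (fun j =>
          u * (qh_part (coefP X) p q (r + Z.of_nat p + Z.of_nat j) (cos phi) (sin phi) * t ^ j)
          + v * (qh_part (coefQ X) p q (r + Z.of_nat q + Z.of_nat j) (cos phi) (sin phi) * t ^ j))).
      { intros; ring. }
      apply (is_series_plus (V := R_NormedModule)).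
      - apply (is_series_scal u _ _ HP).
      - apply (is_series_scal v _ _ HQ). }
    unfold coeff_sum, PSeries. rewrite pow_add. split.
    + symmetry. apply is_series_unique.
      replace (s * (INR p * cos phi * t ^ p * SQ - INR q * sin phi * t ^ q * SP)
                / (powerRZ t r * (t ^ p * t ^ q) * polar_den p q phi))
        with ((- s * INR q * sin phi / polar_den p q phi) * (SP / (powerRZ t r * t ^ p))
            + (s * INR p * cos phi / polar_den p q phi) * (SQ / (powerRZ t r * t ^ q)))
        by (field; repeat split; auto; lra).
      eapply is_series_Rext; [|apply Hlin].
      intros j. unfold theta_coef. cbv beta. field. lra.
    + replace (s * t * (t ^ q * cos phi * SP + t ^ p * sin phi * SQ)
                / (powerRZ t r * (t ^ p * t ^ q) * polar_den p q phi))
        with (t * ((s * cos phi / polar_den p q phi) * (SP / (powerRZ t r * t ^ p))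
            + (s * sin phi / polar_den p q phi) * (SQ / (powerRZ t r * t ^ q))))
        by (field; repeat split; auto; lra).
      f_equal. symmetry. apply is_series_unique.
      eapply is_series_Rext; [|apply Hlin].
      intros j. unfold rho_coef. cbv beta. field. lra.
Qed.

(** * Weighted polar coordinates along a curve *)

Lemma pow_lt_incr (a b : R) (n : nat) : 0 <= a < b -> (0 < n)%nat -> a ^ n < b ^ n.
Proof.
  intros Hab Hn. destruct n as [|n]; [lia|]. clear Hn.
  induction n as [|n IH]; [simpl; lra|].
  change (a * a ^ S n < b * b ^ S n).
  assert (0 <= a ^ S n) by (apply pow_le; lra). nra.
Qed.

(** For [X = x ^ 2] and [Y = y ^ 2], the weighted radius of [(x, y)] is the inverse of the root [m]
    of [wnorm = 1]. Working with the inverse radius makes the equation polynomial and increasing in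
    [m]. *)
Definition wnorm (p q : nat) (X Y m : R) : R := X * m ^ (2 * p) + Y * m ^ (2 * q).

Lemma wnorm_lt (p q : nat) (X Y a b : R) :
  (0 < p)%nat -> (0 < q)%nat -> 0 <= X -> 0 <= Y -> 0 < X + Y -> 0 <= a < b ->
  wnorm p q X Y a < wnorm p q X Y b.
Proof.
  intros Hp Hq HX HY HXY Hab. unfold wnorm.
  assert (H1 := pow_lt_incr a b (2 * p) Hab ltac:(lia)).
  assert (H2 := pow_lt_incr a b (2 * q) Hab ltac:(lia)).
  destruct HX as [HX|HX]; destruct HY as [HY|HY]; nra.
Qed.

Lemma wnorm_root (p q : nat) (X Y : R) :
  (0 < p)%nat -> (0 < q)%nat -> 0 <= X -> 0 <= Y -> 0 < X + Y ->
  exists m, 0 < m /\ wnorm p q X Y m = 1.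
Proof.
  intros Hp Hq HX HY HXY.
  assert (Hi : 0 < / (X + Y)) by (apply Rinv_0_lt_compat, HXY).
  (* Chosen so that [(X + Y) * b = X + Y + 1 > 1], while [b >= 1] is below its positive powers;
     hence the value at [b] exceeds one. *)
  set (b := 1 + / (X + Y)).
  assert (Hb : forall n, (0 < n)%nat -> b <= b ^ n).
  { intros n Hn. destruct n as [|n]; [lia|]. simpl.
    assert (1 <= b ^ n) by (apply pow_R1_Rle; unfold b; lra). unfold b in *. nra. }
  destruct (IVT (fun m => wnorm p q X Y m - 1) 0 b) as (m & Hm & E).
  - unfold wnorm. reg.
  - unfold b; lra.
  - unfold wnorm. rewrite !pow_i by lia. lra.
  - unfold wnorm. assert (H1 := Hb (2 * p)%nat ltac:(lia)).
    assert (H2 := Hb (2 * q)%nat ltac:(lia)).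
    assert ((X + Y) * b = X + Y + 1) by (unfold b; field; lra). nra.
  - exists m. split; [|lra].
    destruct (proj1 Hm) as [H|H]; [exact H|]. subst m. unfold wnorm in E.
    rewrite !pow_i in E by lia. lra.
Qed.

Lemma circle_angle (c s : R) : c ^ 2 + s ^ 2 = 1 -> exists a, cos a = c /\ sin a = s.
Proof.
  intros E. assert (Hc : -1 <= c <= 1) by (split; nra).
  destruct (Rle_dec 0 s) as [Hs|Hs].
  - exists (acos c). rewrite cos_acos, sin_acos by exact Hc. split; [reflexivity|].
    replace (1 - c²) with (s²) by (unfold Rsqr; lra). apply sqrt_Rsqr, Hs.
  - exists (- acos c). rewrite cos_neg, sin_neg, cos_acos, sin_acos by exact Hc.
    split; [reflexivity|]. replace (1 - c²) with ((- s)²) by (unfold Rsqr; lra).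
    rewrite sqrt_Rsqr by lra. ring.
Qed.

Lemma weighted_polar_exists (p q : nat) (x y : R) :
  (0 < p)%nat -> (0 < q)%nat -> (x, y) <> (0, 0) ->
  exists t a, 0 < t /\ x = t ^ p * cos a /\ y = t ^ q * sin a.
Proof.
  intros Hp Hq Hxy.
  assert (HXY : 0 < x ^ 2 + y ^ 2).
  { destruct (Req_dec x 0) as [->|Hx]; [|pose proof (pow2_gt_0 x Hx); pose proof (pow2_ge_0 y); lra].
    destruct (Req_dec y 0) as [->|Hy]; [contradiction Hxy; reflexivity|].
    pose proof (pow2_gt_0 y Hy); pose proof (pow2_ge_0 0); lra. }
  destruct (wnorm_root p q (x ^ 2) (y ^ 2)) as (m & Hm & E); auto using pow2_ge_0.
  destruct (circle_angle (x * m ^ p) (y * m ^ q)) as (a & Ec & Es).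
  { rewrite <- E. unfold wnorm. rewrite !Rpow_mult_distr, <- !pow_mult.
    rewrite !(Nat.mul_comm 2). reflexivity. }
  exists (/ m), a. split; [apply Rinv_0_lt_compat, Hm|].
  rewrite Ec, Es, !pow_inv.
  split; field; apply pow_nonzero; lra.
Qed.

Lemma weighted_polar_wnorm (p q : nat) (t a : R) : 0 < t ->
  wnorm p q ((t ^ p * cos a) ^ 2) ((t ^ q * sin a) ^ 2) (/ t) = 1.
Proof.
  intros Ht. unfold wnorm. rewrite !Rpow_mult_distr, <- !pow_mult, !(Nat.mul_comm 2), !pow_inv.
  assert (E := sin2_cos2 a). unfold Rsqr in E.
  replace 1 with (cos a ^ 2 + sin a ^ 2) by (simpl; lra).
  field. split; apply pow_nonzero; lra.
Qed.

Lemma weighted_polar_unique (p q : nat) (t t' a a' : R) :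
  (0 < p)%nat -> (0 < q)%nat -> 0 < t -> 0 < t' ->
  t ^ p * cos a = t' ^ p * cos a' -> t ^ q * sin a = t' ^ q * sin a' ->
  t = t' /\ cos a = cos a' /\ sin a = sin a'.
Proof.
  intros Hp Hq Ht Ht' Ex Ey.
  assert (E := weighted_polar_wnorm p q t a Ht).
  assert (E' := weighted_polar_wnorm p q t' a' Ht').
  rewrite <- Ex, <- Ey in E'.
  assert (Hi : 0 < / t) by (apply Rinv_0_lt_compat, Ht).
  assert (Hi' : 0 < / t') by (apply Rinv_0_lt_compat, Ht').
  set (X := (t ^ p * cos a) ^ 2) in *. set (Y := (t ^ q * sin a) ^ 2) in *.
  assert (HX : 0 <= X) by apply pow2_ge_0. assert (HY : 0 <= Y) by apply pow2_ge_0.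
  assert (HXY : 0 < X + Y).
  { destruct HX as [HX|HX]; [lra|]. destruct HY as [HY|HY]; [lra|].
    unfold wnorm in E. rewrite <- HX, <- HY in E. lra. }
  assert (Et : t = t').
  { rewrite <- (Rinv_inv t), <- (Rinv_inv t'). f_equal.
    destruct (Rtotal_order (/ t) (/ t')) as [H|[H|H]]; [|exact H|];
      [assert (W := wnorm_lt p q X Y (/ t) (/ t') Hp Hq HX HY HXY ltac:(lra))
      |assert (W := wnorm_lt p q X Y (/ t') (/ t) Hp Hq HX HY HXY ltac:(lra))]; lra. }
  subst t'. split; [reflexivity|].
  split; [apply Rmult_eq_reg_l with (t ^ p)|apply Rmult_eq_reg_l with (t ^ q)];
    auto; apply pow_nonzero; lra.
Qed.

Lemma cos_sin_eq_mod (a b : R) :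
  cos a = cos b -> sin a = sin b -> exists n : Z, a = b + 2 * PI * IZR n.
Proof.
  intros Ec Es. pose proof PI_RGT_0 as HP.
  destruct (mod_2PI (a - b)) as (n & y & E & Hy).
  assert (Hc : cos y = 1).
  { rewrite <- (periodic_IZR cos n y).
    - rewrite <- E, cos_minus, Ec, Es. pose proof (sin2_cos2 b). unfold Rsqr in *. lra.
    - intros x. replace (x + 2 * PI) with (x + 2 * INR 1 * PI) by (simpl; ring).
      apply cos_period. }
  assert (Hs : sin (y / 2) = 0).
  { replace y with (2 * (y / 2)) in Hc by field. rewrite cos_2a_sin in Hc. nra. }
  destruct (Req_dec y 0) as [H0|H0]; [exists n; lra|].
  destruct (Req_dec y (2 * PI)) as [H1|H1].
  - exists (n + 1)%Z. rewrite plus_IZR. lra.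
  - assert (0 < sin (y / 2)) by (apply sin_gt_0; lra). lra.
Qed.

(** The divided difference [(a ^ n - b ^ n) / (a - b)], in a form that also makes sense for
    [a = b]. *)
Fixpoint powq (n : nat) (a b : R) : R :=
  match n with
  | O => 0
  | S k => a ^ k + b * powq k a b
  end.

Lemma powq_spec (n : nat) (a b : R) : a ^ n - b ^ n = (a - b) * powq n a b.
Proof.
  induction n as [|n IH]; simpl; [ring|].
  replace (b ^ n) with (a ^ n - (a - b) * powq n a b) by lra. ring.
Qed.

Lemma powq_pos (n : nat) (a b : R) : 0 < a -> 0 < b -> (0 < n)%nat -> 0 < powq n a b.
Proof.
  intros Ha Hb Hn. destruct n as [|n]; [lia|]. clear Hn.
  induction n as [|n IH]; [simpl; lra|].
  change (0 < a ^ S n + b * powq (S n) a b).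
  assert (0 < a ^ S n) by (apply pow_lt, Ha). nra.
Qed.

Lemma continuity_pt_powq (n : nat) (f : R -> R) (b x : R) :
  continuity_pt f x -> continuity_pt (fun t => powq n (f t) b) x.
Proof.
  intros Hf. induction n as [|n IH]; simpl.
  - apply continuity_pt_const. intros u v; reflexivity.
  - apply (continuity_pt_plus (fun t => f t ^ n) (fun t => b * powq n (f t) b)).
    + apply (continuity_pt_comp f (fun u => u ^ n)); [exact Hf|].
      apply derivable_continuous_pt, derivable_pt_pow.
    + apply (continuity_pt_mult (fun _ => b)); [|exact IH].
      apply continuity_pt_const. intros u v; reflexivity.
Qed.

(** Caratheodory's form of differentiability: since [h] vanishes at [x], continuity of the cofactor
    [k] is enough. *)
Lemma is_derive_factor (f h k : R -> R) (x dh : R) :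
  h x = 0 -> is_derive h x dh -> continuity_pt k x ->
  (exists e, 0 < e /\ forall t, Rabs (t - x) < e -> f t - f x = h t * k t) ->
  is_derive f x (dh * k x).
Proof.
  intros Hx Dh Ck (e & He & E). apply is_derive_Reals. apply is_derive_Reals in Dh.
  apply uniqueness_step3.
  assert (L1 := uniqueness_step2 _ _ _ Dh).
  assert (L2 : limit1_in (fun d => k (x + d)) (fun d => d <> 0) (k x) 0).
  { intros eps Heps. destruct (Ck eps Heps) as (alp & Ha & H). exists alp. split; [exact Ha|].
    intros d [Hd Hd']. simpl in *. unfold R_dist in *. rewrite Rminus_0_r in Hd'.
    apply H. split; [split; [exact I|]|].
    - intros E'. apply Hd. lra.
    - replace (x + d - x) with d by ring. exact Hd'. }
  assert (L := limit_mul _ _ _ _ _ _ L1 L2).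
  intros eps Heps. destruct (L eps Heps) as (alp & Ha & H).
  exists (Rmin alp e). split; [apply Rmin_glb_lt; assumption|].
  intros d [Hd Hd']. simpl in *. unfold R_dist in *.
  specialize (H d). unfold R_dist in H. rewrite Rminus_0_r in *.
  assert (Hm1 := Rmin_l alp e). assert (Hm2 := Rmin_r alp e).
  replace ((f (x + d) - f x) / d) with ((h (x + d) - h x) / d * k (x + d)).
  - apply H. split; [exact Hd|lra].
  - rewrite E by (replace (x + d - x) with d by ring; lra). rewrite Hx. field. exact Hd.
Qed.

Lemma is_derive_continuity_pt (f : R -> R) (x l : R) : is_derive f x l -> continuity_pt f x.
Proof.
  intros H. apply derivable_continuous_pt. exists l. apply is_derive_Reals, H.
Qed.

(** Just below and just above [m x] the function [wnorm] is on opposite sides of one; this persists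
    for nearby [t], and monotonicity then traps the root [m t]. *)
Lemma wnorm_root_continuous (p q : nat) (X Y m : R -> R) (x : R) :
  (0 < p)%nat -> (0 < q)%nat ->
  continuity_pt X x -> continuity_pt Y x ->
  (forall t, 0 <= X t /\ 0 <= Y t /\ 0 < X t + Y t /\ 0 < m t /\ wnorm p q (X t) (Y t) (m t) = 1) ->
  continuity_pt m x.
Proof.
  intros Hp Hq CX CY H.
  assert (CW : forall c, continuity_pt (fun t => wnorm p q (X t) (Y t) c) x).
  { intros c. unfold wnorm.
    apply (continuity_pt_plus (fun t => X t * c ^ (2 * p)) (fun t => Y t * c ^ (2 * q)));
      [apply (continuity_pt_mult X (fun _ => _))|apply (continuity_pt_mult Y (fun _ => _))];
      auto; apply continuity_pt_const; intros u v; reflexivity. }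
  destruct (H x) as (HX & HY & HXY & Hm & E).
  apply continuity_pt_locally. intros eps.
  set (d := Rmin (eps / 2) (m x / 2)).
  pose proof (cond_pos eps) as He.
  assert (Hd : 0 < d) by (apply Rmin_glb_lt; lra).
  assert (Hd1 : d <= eps / 2) by apply Rmin_l. assert (Hd2 : d <= m x / 2) by apply Rmin_r.
  assert (W1 := wnorm_lt p q (X x) (Y x) (m x - d) (m x) Hp Hq HX HY HXY ltac:(lra)).
  assert (W2 := wnorm_lt p q (X x) (Y x) (m x) (m x + d) Hp Hq HX HY HXY ltac:(lra)).
  rewrite E in W1, W2.
  assert (C1 := CW (m x - d)). assert (C2 := CW (m x + d)).
  rewrite continuity_pt_locally in C1, C2.
  assert (P1 : 0 < 1 - wnorm p q (X x) (Y x) (m x - d)) by lra.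
  assert (P2 : 0 < wnorm p q (X x) (Y x) (m x + d) - 1) by lra.
  specialize (C1 (mkposreal _ P1)). specialize (C2 (mkposreal _ P2)).
  generalize (filter_and _ _ C1 C2). apply filter_imp. simpl. intros t [B1 B2].
  apply Rabs_def2 in B1, B2. destruct (H t) as (HXt & HYt & HXYt & Hmt & Et).
  apply Rabs_def1.
  - destruct (Rlt_le_dec (m t) (m x + d)) as [|Hc]; [lra|].
    assert (wnorm p q (X t) (Y t) (m x + d) <= wnorm p q (X t) (Y t) (m t)).
    { destruct Hc as [Hc|Hc]; [left; apply wnorm_lt; auto; lra|rewrite Hc; lra]. }
    lra.
  - destruct (Rlt_le_dec (m x - d) (m t)) as [|Hc]; [lra|].
    assert (wnorm p q (X t) (Y t) (m t) <= wnorm p q (X t) (Y t) (m x - d)).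
    { destruct Hc as [Hc|Hc]; [left; apply wnorm_lt; auto; lra|rewrite Hc; lra]. }
    lra.
Qed.

(** The implicit function theorem by hand. Subtracting the equations at [t] and at [x] and dividing
    powers by [powq] gives [(m t - m x) * Dn t = h t], with [Dn] positive and continuous at [x] and
    [h] derivable there. *)
Lemma wnorm_root_derivable (p q : nat) (X Y m : R -> R) (x : R) :
  (0 < p)%nat -> (0 < q)%nat -> ex_derive X x -> ex_derive Y x ->
  (forall t, 0 <= X t /\ 0 <= Y t /\ 0 < X t + Y t /\ 0 < m t /\ wnorm p q (X t) (Y t) (m t) = 1) ->
  ex_derive m x.
Proof.
  intros Hp Hq [dX DX] [dY DY] H.
  assert (CX := is_derive_continuity_pt _ _ _ DX).
  assert (CY := is_derive_continuity_pt _ _ _ DY).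
  assert (Cm := wnorm_root_continuous p q X Y m x Hp Hq CX CY H).
  destruct (H x) as (HX & HY & HXY & Hm & E).
  set (Dn := fun t => X t * powq (2 * p) (m t) (m x) + Y t * powq (2 * q) (m t) (m x)).
  assert (HD : forall t, 0 < Dn t).
  { intros t. destruct (H t) as (HXt & HYt & HXYt & Hmt & Et). unfold Dn.
    assert (P1 := powq_pos (2 * p) (m t) (m x) Hmt Hm ltac:(lia)).
    assert (P2 := powq_pos (2 * q) (m t) (m x) Hmt Hm ltac:(lia)).
    destruct HXt as [HXt|HXt]; destruct HYt as [HYt|HYt]; nra. }
  assert (CD : continuity_pt Dn x).
  { unfold Dn. apply (continuity_pt_plus (fun t => X t * powq (2 * p) (m t) (m x))
        (fun t => Y t * powq (2 * q) (m t) (m x)));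
      [apply (continuity_pt_mult X)|apply (continuity_pt_mult Y)]; auto;
      apply (continuity_pt_powq _ m); exact Cm. }
  set (h := fun t => (X t - X x) * (- m x ^ (2 * p)) + (Y t - Y x) * (- m x ^ (2 * q))).
  eexists. apply (is_derive_factor m h (fun t => / Dn t) x).
  - unfold h. ring.
  - unfold h. apply is_derive_Rplus; apply is_derive_Rmult.
    + apply (is_derive_minus X (fun _ => X x)); [exact DX|apply @is_derive_const].
    + apply @is_derive_const.
    + apply (is_derive_minus Y (fun _ => Y x)); [exact DY|apply @is_derive_const].
    + apply @is_derive_const.
  - apply (continuity_pt_inv Dn); [exact CD|]. specialize (HD x). lra.
  - exists 1. split; [lra|]. intros t _. specialize (HD t).
    apply Rmult_eq_reg_r with (Dn t); [|lra].
    rewrite Rmult_assoc, Rinv_l, Rmult_1_r by lra.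
    destruct (H t) as (_ & _ & _ & _ & Et).
    unfold Dn, h. rewrite Rmult_plus_distr_l.
    replace ((m t - m x) * (X t * powq (2 * p) (m t) (m x)))
      with (X t * ((m t - m x) * powq (2 * p) (m t) (m x))) by ring.
    replace ((m t - m x) * (Y t * powq (2 * q) (m t) (m x)))
      with (Y t * ((m t - m x) * powq (2 * q) (m t) (m x))) by ring.
    rewrite <- !powq_spec. unfold wnorm in E, Et. lra.
Qed.

(* Only derivability at the single point [x] is available, so the lift is
   explicit near [x] instead of an integral along the curve. *)
Lemma local_angle (c s : R -> R) (x a : R) :
  ex_derive c x -> ex_derive s x -> (forall t, c t ^ 2 + s t ^ 2 = 1) ->
  cos a = c x -> sin a = s x ->
  exists b : R -> R, ex_derive b x /\ b x = a /\
    locally x (fun t => cos (b t) = c t /\ sin (b t) = s t).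
Proof.
  intros Dc Ds E Ec Es.
  (* Cosine and sine of the angle measured from its value at [x]. Near [x] the cosine is positive,
     so [atan (S t / C t)] recovers that angle. *)
  set (C := fun t => c t * c x + s t * s x). set (S := fun t => s t * c x - c t * s x).
  assert (E2 : forall t, C t ^ 2 + S t ^ 2 = 1).
  { intros t. unfold C, S. transitivity ((c t ^ 2 + s t ^ 2) * (c x ^ 2 + s x ^ 2)); [ring|].
    rewrite !E. ring. }
  assert (C0 : C x = 1) by (unfold C; rewrite <- (E x); ring).
  assert (S0 : S x = 0) by (unfold S; ring).
  assert (DC : ex_derive C x) by (unfold C; auto_derive; auto).
  assert (DS : ex_derive S x) by (unfold S; auto_derive; auto).
  exists (fun t => a + atan (S t / C t)). split; [|split].
  - destruct DC as [dC DC]. destruct DS as [dS DS]. eexists.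
    apply is_derive_Rplus; [apply @is_derive_const|].
    apply (is_derive_comp atan (fun t => S t / C t)).
    + apply is_derive_Reals, derivable_pt_lim_atan.
    + apply is_derive_Rmult; [exact DS|]. apply is_derive_inv; [exact DC|]. rewrite C0; lra.
  - rewrite S0. unfold Rdiv. rewrite Rmult_0_l, atan_0. ring.
  - assert (CC := ex_derive_Rcontinuous C x DC). apply continuity_pt_filterlim in CC.
    rewrite continuity_pt_locally in CC. specialize (CC (mkposreal 1 Rlt_0_1)).
    revert CC. apply filter_imp. simpl. intros t Ht. rewrite C0 in Ht. apply Rabs_def2 in Ht.
    assert (HC : 0 < C t) by lra. specialize (E2 t).
    assert (Hsq : sqrt (1 + (S t / C t)²) = / C t).
    { replace (1 + (S t / C t)²) with ((/ C t)²).
      - apply sqrt_Rsqr. left; apply Rinv_0_lt_compat, HC.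
      - unfold Rsqr. apply Rmult_eq_reg_r with (C t ^ 2); [|apply pow_nonzero; lra].
        transitivity 1; [field; lra|].
        transitivity (C t ^ 2 + S t ^ 2); [lra|]. field. lra. }
    assert (A1 : cos (atan (S t / C t)) = C t).
    { rewrite cos_atan, Hsq. field. lra. }
    assert (A2 : sin (atan (S t / C t)) = S t).
    { rewrite sin_atan, Hsq. field. lra. }
    rewrite cos_plus, sin_plus, A1, A2, Ec, Es. unfold C, S.
    assert (Ex := E x). split.
    + transitivity (c t * (c x ^ 2 + s x ^ 2)); [ring|]. rewrite Ex. ring.
    + transitivity (s t * (c x ^ 2 + s x ^ 2)); [ring|]. rewrite Ex. ring.
Qed.

(** The angle [an] comes from a pointwise choice and may jump by multiples of [2 * PI]; only its
    cosine and sine are regular. Around each time it is replaced by a derivable lift [b]. *)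
Lemma weighted_polar_lift (p q : nat) (x y ra an : R -> R) (t0 : R) :
  (0 < p)%nat -> (0 < q)%nat -> ex_derive x t0 -> ex_derive y t0 ->
  (forall t, 0 < ra t /\ x t = ra t ^ p * cos (an t) /\ y t = ra t ^ q * sin (an t)) ->
  ex_derive ra t0 /\
  exists b : R -> R, ex_derive b t0 /\ b t0 = an t0 /\
    locally t0 (fun t => cos (b t) = cos (an t) /\ sin (b t) = sin (an t)).
Proof.
  intros Hp Hq Dx Dy H.
  assert (Dm : ex_derive (fun t => / ra t) t0).
  { apply (wnorm_root_derivable p q (fun t => x t ^ 2) (fun t => y t ^ 2)); auto.
    - auto_derive; auto.
    - auto_derive; auto.
    - intros t. destruct (H t) as (Hr & Ex & Ey).
      assert (W := weighted_polar_wnorm p q (ra t) (an t) Hr). rewrite <- Ex, <- Ey in W.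
      assert (P1 := pow2_ge_0 (x t)). assert (P2 := pow2_ge_0 (y t)).
      repeat split; auto; [|apply Rinv_0_lt_compat, Hr].
      destruct P1 as [P1|P1]; [lra|]. destruct P2 as [P2|P2]; [lra|].
      unfold wnorm in W. rewrite <- P1, <- P2 in W. lra. }
  assert (Hi : forall t, 0 < / ra t) by (intros t; apply Rinv_0_lt_compat, (H t)).
  assert (Dr : ex_derive ra t0).
  { apply (ex_derive_ext (fun t => / / ra t)).
    - intros t. apply Rinv_inv.
    - destruct Dm as [dm Dm]. eexists. apply is_derive_inv; [exact Dm|]. specialize (Hi t0). lra. }
  split; [exact Dr|].
  set (c := fun t => x t * (/ ra t) ^ p). set (s := fun t => y t * (/ ra t) ^ q).
  assert (Ec : forall t, c t = cos (an t)).
  { intros t. unfold c. destruct (H t) as (Hr & Ex & _). rewrite Ex, pow_inv. field.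
    apply pow_nonzero; lra. }
  assert (Es : forall t, s t = sin (an t)).
  { intros t. unfold s. destruct (H t) as (Hr & _ & Ey). rewrite Ey, pow_inv. field.
    apply pow_nonzero; lra. }
  destruct (local_angle c s t0 (an t0)) as (b & Db & Eb & Hb); auto.
  - unfold c. apply @ex_derive_mult; [exact Dx|]. apply ex_derive_pow, Dm.
  - unfold s. apply @ex_derive_mult; [exact Dy|]. apply ex_derive_pow, Dm.
  - intros t. rewrite Ec, Es. pose proof (sin2_cos2 (an t)) as Q. unfold Rsqr in Q.
    simpl. lra.
  - exists b. split; [exact Db|]. split; [exact Eb|].
    revert Hb. apply filter_imp. intros t [H1 H2]. rewrite <- Ec, <- Es. auto.
Qed.

(** * Strict Lyapunov functions exclude centers *)

(** The hypotheses are the chain rule for a curve in weighted polar coordinates, run at signed speed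
    [k]. Two combinations of them isolate [da] and [dt], with common factor [polar_den]; [s * s = 1]
    moves the orientation sign across. *)
Lemma polar_velocity (X : analytic_field) (p q : nat) (r : Z) (s k a t da dt : R) :
  (0 < p)%nat -> (0 < q)%nat -> s * s = 1 -> 0 < t ->
  k * compP X (t ^ p * cos a) (t ^ q * sin a)
    = INR p * dt * t ^ pred p * cos a - t ^ p * (sin a * da) ->
  k * compQ X (t ^ p * cos a) (t ^ q * sin a)
    = INR q * dt * t ^ pred q * sin a + t ^ q * (cos a * da) ->
  da = k * s * powerRZ t r * polar_Theta X p q r s a t /\
  dt = k * s * powerRZ t r * polar_R X p q r s a t.
Proof.
  intros Hp Hq Hs Ht EP EQ.
  assert (Hden := polar_den_ge_1 p q a Hp Hq).
  unfold polar_Theta, polar_R. destruct (Req_EM_T t 0) as [E0|_]; [lra|]. cbv zeta.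
  set (vP := compP X (t ^ p * cos a) (t ^ q * sin a)) in *.
  set (vQ := compQ X (t ^ p * cos a) (t ^ q * sin a)) in *.
  assert (Hpr : powerRZ t r <> 0) by (apply powerRZ_NOR; lra).
  assert (Etp : t ^ p = t * t ^ pred p) by (destruct p; [lia|reflexivity]).
  assert (Etq : t ^ q = t * t ^ pred q) by (destruct q; [lia|reflexivity]).
  assert (Hu : t ^ pred p <> 0) by (apply pow_nonzero; lra).
  assert (Hv : t ^ pred q <> 0) by (apply pow_nonzero; lra).
  rewrite pow_add, Etp, Etq in *.
  set (u := t ^ pred p) in *. set (v := t ^ pred q) in *.
  assert (E1 : k * (INR p * cos a * (t * u) * vQ - INR q * sin a * (t * v) * vP)
             = t * t * u * v * da * polar_den p q a).
  { transitivity (INR p * cos a * (t * u) * (k * vQ) - INR q * sin a * (t * v) * (k * vP));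
      [ring|]. rewrite EP, EQ. unfold polar_den. ring. }
  assert (E2 : k * ((t * v) * cos a * vP + (t * u) * sin a * vQ)
             = t * u * v * dt * polar_den p q a).
  { transitivity ((t * v) * cos a * (k * vP) + (t * u) * sin a * (k * vQ)); [ring|].
    rewrite EP, EQ. unfold polar_den. ring. }
  split.
  - transitivity (s * s * (k * (INR p * cos a * (t * u) * vQ - INR q * sin a * (t * v) * vP))
                  / (t * t * u * v * polar_den p q a)).
    + rewrite E1, Hs. field. repeat split; auto; lra.
    + field. repeat split; auto; lra.
  - transitivity (s * s * t * (k * ((t * v) * cos a * vP + (t * u) * sin a * vQ))
                  / (t * t * u * v * polar_den p q a)).
    + rewrite E2, Hs. field. repeat split; auto; lra.
    + field. repeat split; auto; lra.
Qed.

(** A continuation argument: as long as [f] stays below [d] it is in fact at most [e]. By continuity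
    the gap [d - e] lets the supremum of the good times be exceeded, unless it is [t1]. *)
Lemma trapped_below (f : R -> R) (d e : R) :
  e < d -> f 0 <= e -> (forall t, continuity_pt f t) ->
  (forall t, 0 <= t -> (forall v, 0 <= v < t -> f v < d) -> forall v, 0 <= v < t -> f v <= e) ->
  forall t, 0 <= t -> f t < d.
Proof.
  intros Hed H0 Cf Hstep t1 Ht1.
  set (S := fun t => 0 <= t <= t1 /\ forall v, 0 <= v < t -> f v < d).
  destruct (completeness S) as [m [Hub Hlub]].
  { exists t1. intros t [Ht _]. lra. }
  { exists 0. split; [lra|]. intros v Hv; lra. }
  assert (HS0 : S 0) by (split; [lra|]; intros v Hv; lra).
  assert (Hm0 : 0 <= m) by (apply Hub, HS0).
  assert (Hm1 : m <= t1) by (apply Hlub; intros t [Ht _]; lra).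
  assert (Hbelow : forall v, 0 <= v < m -> f v < d).
  { intros v Hv. destruct (Rlt_le_dec (f v) d) as [|Hc]; [assumption|exfalso].
    assert (m <= v); [|lra]. apply Hlub. intros t [Ht Hft].
    destruct (Rle_lt_dec t v) as [|Hlt]; [assumption|]. specialize (Hft v). lra. }
  assert (Hle : forall v, 0 <= v < m -> f v <= e) by (apply Hstep; assumption).
  assert (Hpos : 0 < d - e) by lra.
  assert (Cm := Cf m). rewrite continuity_pt_locally in Cm.
  assert (Hh : 0 < (d - e) / 2) by lra.
  destruct (Cm (mkposreal _ Hh)) as [g Hg]. simpl in Hg.
  pose proof (cond_pos g) as Hgp.
  assert (Hball : forall t, Rabs (t - m) < g -> Rabs (f t - f m) < (d - e) / 2).
  { intros t Ht. apply Hg. exact Ht. }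
  assert (Hfm : f m <= e + (d - e) / 2).
  { destruct (Req_dec m 0) as [->|Hn]; [lra|].
    set (v := Rmax 0 (m - g / 2)).
    assert (Hv : 0 <= v < m /\ Rabs (v - m) < g).
    { unfold v. destruct (Rle_dec 0 (m - g / 2)).
      - rewrite Rmax_right by lra. split; [lra|]. apply Rabs_def1; lra.
      - rewrite Rmax_left by lra. split; [lra|]. apply Rabs_def1; lra. }
    destruct Hv as [Hv1 Hv2]. specialize (Hle v Hv1). specialize (Hball v Hv2).
    apply Rabs_def2 in Hball. lra. }
  destruct (Rlt_le_dec m t1) as [Hlt|Hge].
  - exfalso.
    set (m' := Rmin t1 (m + g / 2)).
    assert (Hm' : m < m') by (apply Rmin_glb_lt; lra).
    assert (Hm't : m' <= t1) by apply Rmin_l. assert (Hm'g : m' <= m + g / 2) by apply Rmin_r.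
    assert (S m'); [|specialize (Hub m' H); lra].
    split; [lra|]. intros v Hv. destruct (Rlt_le_dec v m) as [Hvm|Hvm]; [apply Hbelow; lra|].
    assert (Hb : Rabs (f v - f m) < (d - e) / 2) by (apply Hball, Rabs_def1; lra).
    apply Rabs_def2 in Hb. lra.
  - replace t1 with m by lra. lra.
Qed.

Lemma derive_neg_lt (f : R -> R) (x y : R) :
  x < y -> (forall t, x <= t <= y -> exists l, is_derive f t l /\ l < 0) -> f y < f x.
Proof.
  intros Hxy H.
  destruct (MVT_gen f x y (Derive f)) as [z [Hz E]].
  { intros t Ht. rewrite Rmin_left, Rmax_right in Ht by lra.
    destruct (H t) as (l & Hl & _); [lra|]. apply Derive_correct. exists l; exact Hl. }
  { intros t Ht. rewrite Rmin_left, Rmax_right in Ht by lra.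
    destruct (H t) as (l & Hl & _); [lra|]. apply (is_derive_continuity_pt _ _ _ Hl). }
  rewrite Rmin_left, Rmax_right in Hz by lra.
  destruct (H z Hz) as (l & Hl & Hneg). rewrite (is_derive_unique _ _ _ Hl) in E. nra.
Qed.

(* Time is run in the direction in which [L] decreases; the orbit then stays in
   the region where [L] is monotone, so [L] cannot return to its initial value. *)
Lemma no_strict_lyapunov (X : analytic_field) (p q : nat) (r : Z) (s sg d c1 c2 : R)
    (L Lp Lr : R -> R -> R) :
  (0 < p)%nat -> (0 < q)%nat -> s * s = 1 -> sg * sg = 1 -> is_center X ->
  0 < d -> 0 < c1 ->
  (forall t, periodic (fun a => L a t)) ->
  (forall a t, 0 < t < d -> c1 * t <= L a t <= c2 * t) ->
  (forall (a b : R -> R) u da db, is_derive a u da -> is_derive b u db ->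
     is_derive (fun v => L (a v) (b v)) u (Lp (a u) (b u) * da + Lr (a u) (b u) * db)) ->
  (forall a t, 0 < t < d ->
     0 < sg * (Lp a t * polar_Theta X p q r s a t + Lr a t * polar_R X p q r s a t)) ->
  False.
Proof.
  intros Hp Hq Hs Hsg (_ & _ & U & HUo & HU0 & HU) Hd Hc1 Lper Lbd Lch Lpos.
  assert (Hc2 : c1 <= c2).
  { specialize (Lbd 0 (d / 2) ltac:(lra)). nra. }
  set (d1 := d / 2).
  destruct (HUo (0, 0) HU0) as [e0 He0]. pose proof (cond_pos e0) as He0p.
  (* The start [(t0 ^ p, 0)] has weighted radius exactly [t0] and lies in [U]. The last bound gives
     [c2 * t0 <= c1 * (d1 / 2)], so any point of radius below [d] where [L] is at most its initial
     value has radius at most [d1 / 2]. *)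
  set (t0 := Rmin (Rmin (e0 / 2) (/ 2)) (c1 * d1 / (2 * c2))).
  assert (Hq0 : 0 < c1 * d1 / (2 * c2)).
  { apply Rdiv_lt_0_compat; [|lra]. unfold d1. nra. }
  assert (Ht0 : 0 < t0) by (apply Rmin_glb_lt; [apply Rmin_glb_lt; lra|exact Hq0]).
  assert (Ht0e : t0 <= e0 / 2) by (eapply Rle_trans; [apply Rmin_l|apply Rmin_l]).
  assert (Ht0h : t0 <= / 2) by (eapply Rle_trans; [apply Rmin_l|apply Rmin_r]).
  assert (Ht0c : c2 * t0 <= c1 * (d1 / 2)).
  { apply Rle_trans with (c2 * (c1 * d1 / (2 * c2))).
    - apply Rmult_le_compat_l; [lra|apply Rmin_r].
    - right. field. lra. }
  assert (Hxp : 0 < t0 ^ p <= t0).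
  { split; [apply pow_lt, Ht0|]. destruct p as [|p']; [lia|]. simpl.
    assert (t0 ^ p' <= 1) by (rewrite <- (pow1 p'); apply pow_incr; lra).
    assert (0 <= t0 ^ p') by (apply pow_le; lra). nra. }
  destruct (HU (t0 ^ p) 0) as (x & y & [Hsol (T & HT & Hper)] & Hx0 & Hy0 & [Horb _]).
  { apply He0. split; simpl; unfold ball; simpl; unfold AbsRing_ball, abs, minus, plus, opp; simpl.
    - rewrite Ropp_0, Rplus_0_r, Rabs_pos_eq; lra.
    - rewrite Ropp_0, Rplus_0_r, Rabs_R0; lra. }
  { intros E. injection E as E. lra. }
  (* Time orientation, equal to [1] or [-1]: with [k * s = - sg] the function [L] decreases along
     the reparametrized orbit. *)
  set (k := - sg * s).
  assert (Hk : k * s = - sg) by (unfold k; rewrite Rmult_assoc, Hs; ring).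
  assert (Hkk : k * k = 1).
  { unfold k. transitivity (sg * sg * (s * s)); [ring|]. rewrite Hs, Hsg. ring. }
  set (xi := fun t => x (k * t)). set (et := fun t => y (k * t)).
  assert (Dlin : forall t, is_derive (fun t => k * t) t k).
  { intros t. eapply is_derive_eq; [apply is_derive_Rscal, is_derive_id|].
    unfold one; simpl; ring. }
  assert (Dxi : forall t, is_derive xi t (k * compP X (xi t) (et t))).
  { intros t. apply (is_derive_comp x (fun t => k * t)); [apply Hsol|apply Dlin]. }
  assert (Det : forall t, is_derive et t (k * compQ X (xi t) (et t))).
  { intros t. apply (is_derive_comp y (fun t => k * t)); [apply Hsol|apply Dlin]. }
  assert (Hnz : forall t, (xi t, et t) <> (0, 0)).
  { intros t E. apply Horb. exists (k * t). symmetry. exact E. }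
  assert (Hpol : exists f : R -> R * R, forall t, 0 < fst (f t) /\
            xi t = fst (f t) ^ p * cos (snd (f t)) /\ et t = fst (f t) ^ q * sin (snd (f t))).
  { apply (functional_choice (fun t w => 0 < fst w /\
            xi t = fst w ^ p * cos (snd w) /\ et t = fst w ^ q * sin (snd w))).
    intros t. destruct (weighted_polar_exists p q (xi t) (et t) Hp Hq (Hnz t))
      as (u & a & Hu & E1 & E2). exists (u, a). auto. }
  destruct Hpol as [f Hf].
  set (ra := fun t => fst (f t)). set (an := fun t => snd (f t)).
  assert (Hra : forall t, 0 < ra t /\ xi t = ra t ^ p * cos (an t)
                          /\ et t = ra t ^ q * sin (an t)) by exact Hf.
  assert (Lsame : forall a b t, cos a = cos b -> sin a = sin b -> L a t = L b t).
  { intros a b t Ec Es. destruct (cos_sin_eq_mod a b Ec Es) as [n ->].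
    apply (periodic_IZR (fun a => L a t)), Lper. }
  assert (Hlift : forall t, ex_derive ra t /\ exists b : R -> R, ex_derive b t /\ b t = an t /\
    locally t (fun v => cos (b v) = cos (an v) /\ sin (b v) = sin (an v))).
  { intros t. apply (weighted_polar_lift p q xi et); auto.
    - eexists; apply Dxi. - eexists; apply Det. }
  set (ell := fun t => L (an t) (ra t)).
  (* [L] is differentiated along the derivable lift [b], with which it agrees locally by
     periodicity. Comparing the two expressions for the velocity of [xi] and [et] determines the
     derivatives of radius and angle. *)
  assert (Dell : forall t, ra t < d -> exists l, is_derive ell t l /\ l < 0).
  { intros t Hlt. destruct (Hlift t) as ([dr Dr] & b & [db Db] & Eb & Hb).
    destruct (Hra t) as (Hpos & Ext & Eyt).
    assert (Dxi' : is_derive xi t (INR p * dr * ra t ^ pred p * cos (an t)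
                                   - ra t ^ p * (sin (an t) * db))).
    { apply (is_derive_ext_loc (fun v => ra v ^ p * cos (b v))).
      - revert Hb. apply filter_imp. intros v [E1 _]. destruct (Hra v) as (_ & E2 & _).
        rewrite E1. symmetry. exact E2.
      - eapply is_derive_eq.
        + apply is_derive_Rmult; [apply is_derive_pow, Dr|].
          apply (is_derive_comp cos b); [apply is_derive_Reals, derivable_pt_lim_cos|exact Db].
        + unfold scal; simpl; unfold mult; simpl. rewrite !Eb. ring. }
    assert (Det' : is_derive et t (INR q * dr * ra t ^ pred q * sin (an t)
                                   + ra t ^ q * (cos (an t) * db))).
    { apply (is_derive_ext_loc (fun v => ra v ^ q * sin (b v))).
      - revert Hb. apply filter_imp. intros v [_ E1]. destruct (Hra v) as (_ & _ & E2).
        rewrite E1. symmetry. exact E2.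
      - eapply is_derive_eq.
        + apply is_derive_Rmult; [apply is_derive_pow, Dr|].
          apply (is_derive_comp sin b); [apply is_derive_Reals, derivable_pt_lim_sin|exact Db].
        + unfold scal; simpl; unfold mult; simpl. rewrite !Eb. ring. }
    assert (EP := eq_trans (eq_sym (is_derive_unique _ _ _ (Dxi t))) (is_derive_unique _ _ _ Dxi')).
    assert (EQ := eq_trans (eq_sym (is_derive_unique _ _ _ (Det t))) (is_derive_unique _ _ _ Det')).
    rewrite Ext, Eyt in EP, EQ.
    destruct (polar_velocity X p q r s k (an t) (ra t) db dr Hp Hq Hs Hpos EP EQ) as [Vb Vr].
    exists (Lp (b t) (ra t) * db + Lr (b t) (ra t) * dr). split.
    - apply (is_derive_ext_loc (fun v => L (b v) (ra v))).
      + revert Hb. apply filter_imp. intros v [E1 E2]. apply Lsame; assumption.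
      + apply Lch; assumption.
    - rewrite Eb, Vb, Vr, Hk.
      assert (Hl := Lpos (an t) (ra t) (conj Hpos Hlt)).
      assert (Hz : 0 < powerRZ (ra t) r) by (apply powerRZ_lt, Hpos).
      assert (Hprod := Rmult_lt_0_compat _ _ Hz Hl). lra. }
  assert (Hr0 : ra 0 = t0).
  { destruct (Hra 0) as (Hpos & E1 & E2).
    unfold xi in E1. unfold et in E2. rewrite Rmult_0_r in E1, E2.
    rewrite Hx0 in E1. rewrite Hy0 in E2.
    symmetry. apply (weighted_polar_unique p q t0 (ra 0) 0 (an 0) Hp Hq Ht0 Hpos).
    - rewrite cos_0, Rmult_1_r. exact E1.
    - rewrite sin_0, Rmult_0_r. exact E2. }
  assert (Hdecr : forall v, 0 < v -> (forall w, 0 <= w <= v -> ra w < d) -> ell v < ell 0).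
  { intros v Hv Hw. apply derive_neg_lt; [exact Hv|]. intros w Hw'. apply Dell, Hw, Hw'. }
  assert (Hell0 : ell 0 <= c2 * t0).
  { unfold ell. rewrite Hr0. apply Lbd. split; [exact Ht0|].
    assert (c1 * t0 <= c2 * t0) by (apply Rmult_le_compat_r; lra).
    unfold d1 in Ht0c. nra. }
  assert (Htrap : forall t, 0 <= t -> ra t < d1).
  { apply (trapped_below ra d1 (d1 / 2)).
    - unfold d1; lra.
    - rewrite Hr0. assert (c1 * t0 <= c2 * t0) by (apply Rmult_le_compat_r; lra). nra.
    - intros t. destruct (Hlift t) as ([dr Dr] & _). apply (is_derive_continuity_pt _ _ _ Dr).
    - intros t Ht Hbelow v Hv.
      destruct (Req_dec v 0) as [->|Hv0].
      + rewrite Hr0. assert (c1 * t0 <= c2 * t0) by (apply Rmult_le_compat_r; lra). nra.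
      + assert (Hw : ell v < ell 0).
        { apply Hdecr; [lra|]. intros w Hw. specialize (Hbelow w ltac:(lra)).
          unfold d1 in Hbelow. lra. }
        assert (Hvd : ra v < d1) by (apply Hbelow; lra).
        assert (Hb := Lbd (an v) (ra v)).
        assert (Hb' : c1 * ra v <= ell v).
        { apply Hb. split; [apply (Hra v)|unfold d1 in Hvd; lra]. }
        nra. }
  assert (HellT : ell T < ell 0).
  { apply Hdecr; [exact HT|]. intros w Hw. specialize (Htrap w ltac:(lra)).
    unfold d1 in Htrap. lra. }
  assert (Hret : xi T = xi 0 /\ et T = et 0).
  { unfold xi, et. rewrite Rmult_0_r.
    assert (Hk1 : k = 1 \/ k = -1).
    { destruct (Rle_dec 0 k); [left|right]; nra. }
    destruct Hk1 as [-> | ->].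
    - rewrite Rmult_1_l. specialize (Hper 0). rewrite Rplus_0_l in Hper. exact Hper.
    - specialize (Hper (-1 * T)). replace (-1 * T + T) with 0 in Hper by ring.
      destruct Hper as [-> ->]. auto. }
  destruct Hret as [Rx Ry].
  destruct (Hra T) as (HrT & EPx & EPy). destruct (Hra 0) as (Hr0' & E0x & E0y).
  rewrite Rx, E0x in EPx. rewrite Ry, E0y in EPy.
  destruct (weighted_polar_unique p q _ _ _ _ Hp Hq Hr0' HrT EPx EPy) as (W1 & W2 & W3).
  unfold ell in HellT. rewrite <- W1 in HellT.
  rewrite (Lsame (an T) (an 0)) in HellT by auto. lra.
Qed.

(** * Algebra of the sums *)

Lemma PSeries_finite (w : nat -> R) (n : nat) (t : R) :
  (forall k, (n < k)%nat -> w k = 0) -> PSeries w t = sum_f_R0 (fun k => w k * t ^ k) n.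
Proof.
  intros H. apply is_series_unique. apply is_series_Reals. intros eps Heps.
  exists n. intros m Hm. unfold R_dist.
  replace (sum_f_R0 (fun k => w k * t ^ k) m) with (sum_f_R0 (fun k => w k * t ^ k) n).
  - rewrite Rminus_diag, Rabs_R0. exact Heps.
  - induction Hm as [|m Hm IH]; [reflexivity|].
    rewrite tech5, <- IH, H by lia. ring.
Qed.

Lemma coeff_sum_mult (w w' : nat -> R -> R) : analytic_coeffs w -> analytic_coeffs w' ->
  exists r, 0 < r /\ forall x t, Rabs t < r ->
    coeff_sum (fun n x => PS_mult (fun k => w k x) (fun k => w' k x) n) x t
    = coeff_sum w x t * coeff_sum w' x t.
Proof.
  intros Hw Hw'. destruct (analytic_coeffs_regular w Hw) as (r & _ & Hr & _ & HC & _).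
  destruct (analytic_coeffs_regular w' Hw') as (r' & _ & Hr' & _ & HC' & _).
  exists (Rmin r r'). split; [apply Rmin_glb_lt; assumption|]. intros x t Ht.
  pose proof (Rmin_l r r'). pose proof (Rmin_r r r').
  apply PSeries_mult; [apply HC|apply HC']; lra.
Qed.

Lemma coeff_sum_inv (b : nat -> R -> R) (c : R) :
  0 < c -> (forall x, c <= b 0%nat x) -> analytic_coeffs b ->
  exists r, 0 < r /\ forall x t, Rabs t < r ->
    coeff_sum b x t * coeff_sum (fun n x => inv_seq (fun k => b k x) n) x t = 1.
Proof.
  intros Hc Hb Ha.
  destruct (coeff_sum_mult b _ Ha (analytic_coeffs_inv b c Hc Hb Ha)) as (r & Hr & E).
  exists r. split; [exact Hr|]. intros x t Ht. rewrite <- E by exact Ht.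
  assert (Hn : b 0%nat x <> 0) by (specialize (Hb x); lra).
  unfold coeff_sum. rewrite (PSeries_finite _ 0).
  - change (PS_mult (fun k => b k x) (inv_seq (fun k => b k x)) 0 * 1 = 1).
    rewrite PS_mult_inv_0 by exact Hn. ring.
  - intros k Hk. destruct k as [|k]; [lia|]. apply (PS_mult_inv_S (fun k => b k x) k Hn).
Qed.

Lemma periodic_bounded (f : R -> R) :
  periodic f -> (forall x, ex_derive f x) -> exists C, forall x, Rabs (f x) <= C.
Proof.
  intros Hp Hd. pose proof PI_RGT_0 as HP.
  destruct (continuity_ab_maj (fun x => Rabs (f x)) 0 (2 * PI)) as [m [Hm _]].
  - lra.
  - intros c _. apply (continuity_pt_comp f Rabs); [|apply Rcontinuity_abs].
    apply continuity_pt_filterlim. apply ex_derive_Rcontinuous, Hd.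
  - exists (Rabs (f m)). intros x.
    destruct (periodic_repr f x Hp) as (y & Hy & E). rewrite E. apply Hm, Hy.
Qed.

Lemma periodic_family_bounded (f : nat -> R -> R) (n : nat) :
  (forall k, (k <= n)%nat -> periodic (f k)) ->
  (forall k x, (k <= n)%nat -> ex_derive (f k) x) ->
  exists C, 0 <= C /\ forall k x, (k <= n)%nat -> Rabs (f k x) <= C.
Proof.
  induction n as [|n IH]; intros Hp Hd.
  - destruct (periodic_bounded (f 0%nat)) as [C HC]; auto.
    exists C. split; [eapply Rle_trans; [apply Rabs_pos|apply (HC 0)]|].
    intros k x Hk. replace k with 0%nat by lia. apply HC.
  - destruct IH as (C & HC0 & HC); [intros; apply Hp; lia|intros; apply Hd; lia|].
    destruct (periodic_bounded (f (S n))) as [C' HC']; auto.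
    exists (Rmax C C'). split; [eapply Rle_trans; [apply HC0|apply Rmax_l]|].
    intros k x Hk. destruct (Nat.eq_dec k (S n)) as [->|Hne].
    + eapply Rle_trans; [apply HC'|apply Rmax_r].
    + eapply Rle_trans; [apply HC; lia|apply Rmax_l].
Qed.

(** * Periodicity of the coefficients of the Jacobi multiplier *)

Definition slope_coef (X : analytic_field) (p q : nat) (r : Z) (s : R) (n : nat) (x : R) : R :=
  PS_mult (fun k => rho_coef X p q r s k x)
          (inv_seq (fun k => theta_coef X p q r s k x)) n.

Lemma slope_coef_periodic (X : analytic_field) (p q : nat) (r : Z) (s : R) (n : nat) :
  periodic (slope_coef X p q r s n).
Proof.
  intros x. unfold slope_coef. f_equal.
  - apply functional_extensionality; intros k. apply polar_coeffs_periodic.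
  - f_equal. apply functional_extensionality; intros k. apply polar_coeffs_periodic.
Qed.

Lemma slope_coef_analytic (X : analytic_field) (p q : nat) (r : Z) (s c : R) :
  (0 < p)%nat -> (0 < q)%nat -> 0 < c -> (forall x, c <= theta_coef X p q r s 0 x) ->
  analytic_coeffs (slope_coef X p q r s) /\
  exists d, 0 < d /\ forall x t, Rabs t < d ->
    coeff_sum (rho_coef X p q r s) x t
    = coeff_sum (theta_coef X p q r s) x t * coeff_sum (slope_coef X p q r s) x t.
Proof.
  intros Hp Hq Hc Hth. destruct (polar_coeffs_analytic X p q r s Hp Hq) as [At Ar].
  assert (Ai := analytic_coeffs_inv _ c Hc Hth At).
  split; [apply (analytic_coeffs_mult _ _ Ar Ai)|].
  destruct (coeff_sum_mult _ _ Ar Ai) as (d1 & Hd1 & E1).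
  destruct (coeff_sum_inv _ c Hc Hth At) as (d2 & Hd2 & E2).
  exists (Rmin d1 d2). split; [apply Rmin_glb_lt; assumption|]. intros x t Ht.
  pose proof (Rmin_l d1 d2). pose proof (Rmin_r d1 d2).
  specialize (E1 x t ltac:(lra)). specialize (E2 x t ltac:(lra)).
  change (coeff_sum (slope_coef X p q r s) x t = coeff_sum (rho_coef X p q r s) x t
    * coeff_sum (fun n x => inv_seq (fun k => theta_coef X p q r s k x) n) x t) in E1.
  rewrite E1.
  transitivity (coeff_sum (rho_coef X p q r s) x t * 1); [ring|]. rewrite <- E2. ring.
Qed.

(** The derivative of [L] along the field is [Theta * (Lp + t * G * Lr)]. The recurrence below [K]
    cancels every order up to [t ^ K], and the last hypothesis keeps the coefficient of [t ^ S K]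
    away from zero with the sign [sg]. *)
Lemma truncated_lyapunov (X : analytic_field) (p q : nat) (r : Z) (s c sg k0 : R)
    (K : nat) (uh duh : nat -> R -> R) :
  (0 < p)%nat -> (0 < q)%nat -> s * s = 1 -> sg * sg = 1 ->
  is_center X -> leading_degree X p q r ->
  0 < c -> (forall x, c <= theta_coef X p q r s 0 x) -> 0 < k0 ->
  (forall k, (k <= K)%nat -> periodic (uh k)) ->
  (forall k x, (k <= K)%nat -> is_derive (uh k) x (duh k x)) ->
  (forall x, 0 < uh 0%nat x) ->
  (forall k x, (k < K)%nat -> duh k x =
     - INR (S k) * PS_mult (fun j => slope_coef X p q r s j x) (fun j => uh j x) k) ->
  (forall x, k0 <= sg * (duh K x / INR (S K)
     + PS_mult (fun j => slope_coef X p q r s j x) (fun j => uh j x) K)) ->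
  False.
Proof.
  intros Hp Hq Hs Hsg Hcen Hr Hc Hth Hk0 Uper Uder U0 Urec UK.
  set (th := theta_coef X p q r s) in *. set (rh := rho_coef X p q r s).
  set (g := slope_coef X p q r s) in *.
  destruct (polar_coeffs_analytic X p q r s Hp Hq) as [At _]. fold th in At.
  destruct (slope_coef_analytic X p q r s c Hp Hq Hc Hth) as (Ag & d1 & Hd1 & E1).
  fold g in Ag, E1. fold th in E1. fold rh in E1.
  destruct (polar_field_expansion X p q r s Hp Hq Hr) as (d2 & Hd2 & E2).
  fold th in E2. fold rh in E2.
  destruct (analytic_coeffs_regular th At) as (d3 & K3 & Hd3 & HK3 & _ & _ & Hth3 & _).
  destruct Ag as (aa & M & B0 & Haa & HB0 & Hg).
  assert (HM := AnS_pos _ _ _ _ Hg).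
  assert (gb : forall j x, Rabs (g j x) <= M * B0 ^ j).
  { intros j x. apply (An_bound aa). apply Hg. }
  set (B := Rmax B0 1).
  assert (HB1 : 1 <= B) by apply Rmax_r. assert (HB2 : B0 <= B) by apply Rmax_l.
  destruct (periodic_family_bounded uh K Uper) as (C & HC & Ub).
  { intros k x Hk. eexists; apply Uder, Hk. }
  destruct (periodic_lower_bound (uh 0%nat)) as (c0 & Hc0 & Uc0).
  { apply Uper; lia. } { intros x. eexists; apply Uder; lia. } { exact U0. }
  (* Extension by zero turns the polynomial [Lr] into a power series, so its product with [G]
     becomes a Cauchy product. *)
  set (uz := fun k x => if Nat.leb k K then uh k x else 0).
  assert (uzb : forall k x, Rabs (uz k x) <= C * (2 * B) ^ k).
  { intros k x. assert (1 <= (2 * B) ^ k) by (apply pow_R1_Rle; lra).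
    unfold uz. destruct (Nat.leb_spec k K) as [Hk|Hk].
    - eapply Rle_trans; [apply Ub, Hk|]. nra.
    - rewrite Rabs_R0. nra. }
  set (b := fun x n => PS_mult (fun j => g j x) (fun j => uz j x) n).
  assert (bb : forall x n, Rabs (b x n) <= (2 * M * C) * (2 * B) ^ n).
  { intros x n. unfold b. eapply Rle_trans; [apply PS_mult_Rabs|]. unfold PS_mult.
    apply Rle_trans with (sum_f_R0 (fun j => (M * C) * (B ^ j * (2 * B) ^ (n - j))) n).
    - apply sum_Rle; intros j Hj.
      apply Rle_trans with ((M * B ^ j) * (C * (2 * B) ^ (n - j))); [|right; ring].
      apply Rmult_le_compat; try apply Rabs_pos; [|apply uzb].
      eapply Rle_trans; [apply gb|]. apply Rmult_le_compat_l; [exact HM|].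
      apply pow_incr; lra.
    - rewrite sum_mult_l.
      replace (2 * M * C * (2 * B) ^ n) with ((M * C) * (2 * (2 * B) ^ n)) by ring.
      apply Rmult_le_compat_l; [nra|]. apply sum_geom_le; lra. }
  assert (bK : forall x k, (k <= K)%nat ->
             b x k = PS_mult (fun j => g j x) (fun j => uh j x) k).
  { intros x k Hk. unfold b, PS_mult. apply sum_eq; intros j Hj. unfold uz.
    destruct (Nat.leb_spec (k - j) K); [reflexivity|lia]. }
  set (L := fun a t => sum_f_R0 (fun k => / INR (S k) * (uh k a * t ^ S k)) K).
  set (Lp := fun a t => sum_f_R0 (fun k => / INR (S k) * (duh k a * t ^ S k)) K).
  set (Lr := fun a t => sum_f_R0 (fun k => uh k a * t ^ k) K).
  (* Bound for the part of [G * Lr] beyond order [K], after division by [t ^ S K]. *)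
  set (Rb := 2 * (2 * M * C * (2 * B) ^ S K)).
  assert (HRb : 0 <= Rb).
  { unfold Rb. apply Rmult_le_pos; [lra|]. apply Rmult_le_pos; [nra|apply pow_le; lra]. }
  (* Besides the domains of validity, the quotients by [K3], [Rb] and [INR K * C] make half of [c],
     [k0] and [c0] survive: [Theta >= c / 2], the leading coefficient dominates the tail, and
     [L a t >= c0 / 2 * t]. *)
  set (d := Rmin (Rmin (Rmin d1 d2) (Rmin d3 (c / (2 * (K3 + 1)))))
                 (Rmin (Rmin (/ (4 * B)) (k0 / (2 * (Rb + 1)))) (c0 / (2 * (INR K * C + 1))))).
  assert (HK : 0 <= INR K * C) by (apply Rmult_le_pos; [apply pos_INR|exact HC]).
  assert (Q1 : 0 < c / (2 * (K3 + 1))) by (apply Rdiv_lt_0_compat; lra).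
  assert (Q2 : 0 < / (4 * B)) by (apply Rinv_0_lt_compat; lra).
  assert (Q3 : 0 < k0 / (2 * (Rb + 1))) by (apply Rdiv_lt_0_compat; lra).
  assert (Q4 : 0 < c0 / (2 * (INR K * C + 1))) by (apply Rdiv_lt_0_compat; lra).
  assert (Hd : 0 < d) by (unfold d; repeat apply Rmin_glb_lt; assumption).
  assert (Hdl : d <= d1 /\ d <= d2 /\ d <= d3 /\ d <= c / (2 * (K3 + 1)) /\ d <= / (4 * B)
           /\ d <= k0 / (2 * (Rb + 1)) /\ d <= c0 / (2 * (INR K * C + 1))).
  { unfold d. repeat split.
    - eapply Rle_trans; [apply Rmin_l|]. eapply Rle_trans; [apply Rmin_l|apply Rmin_l].
    - eapply Rle_trans; [apply Rmin_l|]. eapply Rle_trans; [apply Rmin_l|apply Rmin_r].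
    - eapply Rle_trans; [apply Rmin_l|]. eapply Rle_trans; [apply Rmin_r|apply Rmin_l].
    - eapply Rle_trans; [apply Rmin_l|]. eapply Rle_trans; [apply Rmin_r|apply Rmin_r].
    - eapply Rle_trans; [apply Rmin_r|]. eapply Rle_trans; [apply Rmin_l|apply Rmin_l].
    - eapply Rle_trans; [apply Rmin_r|]. eapply Rle_trans; [apply Rmin_l|apply Rmin_r].
    - eapply Rle_trans; [apply Rmin_r|apply Rmin_r]. }
  destruct Hdl as (L1 & L2 & L3 & L4 & L5 & L6 & L7).
  assert (Hsmall : forall A e t, 0 <= A -> 0 < t -> t < d -> d <= e / (2 * (A + 1)) ->
             A * t <= e / 2).
  { intros A e t HA Ht1 Ht2 He. apply Rle_trans with ((A + 1) * (e / (2 * (A + 1)))).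
    - apply Rmult_le_compat; lra.
    - right. field. lra. }
  assert (Hd1' : d <= / 4).
  { eapply Rle_trans; [apply L5|]. apply Rinv_le_contravar; lra. }
  apply (no_strict_lyapunov X p q r s sg d (c0 / 2) (C + c0) L Lp Lr); auto; try lra.
  - intros t x. unfold L. apply sum_eq; intros k Hk. rewrite Uper by exact Hk. reflexivity.
  - intros a t Ht.
    assert (Hdev : forall n, (n <= K)%nat ->
      Rabs (sum_f_R0 (fun k => / INR (S k) * (uh k a * t ^ S k)) n - uh 0%nat a * t)
      <= INR n * C * t ^ 2).
    { induction n as [|n IH]; intros Hn.
      - simpl. replace (_ - _) with 0 by field. rewrite Rabs_R0. lra.
      - rewrite tech5. specialize (IH ltac:(lia)).
        match goal with |- Rabs (?u + ?v - ?w) <= _ =>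
          replace (u + v - w) with ((u - w) + v) by ring end.
        eapply Rle_trans; [apply Rabs_triang|].
        replace (INR (S n) * C * t ^ 2) with (INR n * C * t ^ 2 + C * t ^ 2)
          by (rewrite (S_INR n); ring).
        apply Rplus_le_compat; [exact IH|].
        assert (Hi : 0 < / INR (S (S n)) <= 1).
        { split; [apply Rinv_0_lt_compat, lt_0_INR; lia|].
          rewrite <- Rinv_1. apply Rinv_le_contravar; [lra|].
          apply (le_INR 1). lia. }
        rewrite !Rabs_mult, (Rabs_pos_eq (/ _)), <- RPow_abs, (Rabs_pos_eq t) by lra.
        assert (Htn : t ^ S (S n) <= t ^ 2).
        { replace (t ^ S (S n)) with (t ^ 2 * t ^ n) by (simpl; ring).
          rewrite <- (Rmult_1_r (t ^ 2)) at 2. apply Rmult_le_compat_l; [apply pow2_ge_0|].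
          rewrite <- (pow1 n). apply pow_incr. lra. }
        assert (Hp0 : 0 <= t ^ S (S n)) by (apply pow_le; lra).
        assert (Hu := Ub (S n) a Hn).
        rewrite <- (Rmult_1_l (C * t ^ 2)). apply Rmult_le_compat; try lra.
        + apply Rmult_le_pos; [apply Rabs_pos|exact Hp0].
        + apply Rmult_le_compat; auto. apply Rabs_pos. }
    specialize (Hdev K (Nat.le_refl K)). fold (L a t) in Hdev.
    assert (Hs1 := Hsmall (INR K * C) c0 t HK ltac:(lra) ltac:(lra) L7).
    assert (Hu0 := Uc0 a). assert (Hu1 := Ub 0%nat a ltac:(lia)).
    apply Rabs_le_between in Hdev. apply Rabs_le_between in Hu1.
    assert (INR K * C * t ^ 2 <= c0 / 2 * t).
    { replace (INR K * C * t ^ 2) with (INR K * C * t * t) by ring.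
      apply Rmult_le_compat_r; lra. }
    nra.
  - intros a e u da de Da De. unfold L. eapply is_derive_eq.
    + apply (is_derive_sum_f_R0 (fun k v => / INR (S k) * (uh k (a v) * e v ^ S k))).
      intros k Hk. apply is_derive_Rscal. apply is_derive_Rmult.
      * apply (is_derive_Rcomp (uh k) a); [apply Uder, Hk|exact Da].
      * apply is_derive_pow, De.
    + unfold Lp, Lr. rewrite (Rmult_comm _ da), (Rmult_comm _ de), <- !sum_mult_l, <- sum_plus.
      apply sum_eq; intros k Hk. 
      simpl Init.Nat.pred. simpl pow.
      change (match k with 0%nat => 1 | S _ => INR k + 1 end) with (INR (S k)).
      field. apply not_0_INR; lia.
  - intros a t Ht.
    assert (HtA : Rabs t = t) by (apply Rabs_pos_eq; lra).
    destruct (E2 a t) as (_ & ET & ER); [lra|].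
    rewrite ET, ER, E1 by lra.
    assert (HT3 := Hth3 a t ltac:(lra)). rewrite HtA in HT3.
    assert (Hs1 := Hsmall K3 c t HK3 ltac:(lra) ltac:(lra) L4).
    assert (Hth0 := Hth a). apply Rabs_le_between in HT3.
    set (Th := coeff_sum th a t) in *. assert (HTh : 0 < Th) by lra.
    assert (HtB : t * (2 * B) <= / 2).
    { apply Rle_trans with (/ (4 * B) * (2 * B)); [apply Rmult_le_compat_r; lra|].
      right; field; lra. }
    assert (CVb : forall y : nat -> R, forall N, (forall j, Rabs (y j) <= N * (2 * B) ^ j) ->
                Rbar_lt (Rabs t) (CV_radius y)).
    { intros y N Hy. apply (CV_radius_geom y N (2 * B)); [lra|exact Hy|]. rewrite HtA; lra. }
    assert (ELr : Lr a t = PSeries (fun k => uz k a) t).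
    { rewrite (PSeries_finite _ K).
      - unfold Lr. apply sum_eq; intros k Hk. unfold uz.
        destruct (Nat.leb_spec k K); [reflexivity|lia].
      - intros k Hk. unfold uz. destruct (Nat.leb_spec k K); [lia|reflexivity]. }
    assert (EG : coeff_sum g a t * Lr a t = PSeries (b a) t).
    { rewrite ELr. symmetry. apply PSeries_mult.
      - apply (CVb _ M). intros j. eapply Rle_trans; [apply gb|].
        apply Rmult_le_compat_l; [exact HM|]. apply pow_incr; lra.
      - apply (CVb _ C). intros j. apply uzb. }
    rewrite (PSeries_decr_n (b a) K t) in EG.
    2:{ apply CV_radius_inside. apply (CVb _ (2 * M * C)). apply bb. }
    set (Rm := PSeries (PS_decr_n (b a) (S K)) t) in *.
    assert (HRm : Rabs Rm <= Rb).
    { unfold Rm, Rb. apply (PSeries_geom_bound _ _ (2 * B)); [lra| |rewrite HtA; exact HtB].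
      intros j. unfold PS_decr_n. eapply Rle_trans; [apply bb|]. rewrite pow_add. right; ring. }
    set (kap := duh K a / INR (S K) + PS_mult (fun j => g j a) (fun j => uh j a) K).
    (* All orders below [S K] cancel, leaving the prescribed coefficient [kap] and the tail. *)
    assert (EL : Lp a t + t * (coeff_sum g a t * Lr a t) = t ^ S K * (kap + t * Rm)).
    { rewrite EG. unfold Lp. rewrite Rmult_plus_distr_l, <- sum_mult_l, <- Rplus_assoc, <- sum_plus.
      replace (sum_f_R0 _ K) with (kap * t ^ S K).
      - simpl. ring.
      - assert (Hterm : forall k, (k < K)%nat ->
          / INR (S k) * (duh k a * t ^ S k) + t * (b a k * t ^ k) = 0).
        { intros k Hk. rewrite Urec, bK by lia. simpl pow. field. apply not_0_INR; lia. }
        assert (Hlast : / INR (S K) * (duh K a * t ^ S K) + t * (b a K * t ^ K) = kap * t ^ S K).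
        { rewrite bK by lia. unfold kap. simpl pow. field. apply not_0_INR; lia. }
        destruct K as [|K']; [symmetry; exact Hlast|].
        rewrite tech5, Hlast, sum_zero; [ring|]. intros k Hk. apply Hterm; lia. }
    replace (sg * (Lp a t * Th + Lr a t * (t * (Th * coeff_sum g a t))))
      with (Th * (sg * (Lp a t + t * (coeff_sum g a t * Lr a t)))) by ring.
    rewrite EL. apply Rmult_lt_0_compat; [exact HTh|].
    replace (sg * (t ^ S K * (kap + t * Rm))) with (t ^ S K * (sg * kap + sg * (t * Rm))) by ring.
    apply Rmult_lt_0_compat; [apply pow_lt; lra|].
    assert (Hkap := UK a). fold kap in Hkap.
    assert (Hs2 := Hsmall Rb k0 t HRb ltac:(lra) ltac:(lra) L6).
    assert (Hsg1 : Rabs sg = 1).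
    { assert (Rabs sg * Rabs sg = 1) by (rewrite <- Rabs_mult, Hsg; apply Rabs_R1).
      pose proof (Rabs_pos sg). nra. }
    assert (Habs : Rabs (sg * (t * Rm)) <= k0 / 2).
    { rewrite !Rabs_mult, Hsg1, HtA. pose proof (Rabs_pos Rm). nra. }
    apply Rabs_le_between in Habs. lra.
Qed.

Lemma exp_coef_inj (x y : R) : exp (- INR 1 * x) = exp (- INR 1 * y) -> x = y.
Proof. intros H. apply exp_inv in H. simpl in H. lra. Qed.

(** By induction, the increment over a period of the exponent [a] (for [k = 0]) or of [z k] (for
    [k > 0]) must vanish. Otherwise a linear correction restores periodicity and leaves a defect of
    constant sign in the last equation only, which [truncated_lyapunov] forbids. *)
Lemma ucoef_periodic (X : analytic_field) (p q : nat) (r : Z) (s c : R)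
    (a : R -> R) (z : nat -> R -> R) :
  (0 < p)%nat -> (0 < q)%nat -> s * s = 1 ->
  is_center X -> leading_degree X p q r ->
  0 < c -> (forall x, c <= theta_coef X p q r s 0 x) ->
  (forall x, is_derive a x (slope_coef X p q r s 0 x)) ->
  (forall x, z 0%nat x = 1) ->
  (forall k x, is_derive (z k) x (zder (slope_coef X p q r s) a z k x)) ->
  forall k, periodic (ucoef a z k).
Proof.
  intros Hp Hq Hs Hcen Hr Hc Hth Da z0 Dz.
  set (g := slope_coef X p q r s) in *.
  assert (Gper : forall n, periodic (g n)) by (intros; apply slope_coef_periodic).
  pose proof PI_RGT_0 as HPI.
  assert (Du := is_derive_ucoef g a z Da Dz).
  assert (Hsign : forall mu, mu <> 0 -> exists sg, sg * sg = 1 /\ 0 < sg * mu).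
  { intros mu Hmu. destruct (Rdichotomy _ _ Hmu); [exists (-1)|exists 1]; split; lra. }
  induction k as [k IH] using (well_founded_induction Wf_nat.lt_wf).
  destruct k as [|m].
  - assert (Inc := periodic_increment a (g 0%nat) Da (Gper 0%nat)).
    set (D := a (2 * PI) - a 0) in *.
    destruct (Req_dec D 0) as [HD|HD].
    { intros x. unfold ucoef. rewrite !z0. specialize (Inc x).
      replace (a (x + 2 * PI)) with (a x) by lra. reflexivity. }
    exfalso. set (mu := D / (2 * PI)).
    assert (HmuD : mu * (2 * PI) = D) by (unfold mu; field; lra).
    assert (Hmu : mu <> 0) by (intros E; rewrite E in HmuD; lra).
    destruct (Hsign mu Hmu) as (sg & Hsg & Hsgmu).
    set (uh := fun (_ : nat) x => exp (-1 * (a x + (- mu) * x))).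
    assert (Duh : forall n x, is_derive (uh n) x (-1 * (g 0%nat x + - mu) * uh n x)).
    { intros n x. unfold uh. apply (is_derive_exp_scal (fun x => a x + - mu * x)).
      apply is_derive_Rplus; [apply Da|]. eapply is_derive_eq; [apply is_derive_Rscal, is_derive_id|].
      unfold one; simpl; ring. }
    assert (Uper : forall n, periodic (uh n)).
    { intros n x. unfold uh. do 2 f_equal. specialize (Inc x). lra. }
    destruct (periodic_lower_bound (uh 0%nat)) as (c0 & Hc0 & Hc0').
    { apply Uper. } { intros x; eexists; apply Duh. } { intros; apply exp_pos. }
    apply (truncated_lyapunov X p q r s c sg (sg * mu * c0) 0 uh
             (fun n x => -1 * (g 0%nat x + - mu) * uh n x)); auto.
    + apply Rmult_lt_0_compat; assumption.
    + intros; apply exp_pos.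
    + intros k x Hk; lia.
    + intros x. unfold PS_mult. simpl. fold g.
      replace (sg * (_ / 1 + _)) with (sg * mu * uh 0%nat x) by (unfold uh; field).
      apply Rmult_le_compat_l; [lra|apply Hc0'].
  - assert (Aper : periodic a).
    { intros x. apply exp_coef_inj. assert (H0 := IH 0%nat ltac:(lia) x).
      unfold ucoef in H0. rewrite !z0, !Rmult_1_r in H0. exact H0. }
    assert (Zper : forall j, (j <= m)%nat -> periodic (z j)).
    { intros j Hj x. assert (H0 := IH j ltac:(lia) x). unfold ucoef in H0. rewrite Aper in H0.
      apply Rmult_eq_reg_l in H0; [exact H0|]. apply Rgt_not_eq, exp_pos. }
    assert (ZDper : periodic (zder g a z (S m))).
    { intros x. unfold zder, zsum. f_equal. apply sum_eq; intros j Hj.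
      rewrite Gper, Aper, Zper by lia. reflexivity. }
    assert (Inc := periodic_increment (z (S m)) _ (Dz (S m)) ZDper).
    set (D := z (S m) (2 * PI) - z (S m) 0) in *.
    destruct (Req_dec D 0) as [HD|HD].
    { intros x. unfold ucoef. rewrite Aper. specialize (Inc x).
      replace (z (S m) (x + 2 * PI)) with (z (S m) x) by lra. reflexivity. }
    exfalso. set (mu := D / (2 * PI)).
    assert (HmuD : mu * (2 * PI) = D) by (unfold mu; field; lra).
    assert (Hmu : - mu <> 0) by (intros E; replace mu with 0 in HmuD by lra; lra).
    destruct (Hsign (- mu) Hmu) as (sg & Hsg & Hsgmu).
    set (ex := fun x => exp (- INR (S (S m)) * a x)).
    assert (Dex : forall x, is_derive ex x (- INR (S (S m)) * g 0%nat x * ex x)).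
    { intros x. apply is_derive_exp_scal, Da. }
    destruct (periodic_lower_bound ex) as (c0 & Hc0 & Hc0').
    { intros x; unfold ex; rewrite Aper; reflexivity. }
    { intros x; eexists; apply Dex. } { intros; apply exp_pos. }
    (* Only the top coefficient is corrected, with slope [- mu]. In the last equation the terms of
       the exact system cancel, and the defect is [- mu * ex / INR (S (S m))]. *)
    set (top := fun x => ex x * (z (S m) x + (- mu) * x)).
    set (dtop := fun x => - INR (S (S m)) * g 0%nat x * ex x * (z (S m) x + (- mu) * x)
                       + ex x * (zder g a z (S m) x + - mu)).
    assert (Dtop : forall x, is_derive top x (dtop x)).
    { intros x. apply (is_derive_Rmult ex (fun x => z (S m) x + - mu * x)); [apply Dex|].
      apply (is_derive_Rplus (z (S m)) (fun x => - mu * x)); [apply Dz|].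
      eapply is_derive_eq; [apply is_derive_Rscal, is_derive_id|]. unfold one; simpl; ring. }
    set (uh := fun j x => if Nat.eq_dec j (S m) then top x else ucoef a z j x).
    set (duh := fun j x => if Nat.eq_dec j (S m) then dtop x
       else - INR (S j) * PS_mult (fun i => g i x) (fun i => ucoef a z i x) j).
    assert (Euh : forall j x, (j <= m)%nat -> uh j x = ucoef a z j x).
    { intros j x Hj. unfold uh. destruct (Nat.eq_dec j (S m)); [lia|reflexivity]. }
    assert (EuhS : forall x, uh (S m) x = top x).
    { intros x. unfold uh. destruct (Nat.eq_dec (S m) (S m)); [reflexivity|contradiction]. }
    apply (truncated_lyapunov X p q r s c sg (sg * - mu * c0 / INR (S (S m))) (S m) uh duh); auto.
    + apply Rdiv_lt_0_compat; [apply Rmult_lt_0_compat; assumption|apply lt_0_INR; lia].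
    + intros j Hj x. destruct (Nat.eq_dec j (S m)) as [->|Hne].
      * rewrite !EuhS. unfold top, ex. rewrite Aper. f_equal. specialize (Inc x). lra.
      * rewrite !Euh by lia. apply IH. lia.
    + intros j x Hj. unfold uh, duh. destruct (Nat.eq_dec j (S m)); [apply Dtop|apply Du].
    + intros x. rewrite Euh by lia. unfold ucoef. rewrite z0, Rmult_1_r. apply exp_pos.
    + intros j x Hj. unfold duh. destruct (Nat.eq_dec j (S m)); [lia|]. fold g. f_equal.
      unfold PS_mult. apply sum_eq; intros i Hi. rewrite Euh by lia. reflexivity.
    + intros x. fold g.
      replace (PS_mult (fun j => g j x) (fun j => uh j x) (S m))
        with (g 0%nat x * top x + ex x * zsum g a z m x).
      2:{ unfold PS_mult. rewrite sum_S_left. rewrite <- EuhS. f_equal.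
          assert (E := PS_mult_ucoef_S g a z m x). unfold PS_mult in E.
          rewrite sum_S_left in E. apply Rplus_eq_reg_l in E. unfold ex. rewrite <- E.
          apply sum_eq; intros i Hi. cbn [Nat.sub]. rewrite Euh by lia. reflexivity. }
      unfold duh. destruct (Nat.eq_dec (S m) (S m)) as [_|]; [|contradiction].
      unfold dtop, top. unfold zder.
      assert (HI : INR (S (S m)) <> 0) by (apply not_0_INR; lia).
      match goal with |- _ <= ?rhs => replace rhs with (sg * - mu * ex x / INR (S (S m))) end.
      * apply Rmult_le_compat_r; [left; apply Rinv_0_lt_compat, lt_0_INR; lia|].
        apply Rmult_le_compat_l; [lra|apply Hc0'].
      * field. exact HI.
Qed.

(** * The inverse integrating factor *)

Lemma analytic_on_subset (D D' : R * R -> Prop) (f : R -> R -> R) :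
  (forall z, D z -> D' z) -> analytic_on D' f -> analytic_on D f.
Proof.
  intros HD Hf x y Hxy. destruct (Hf x y (HD _ Hxy)) as (c & d & Hd & H).
  exists c, d. split; [exact Hd|]. intros u v Huv. apply H, HD, Huv.
Qed.

Lemma analytic_coeffs_derivable (w : nat -> R -> R) (j : nat) (x : R) :
  analytic_coeffs w -> ex_derive (w j) x.
Proof. intros (a & M & B & _ & _ & H). apply (An_derivable _ _ _ _ (H j)). Qed.

(** Periodicity also serves convergence: it spreads the geometric bound from one period to the whole
    line, as [linear_system_analytic] requires. *)
Lemma multiplier_exists (X : analytic_field) (p q : nat) (r : Z) (s c : R) :
  (0 < p)%nat -> (0 < q)%nat -> s * s = 1 ->
  is_center X -> leading_degree X p q r ->
  0 < c -> (forall x, c <= theta_coef X p q r s 0 x) ->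
  exists u : nat -> R -> R,
    analytic_coeffs u /\ (forall k, periodic (u k)) /\ (forall x, 0 < u 0%nat x) /\
    forall k x, is_derive (u k) x
      (- INR (S k) * PS_mult (fun j => slope_coef X p q r s j x) (fun j => u j x) k).
Proof.
  intros Hp Hq Hs Hcen Hr Hc Hth.
  destruct (slope_coef_analytic X p q r s c Hp Hq Hc Hth) as [Ag _].
  destruct (zsystem_exists (slope_coef X p q r s)) as (a & z & a0 & Da & z0 & zS0 & Dz).
  { intros; apply analytic_coeffs_derivable, Ag. }
  assert (Uper := ucoef_periodic X p q r s c a z Hp Hq Hs Hcen Hr Hc Hth Da z0 Dz).
  assert (Du := is_derive_ucoef _ a z Da Dz).
  destruct Ag as (aa & M & B & Haa & HB & Hg).
  destruct (ucoef_geom_bound (slope_coef X p q r s) a z M B) as (C & L & HC & HL & Hb); auto.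
  { apply (AnS_pos _ _ _ _ Hg). } { intros j x. apply (An_bound aa), Hg. }
  exists (ucoef a z). split; [|split; [exact Uper|split; [|exact Du]]].
  - apply (linear_system_analytic (slope_coef X p q r s) _ C L); auto.
    + exists aa, M, B. auto.
    + intros k x. destruct (periodic_repr (ucoef a z k) x (Uper k)) as (y & Hy & E).
      rewrite E. apply Hb, Hy.
  - intros x. unfold ucoef. rewrite z0, Rmult_1_r. apply exp_pos.
Qed.

(** Multiplication by [y] followed by differentiation multiplies the coefficient of order [k] by
    [S k], so the recurrence for the [u k] is the equation [U_phi + (rho G U)_rho = 0], coefficient
    by coefficient. *)
Lemma multiplier_equation (g u : nat -> R -> R) :
  analytic_coeffs g -> analytic_coeffs u ->
  (forall k x, is_derive (u k) x
     (- INR (S k) * PS_mult (fun j => g j x) (fun j => u j x) k)) ->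
  exists d, 0 < d /\ forall x t, Rabs t < d ->
    is_derive (fun y => y * (coeff_sum g x y * coeff_sum u x y)) t
      (- coeff_sum (fun k => Derive (u k)) x t).
Proof.
  intros Ag Au Du.
  set (b := fun n x => PS_mult (fun k => g k x) (fun k => u k x) n).
  destruct (coeff_sum_mult g u Ag Au) as (d1 & Hd1 & E1).
  destruct (analytic_coeffs_regular b (analytic_coeffs_mult g u Ag Au))
    as (d2 & _ & Hd2 & _ & HC & _).
  exists (Rmin d1 d2). split; [apply Rmin_glb_lt; assumption|]. intros x t Ht.
  pose proof (Rmin_l d1 d2). pose proof (Rmin_r d1 d2).
  apply (is_derive_ext_loc (fun y => PSeries (PS_incr_1 (fun k => b k x)) y)).
  - assert (Hpos : 0 < d1 - Rabs t) by lra. exists (mkposreal _ Hpos).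
    intros y Hy. change (Rabs (y - t) < d1 - Rabs t) in Hy.
    rewrite PSeries_incr_1. f_equal. apply E1.
    replace y with ((y - t) + t) by ring. eapply Rle_lt_trans; [apply Rabs_triang|]. lra.
  - eapply is_derive_eq.
    + apply is_derive_PSeries. rewrite CV_radius_incr_1. apply HC. lra.
    + unfold coeff_sum. rewrite <- PSeries_opp. apply PSeries_ext. intros k.
      unfold PS_derive, PS_incr_1, PS_opp.
      rewrite (is_derive_unique _ _ _ (Du k x)). unfold b, opp; simpl. ring.
Qed.

Theorem proposition1 (X : analytic_field) (p q : nat) (r : Z) (s : R)
    (X_center : is_center X)
    (pq_weight : newton_weight X p q)
    (r_degree : leading_degree X p q r)
    (s_sign : s = 1 \/ s = -1)
    (counterclockwise : forall phi : R, 0 <= polar_Theta X p q r s phi 0)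
    (Omega_empty : forall phi : R, ~ characteristic_directions X p q r s phi) :
  exists (eps : R) (V : R -> R -> R),
    0 < eps /\ in_polar_domain X p q eps /\
    inverse_integrating_factor (polar_Theta X p q r s) (polar_R X p q r s) eps V /\
    analytic_on (cylinder eps) V /\
    exists m : Z, (0 <= m)%Z /\ leading_exponent V eps m.
Proof.
  destruct pq_weight as (Hp & Hq & _).
  assert (Hs : s * s = 1) by (destruct s_sign as [-> | ->]; ring).
  set (th := theta_coef X p q r s).
  destruct (polar_coeffs_analytic X p q r s Hp Hq) as [At _]. fold th in At.
  destruct (polar_field_expansion X p q r s Hp Hq r_degree) as (d0 & Hd0 & Hexp).
  fold th in Hexp.
  assert (Hth0 : forall x, 0 < th 0%nat x).
  { intros x. assert (E : polar_Theta X p q r s x 0 = th 0%nat x).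
    { destruct (Hexp x 0) as (_ & E & _); [rewrite Rabs_R0; exact Hd0|].
      rewrite E. apply PSeries_0. }
    specialize (counterclockwise x). specialize (Omega_empty x).
    unfold characteristic_directions in Omega_empty. rewrite E in *.
    destruct counterclockwise as [H|H]; [exact H|]. symmetry in H. contradiction. }
  destruct (periodic_lower_bound (th 0%nat)) as (c & Hc & Hth); auto.
  { apply polar_coeffs_periodic. } { intros; apply analytic_coeffs_derivable, At. }
  destruct (slope_coef_analytic X p q r s c Hp Hq Hc Hth) as (Ag & d1 & Hd1 & E1).
  set (g := slope_coef X p q r s) in *.
  destruct (multiplier_exists X p q r s c Hp Hq Hs X_center r_degree Hc Hth)
    as (u & Au & Uper & U0 & Du). fold g in Du.
  destruct (periodic_lower_bound (u 0%nat)) as (cu & Hcu & Hu); auto.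
  { intros; apply analytic_coeffs_derivable, Au. }
  destruct (multiplier_equation g u Ag Au Du) as (d2 & Hd2 & E2).
  destruct (coeff_sum_inv u cu Hcu Hu Au) as (d3 & Hd3 & E3).
  assert (Ai := analytic_coeffs_inv u cu Hcu Hu Au).
  set (iu := fun n x => inv_seq (fun k => u k x) n) in *.
  destruct (coeff_sum_mult th iu At Ai) as (d4 & Hd4 & E4).
  assert (Av := analytic_coeffs_mult th iu At Ai).
  set (v := fun n x => PS_mult (fun k => th k x) (fun k => iu k x) n) in *.
  destruct (analytic_coeffs_regular th At) as (d5 & K5 & Hd5 & HK5 & _ & _ & Hth5 & _).
  destruct (analytic_coeffs_regular v Av) as (d6 & _ & Hd6 & _ & Cv & Dv & _ & Anv & C1v).
  destruct (analytic_coeffs_regular u Au) as (d7 & _ & Hd7 & _ & _ & Duu & _).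
  (* The last condition keeps [Theta] at least [c / 2] on the cylinder, whence [V] has no zeros
     there. *)
  assert (Heps : exists eps, 0 < eps /\ eps <= d0 /\ eps <= d1 /\ eps <= d2 /\ eps <= d3 /\
     eps <= d4 /\ eps <= d5 /\ eps <= d6 /\ eps <= d7 /\ K5 * eps <= c / 2).
  { assert (Hq1 : 0 < c / (2 * (K5 + 1))) by (apply Rdiv_lt_0_compat; lra).
    assert (Hmin : forall y (P : R -> Prop), 0 < y ->
       (exists e, 0 < e /\ forall e', 0 < e' <= e -> P e') ->
       exists e, 0 < e /\ forall e', 0 < e' <= e -> e' <= y /\ P e').
    { intros y P Hy (e & He & HP). exists (Rmin y e). split; [apply Rmin_glb_lt; assumption|].
      intros e' He'. pose proof (Rmin_l y e). pose proof (Rmin_r y e).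
      split; [lra|apply HP; lra]. }
    enough (exists e, 0 < e /\ forall e', 0 < e' <= e -> e' <= d0 /\ e' <= d1 /\ e' <= d2 /\
      e' <= d3 /\ e' <= d4 /\ e' <= d5 /\ e' <= d6 /\ e' <= d7 /\ K5 * e' <= c / 2)
      as (e & He & H).
    { exists e. split; [exact He|]. apply H. lra. }
    do 8 (apply Hmin; [assumption|]).
    exists (c / (2 * (K5 + 1))). split; [exact Hq1|]. intros e' He'.
    apply Rle_trans with ((K5 + 1) * (c / (2 * (K5 + 1)))).
    - apply Rmult_le_compat; lra.
    - right; field; lra. }
  destruct Heps as (eps & Heps & L0 & L1 & L2 & L3 & L4 & L5 & L6 & L7 & LK).
  set (V := coeff_sum v). set (U := coeff_sum u). set (G := coeff_sum g).
  (* With [HR], the field is [V] times [(U, t * G * U)], whose divergence vanishes by [E2]. *)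
  assert (HT : forall x t, Rabs t < eps -> polar_Theta X p q r s x t = V x t * U x t).
  { intros x t Ht. destruct (Hexp x t) as (_ & ET & _); [lra|].
    rewrite ET. unfold V. rewrite E4 by lra.
    transitivity (coeff_sum th x t * 1); [ring|]. rewrite <- (E3 x t) by lra. unfold U. ring. }
  assert (HR : forall x t, Rabs t < eps ->
            polar_R X p q r s x t = t * (V x t * (G x t * U x t))).
  { intros x t Ht. destruct (Hexp x t) as (_ & ET & ER); [lra|].
    rewrite ER, E1 by lra. fold th. rewrite <- ET, HT by exact Ht. unfold G. ring. }
  assert (Hnonzero : forall x t, 0 <= t < eps -> V x t <> 0).
  { intros x t Ht E. assert (Habs : Rabs t = t) by (apply Rabs_pos_eq; lra).
    assert (H5 := Hth5 x t ltac:(lra)). rewrite Habs in H5.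
    assert (HT' := HT x t ltac:(lra)). rewrite E, Rmult_0_l in HT'.
    destruct (Hexp x t) as (_ & ET & _); [lra|]. rewrite <- ET, HT' in H5.
    specialize (Hth x). apply Rabs_le_between in H5. nra. }
  exists eps, V. split; [exact Heps|]. split; [|split; [|split]].
  - intros phi rho Hc'. unfold cylinder in Hc'; simpl in Hc'.
    apply (Hexp phi rho). rewrite Rabs_pos_eq; lra.
  - split; [|split; [|split]].
    + intros phi rho _. unfold V, coeff_sum, v, iu. apply PSeries_ext. intros n.
      f_equal.
      * apply functional_extensionality; intros k. apply polar_coeffs_periodic.
      * apply functional_extensionality; intros k. f_equal.
        apply functional_extensionality; intros j. apply Uper.
    + exists 0, (eps / 2). split; [lra|]. apply Hnonzero. lra.
    + intros phi rho Hrho. apply C1v. rewrite Rabs_pos_eq; lra.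
    + intros x t Ht. assert (Habs : Rabs t = t) by (apply Rabs_pos_eq; lra).
      assert (Hloc : locally t (fun y => Rabs y < eps)).
      { assert (Hpos : 0 < eps - t) by lra. exists (mkposreal _ Hpos).
        intros y Hy. change (Rabs (y - t) < eps - t) in Hy.
        replace y with ((y - t) + t) by ring. eapply Rle_lt_trans; [apply Rabs_triang|]. lra. }
      assert (Vx := Dv x t ltac:(lra)). assert (Ux := Duu x t ltac:(lra)).
      assert (Vt := is_derive_PSeries _ _ (Cv x t ltac:(lra))).
      assert (PDE := E2 x t ltac:(lra)).
      change (is_derive (V x) t (PSeries (PS_derive (fun j => v j x)) t)) in Vt.
      change (is_derive (fun y => V y t) x (coeff_sum (fun j => Derive (v j)) x t)) in Vx.
      change (is_derive (fun y => U y t) x (coeff_sum (fun j => Derive (u j)) x t)) in Ux.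
      change (is_derive (fun y => y * (G x y * U x y)) t
                (- coeff_sum (fun j => Derive (u j)) x t)) in PDE.
      set (vx := coeff_sum (fun j => Derive (v j)) x t) in *.
      set (ux := coeff_sum (fun j => Derive (u j)) x t) in *.
      set (vt := PSeries (PS_derive (fun j => v j x)) t) in *.
      unfold lie_derivative, divergence.
      replace (Derive (fun y => V y t) x) with vx
        by (symmetry; apply is_derive_unique, Vx).
      replace (Derive (fun y => V x y) t) with vt
        by (symmetry; apply is_derive_unique, Vt).
      replace (Derive (fun y => polar_Theta X p q r s y t) x)
        with (vx * U x t + V x t * ux).
      2:{ symmetry. apply is_derive_unique.
          apply (is_derive_Rext (fun y => V y t * U y t)).
          - intros y. symmetry. apply HT. lra.
          - apply (is_derive_Rmult (fun y => V y t) (fun y => U y t)); assumption. }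
      replace (Derive (fun y => polar_R X p q r s x y) t)
        with (vt * (t * (G x t * U x t)) + V x t * (- ux)).
      (* The product rule gives [div Z = V_x * U + V_t * (t * G * U)], the terms with [V * ux]
         cancelling; multiplied by [V] this is the derivative of [V] along the field. *)
      2:{ symmetry. apply is_derive_unique.
          apply (is_derive_ext_loc (fun y => V x y * (y * (G x y * U x y)))).
          - revert Hloc. apply filter_imp. intros y Hy.
            rewrite HR by exact Hy. change (V x y * (y * (G x y * U x y))
              = y * (V x y * (G x y * U x y)) :> R). ring.
          - apply (is_derive_Rmult (V x) (fun y => y * (G x y * U x y))); assumption. }
      rewrite HT, HR by lra. ring.
  - apply (analytic_on_subset _ (cylinder d6)); [|exact Anv].
    intros z. unfold cylinder. lra.
  (* The leading coefficient is [theta_0 / u_0], a quotient of two positive functions. *)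
  - exists 0%Z. split; [lia|].
    exists (fun j => v (Z.to_nat j)). split.
    + exists 0. change (PS_mult (fun k => th k 0) (fun k => iu k 0) 0 <> 0).
      unfold PS_mult, iu, inv_seq. simpl.
      apply Rmult_integral_contrapositive_currified.
      * specialize (Hth0 0). lra.
      * apply Rinv_neq_0_compat. specialize (U0 0). lra.
    + intros phi rho Hrho.
      apply (is_series_Rext (fun k => v k phi * rho ^ k)).
      * intros k. rewrite Z.add_0_l, Nat2Z.id, <- pow_powerRZ. reflexivity.
      * apply is_pseries_R. apply PSeries_correct, CV_radius_inside, Cv.
        rewrite Rabs_pos_eq; lra.
Qed.
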